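(* Let $\Omega \subset \mathbb{C}$ be a bounded open domain (i.e. a bounded, nonempty, connected open set). If $\varphi$ is a nonconstant bounded analytic function on $\Omega$ and $\psi$ is a bounded measurable function on $\Omega$ such that the Toeplitz operators $T_\varphi$ and $T_\psi$ on the Bergman space $L_a^2(\Omega)$ commute, i.e. $T_\varphi T_\psi = T_\psi T_\varphi$, then $\psi$ is analytic on $\Omega$ (that is, $\psi$ agrees almost everywhere with respect to area measure with an analytic function on $\Omega$).
   Context: Let $dA$ denote area (two-dimensional Lebesgue) measure on $\Omega$. The Bergman space $L_a^2(\Omega)$ is the (closed) subspace of $L^2(\Omega, dA)$ consisting of the square-integrable functions that are analytic on $\Omega$. Let $P$ be the orthogonal projection of $L^2(\Omega,dA)$ onto $L_a^2(\Omega)$. For a bounded measurable complex-valued function $\varphi$ on $\Omega$, the Toeplitz operator $T_\varphi$ with symbol $\varphi$ is the operator on $L_a^2(\Omega)$ defined by $T_\varphi(f) = P(\varphi f)$. As usual, bounded measurable functions are identified when they agree almost everywhere with respect to $dA$. *)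

(* Defs.v *)
From HB Require Import structures.
From mathcomp Require Import all_boot all_order all_algebra.
From mathcomp Require Import complex.
From mathcomp Require Import all_classical all_reals all_analysis.

Set Implicit Arguments.
Unset Strict Implicit.
Unset Printing Implicit Defensive.

Import Order.TTheory GRing.Theory Num.Theory.
Import numFieldNormedType.Exports.

Local Open Scope classical_set_scope.
Local Open Scope ring_scope.
Local Open Scope complex_scope.

(* R[i] carries the topology of its modulus and is normed over itself, so that
   [derivable f z 1] below is complex differentiability. *)
HB.instance Definition _ (R : realType) := NormedModule.copy R[i] R[i]^o.

Fact complex_display : measure_display. Proof. by []. Qed.

Section AreaMeasure.
Context {R : realType}.

Definition complex_of_pair (p : R * R) : R[i] := p.1 +i* p.2.

(* Borel sets of the plane, transported from R * R. *)
Let measC (A : set R[i]) := measurable (complex_of_pair @^-1` A).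

Let measC0 : measC set0.
Proof. by rewrite /measC preimage_set0. Qed.

Let measCC A : measC A -> measC (~` A).
Proof. by rewrite /measC -preimage_setC => /measurableC. Qed.

Let measC_bigcup (F : (set R[i])^nat) :
  (forall i, measC (F i)) -> measC (\bigcup_i F i).
Proof.
by move=> mF; rewrite /measC preimage_bigcup; exact: bigcupT_measurable.
Qed.

HB.instance Definition _ := @isMeasurable.Build complex_display R[i]
  measC measC0 measCC measC_bigcup.

Lemma measurable_complex_of_pair : measurable_fun [set: R * R] complex_of_pair.
Proof. by move=> _ A mA; rewrite setTI. Qed.

Definition area : set R[i] -> \bar R :=
  pushforward (@lebesgue_measure R \x @lebesgue_measure R)%E complex_of_pair.

HB.instance Definition _ := Measure.copy area
  (measure_function_pushforward__canonical__measure_function_Measure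
     (@lebesgue_measure R \x @lebesgue_measure R)%E measurable_complex_of_pair).

End AreaMeasure.

Section Bergman.
Context {R : realType}.
Implicit Types (D : set R[i]) (f g phi : R[i] -> R[i]).

Definition domain D := [/\ open D, connected D & D !=set0].

Definition analytic_on D f := forall z, D z -> derivable f z 1.

(* Elements of L^2(D) and of the Bergman space are represented by functions on
   the whole plane, of which only the values on D are relevant. *)
Definition square_integrable D f :=
  measurable_fun D f /\
  (\int[area]_(z in D) ((Normc.normc (f z)) ^+ 2)%:E < +oo)%E.

Definition complex_integral D f : R[i] :=
  (\int[area]_(z in D) complex.Re (f z))%R +i*
  (\int[area]_(z in D) complex.Im (f z))%R.

Definition inner D f g : R[i] := complex_integral D (fun z => f z * (g z)^*).

Definition bergman D : set (R[i] -> R[i]) :=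
  [set f | square_integrable D f /\ analytic_on D f].

(* The function of the Bergman space, unique on an open D, from which
   g \in L^2(D) differs by a function orthogonal to the Bergman space; it
   exists because the Bergman space is closed, so the default value 0 is
   never used for such g. *)
Definition bergman_proj D g : R[i] -> R[i] :=
  xget (cst 0) [set h | bergman D h /\
    forall k, bergman D k -> inner D (g \- h) k = 0].

Definition toeplitz D phi f : R[i] -> R[i] := bergman_proj D (phi \* f).

End Bergman.

(* Main.v *)
From HB Require Import structures.
Require Import Defs.
From mathcomp Require Import all_boot all_order all_algebra.
From mathcomp Require Import complex.
From mathcomp Require Import all_classical all_reals all_analysis.
From mathcomp Require Import measurable_realfun.
From mathcomp Require Import ring lra.

(* Put [g = T_psi 1] and [v = conj (psi - g)].  Commutation
   gives [T_psi (phi ^ n) = phi ^ n * g] by induction, so that [v] annihilates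
   all products [conj (phi) ^ n * phi ^ j * k] with [k] bounded and analytic.
   For [a] in [Omega] the quotient [(phi - phi a) / (z - a)] is such a [k], and
   geometric sums in [|phi - phi a| ^ 2] turn it into [1 / (z - a)]: the Cauchy
   transform of [v] vanishes at every [a] in [Omega].  By Fubini and the
   Cauchy-Pompeiu formula [v] annihilates every test function supported in
   [Omega], hence [v = 0] and [psi = g] almost everywhere. *)

Set Implicit Arguments.
Unset Strict Implicit.
Unset Printing Implicit Defensive.

Import Order.TTheory GRing.Theory Num.Theory.
Import numFieldNormedType.Exports.
Import Normc.

Local Open Scope classical_set_scope.
Local Open Scope ring_scope.
Local Open Scope complex_scope.


(** Cauchy-Pompeiu, the analyticity of the quotient, the smallness of level sets and the existence
    of the projection are all derived here from area integrals, without contours or power series.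
    The substitute for Green's formula is translation invariance: the integral of a directional
    derivative of a compactly supported function is a limit of integrals of difference quotients,
    which are zero. As [derivable] gives no continuity of the derivative, a Goursat argument is
    required; indicators of boxes are not smooth, so the bisection runs over quadratic B-splines,
    which refine themselves exactly. Cauchy's formula then becomes integration against a bounded
    kernel on an annulus. The factor usually written with pi stays abstract as [kappa0]; only
    [kappa0 != 0] matters. The conjugate in [v] makes the orthogonality relations bilinear, so that
    [1 / (z - a)] can be reached as a limit of test functions. Nonconstancy of [phi] is used once,
    in the last limit: where [phi = phi a] the geometric sums stay zero, so this set has to be
    null. *)

Section ComplexPlane.
Context {R : realType}.
Implicit Types z w : R[i].

Lemma normcE z : `|z| = (normc z)%:C.
Proof. by []. Qed.

Lemma normc_ge0 z : 0 <= normc z.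
Proof. by case: z => a b; exact: sqrtr_ge0. Qed.

Lemma normc_le0 z : (normc z <= 0) = (z == 0).
Proof.
apply/idP/eqP => [h|->]; last by rewrite normc0.
by apply: eq0_normc; apply/eqP; rewrite eq_le h normc_ge0.
Qed.

Lemma normc_gt0 z : (0 < normc z) = (z != 0).
Proof. by rewrite ltNge normc_le0. Qed.

Lemma normcD z w : normc (z + w) <= normc z + normc w.
Proof. exact: le_normcD. Qed.

Lemma normcB z w : normc (z - w) <= normc z + normc w.
Proof. by rewrite -(normcN w); exact: normcD. Qed.

Lemma normc_distC z w : normc (z - w) = normc (w - z).
Proof. by rewrite -normcN opprB. Qed.

Lemma normc_distD z w u : normc (z - u) <= normc (z - w) + normc (w - u).
Proof. by rewrite (_ : z - u = (z - w) + (w - u)) ?normcD//; ring. Qed.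

Lemma sqr_normc z : normc z ^+ 2 = complex.Re z ^+ 2 + complex.Im z ^+ 2.
Proof. by case: z => a b; rewrite sqr_sqrtr// addr_ge0// sqr_ge0. Qed.

Lemma normcX z n : normc (z ^+ n) = normc z ^+ n.
Proof. by elim: n => [|n IH]; rewrite ?expr0 ?normc1// !exprS normcM IH. Qed.

Lemma normc_conj z : normc z^* = normc z.
Proof. by case: z => a b /=; rewrite sqrrN. Qed.

Lemma normc_real (x : R) : normc x%:C = `|x|.
Proof. by rewrite /= expr0n addr0 sqrtr_sqr. Qed.

Lemma normc_imag (x : R) : normc x*i = `|x|.
Proof. by rewrite /= expr0n add0r sqrtr_sqr. Qed.

Lemma normci : normc ('i : R[i]) = 1.
Proof. by rewrite normc_imag normr1. Qed.

Lemma normr_Re_le z : `|complex.Re z| <= normc z.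
Proof.
by rewrite -ler_sqr ?nnegrE ?normc_ge0// sqr_normc real_normK ?num_real// lerDl sqr_ge0.
Qed.

Lemma normr_Im_le z : `|complex.Im z| <= normc z.
Proof.
by rewrite -ler_sqr ?nnegrE ?normc_ge0// sqr_normc real_normK ?num_real// lerDr sqr_ge0.
Qed.

Lemma normc_le_ReIm z : normc z <= `|complex.Re z| + `|complex.Im z|.
Proof.
rewrite -ler_sqr ?nnegrE ?normc_ge0 ?addr_ge0// sqr_normc.
rewrite sqrrD !real_normK ?num_real// addrAC lerDl.
by rewrite mulrn_wge0 // mulr_ge0.
Qed.

Lemma cReD z w : complex.Re (z + w) = complex.Re z + complex.Re w.
Proof. by case: z w => ? ? []. Qed.
Lemma cImD z w : complex.Im (z + w) = complex.Im z + complex.Im w.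
Proof. by case: z w => ? ? []. Qed.
Lemma cReN z : complex.Re (- z) = - complex.Re z.
Proof. by case: z. Qed.
Lemma cImN z : complex.Im (- z) = - complex.Im z.
Proof. by case: z. Qed.
Lemma cReM z w : complex.Re (z * w) =
  complex.Re z * complex.Re w - complex.Im z * complex.Im w.
Proof. by case: z w => ? ? []. Qed.
Lemma cImM z w : complex.Im (z * w) =
  complex.Re z * complex.Im w + complex.Im z * complex.Re w.
Proof. by case: z w => ? ? []. Qed.
Lemma cReJ z : complex.Re z^* = complex.Re z.
Proof. by case: z. Qed.
Lemma cImJ z : complex.Im z^* = - complex.Im z.
Proof. by case: z. Qed.
Definition ReImE := (cReD, cImD, cReN, cImN, cReM, cImM, cReJ, cImJ).

Lemma eq_ReIm z w : complex.Re z = complex.Re w -> complex.Im z = complex.Im w -> z = w.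
Proof. by case: z w => ? ? [? ?] /= -> ->. Qed.

Lemma mulcJ z : z * z^* = (normc z ^+ 2)%:C.
Proof. by apply: eq_ReIm; rewrite ReImE ?cReJ ?cImJ ?sqr_normc/=; ring. Qed.

Lemma gt0_complexE (e : R[i]) : 0 < e -> exists2 d : R, 0 < d & e = d%:C.
Proof.
by case: e => a b; rewrite ltcE /= => /andP[/eqP-> a0]; exists a.
Qed.

Lemma nbhs_normcP z (A : set R[i]) :
  nbhs z A <-> exists2 e : R, 0 < e & forall w, normc (w - z) < e -> A w.
Proof.
split=> [/nbhs_ballP[e /= e0 H]|[e e0 H]].
  have [d d0 de] := gt0_complexE e0.
  exists d => // w zw; apply: H; rewrite -ball_normE /= normcE de ltcR.
  by rewrite normc_distC.
apply/nbhs_ballP; exists e%:C; first by rewrite /= ltcR.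
by move=> w; rewrite -ball_normE /= normcE ltcR normc_distC => /H.
Qed.

Lemma open_normcP (A : set R[i]) :
  open A <-> forall z, A z ->
    exists2 e : R, 0 < e & forall w, normc (w - z) < e -> A w.
Proof.
rewrite openE; split=> H z /H; first by move=> /nbhs_normcP.
by move=> h; apply/nbhs_normcP.
Qed.

Lemma bounded_normcP T (A : set T) (f : T -> R[i]) :
  [bounded f z | z in A] -> exists2 M : R, 0 < M & forall x, A x -> normc (f x) <= M.
Proof.
move=> /ex_strict_bound_gt0[M M0 H].
have [d d0 de] := gt0_complexE M0; exists d => // x Ax.
by have := H x Ax; rewrite /= normcE de ltcR => /ltW.
Qed.

Lemma boundedset_normcP (A : set R[i]) :
  bounded_set A -> exists2 M : R, 0 < M & forall z, A z -> normc z <= M.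
Proof. exact: bounded_normcP. Qed.

(** Comparing the remainder with [e * normc h], instead of dividing by [h], includes [h = 0] and
    keeps the value [L] at hand for the product rule and for affine approximation. *)
Definition cderiv (f : R[i] -> R[i]) z (L : R[i]) :=
  forall e : R, 0 < e -> exists2 d : R, 0 < d &
    forall h, normc h < d -> normc (f (z + h) - f z - L * h) <= e * normc h.

Lemma derivable_cderivP (f : R[i] -> R[i]) z :
  derivable f z 1 <-> exists L, cderiv f z L.
Proof.
split=> [df|[L H]].
  exists ('D_1 f z) => e e0.
  move: (df); rewrite /derivable => /cvgrPdist_le/(_ e%:C).
  rewrite ltcR => /(_ e0); rewrite /dnbhs /within /= => /nbhs_normcP[d d0 H].
  exists d => // h hd.
  have [->|h0] := eqVneq h 0; first by rewrite addr0 subrr mulr0 subrr normc0 mulr0.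
  have := H h; rewrite subr0 => /(_ hd h0); rewrite normcE lecR.
  rewrite /GRing.scale /= mulr1 => K.
  rewrite -(ler_pM2r (_ : 0 < (normc h)^-1)) ?invr_gt0 ?normc_gt0//.
  rewrite mulfK ?gt_eqF ?normc_gt0// -normcV -normcM.
  apply: le_trans K; rewrite -[leRHS]normcN le_eqVlt; apply/orP; left; apply/eqP.
  by congr normc; rewrite [h + z]addrC /derive; set L := lim _; field.
apply/cvg_ex; exists L; apply/cvgrPdist_le => e e0.
have [d d0 ->] := gt0_complexE e0.
have [r r0 K] := H d d0.
rewrite /dnbhs /within /=; apply/nbhs_normcP; exists r => // h; rewrite subr0 => hr h0.
rewrite normcE lecR /GRing.scale /= mulr1.
rewrite -(ler_pM2r (_ : 0 < normc h)) ?normc_gt0// -normcM.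
apply: le_trans (K h hr); rewrite -normcN le_eqVlt; apply/orP; left; apply/eqP.
by congr normc; rewrite [h + z]addrC; field.
Qed.

Lemma analytic_onP D (f : R[i] -> R[i]) :
  analytic_on D f <-> forall z, D z -> exists L, cderiv f z L.
Proof. by split=> H z /H /derivable_cderivP. Qed.

End ComplexPlane.

(** * Borel measurability in the complex plane *)

Section ComplexMeasurability.
Context {R : realType}.

Lemma measurable_complex_Re : measurable_fun setT (@complex.Re R).
Proof.
move=> _ A mA; rewrite setTI.
rewrite -[measurable _]/(measurable ((@complex_of_pair R) @^-1` _)).
rewrite -comp_preimage -[_ \o _]/(@fst R R) -[_ @^-1` _]setTI.
exact: measurable_fst.
Qed.

Lemma measurable_complex_Im : measurable_fun setT (@complex.Im R).
Proof.
move=> _ A mA; rewrite setTI.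
rewrite -[measurable _]/(measurable ((@complex_of_pair R) @^-1` _)).
rewrite -comp_preimage -[_ \o _]/(@snd R R) -[_ @^-1` _]setTI.
exact: measurable_snd.
Qed.

Lemma measurable_invr : measurable_fun setT (@GRing.inv R).
Proof.
(* Inversion is discontinuous at [0], where its value is [0] by convention, so this point is split
   off. *)
rewrite (_ : setT = [set 0] `|` ~` [set (0 : R)]); last by rewrite setUv.
apply/measurable_funU => //; first exact: measurableC.
split; first by apply: measurable_fun_set1.
apply: subspace_continuous_measurable_fun; first exact: measurableC.
apply: continuous_in_subspaceT => x /set_mem /= /eqP x0.
exact: inv_continuous.
Qed.

Lemma measurable_sqrtr : measurable_fun setT (@Num.sqrt R).
Proof. by apply: continuous_measurable_fun; exact: sqrt_continuous. Qed.

Section Ops.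
Context d (T : measurableType d).
Implicit Types f g : T -> R[i].

Lemma measurable_ReIm (D : set T) f : measurable_fun D f ->
  measurable_fun D (@complex.Re R \o f) /\ measurable_fun D (@complex.Im R \o f).
Proof.
move=> mf; split.
- exact: (measurableT_comp measurable_complex_Re mf).
- exact: (measurableT_comp measurable_complex_Im mf).
Qed.

Lemma ReIm_measurable f : measurable_fun setT (@complex.Re R \o f) ->
  measurable_fun setT (@complex.Im R \o f) -> measurable_fun setT f.
Proof.
move=> mr mi; rewrite (_ : f = complex_of_pair \o
  (fun x => (complex.Re (f x), complex.Im (f x)))).
  by apply: (measurableT_comp measurable_complex_of_pair); exact: measurable_fun_pair.
by apply/funext => x /=; rewrite /complex_of_pair; case: (f x).
Qed.

Lemma measurable_complexD f g : measurable_fun setT f -> measurable_fun setT g ->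
  measurable_fun setT (fun x => f x + g x).
Proof.
move=> /measurable_ReIm[f1 f2] /measurable_ReIm[g1 g2]; apply: ReIm_measurable.
- by rewrite (_ : _ \o _ = (@complex.Re R \o f) \+ (@complex.Re R \o g));
    [exact: measurable_funD|apply/funext => x /=; rewrite cReD].
- by rewrite (_ : _ \o _ = (@complex.Im R \o f) \+ (@complex.Im R \o g));
    [exact: measurable_funD|apply/funext => x /=; rewrite cImD].
Qed.

Lemma measurable_complexM f g : measurable_fun setT f -> measurable_fun setT g ->
  measurable_fun setT (fun x => f x * g x).
Proof.
move=> /measurable_ReIm[f1 f2] /measurable_ReIm[g1 g2]; apply: ReIm_measurable.
- rewrite (_ : _ \o _ = (@complex.Re R \o f) \* (@complex.Re R \o g) \-
    (@complex.Im R \o f) \* (@complex.Im R \o g)).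
    by apply: measurable_funB; exact: measurable_funM.
  by apply/funext => x /=; rewrite cReM.
- rewrite (_ : _ \o _ = (@complex.Re R \o f) \* (@complex.Im R \o g) \+
    (@complex.Im R \o f) \* (@complex.Re R \o g)).
    by apply: measurable_funD; exact: measurable_funM.
  by apply/funext => x /=; rewrite cImM.
Qed.

Lemma measurable_complexN f : measurable_fun setT f ->
  measurable_fun setT (fun x => - f x).
Proof.
move=> /measurable_ReIm[f1 f2]; apply: ReIm_measurable.
- by rewrite (_ : _ \o _ = \- (@complex.Re R \o f));
    [exact: measurable_funN|apply/funext => x /=; rewrite cReN].
- by rewrite (_ : _ \o _ = \- (@complex.Im R \o f));
    [exact: measurable_funN|apply/funext => x /=; rewrite cImN].
Qed.

Lemma measurable_complexB f g : measurable_fun setT f -> measurable_fun setT g ->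
  measurable_fun setT (fun x => f x - g x).
Proof. by move=> mf mg; apply: measurable_complexD => //; exact: measurable_complexN. Qed.

Lemma measurable_complexX f n : measurable_fun setT f ->
  measurable_fun setT (fun x => f x ^+ n).
Proof.
move=> mf; elim: n => [|n IH]; first exact: measurable_cst.
rewrite (_ : (fun x => _) = (fun x => f x * f x ^+ n)); last first.
  by apply/funext => x; rewrite exprS.
exact: measurable_complexM.
Qed.

Lemma measurable_complexJ f : measurable_fun setT f ->
  measurable_fun setT (fun x => (f x)^*).
Proof.
move=> /measurable_ReIm[f1 f2]; apply: ReIm_measurable.
- by rewrite (_ : _ \o _ = @complex.Re R \o f)//; apply/funext => x /=; rewrite cReJ.
- by rewrite (_ : _ \o _ = \- (@complex.Im R \o f));
    [exact: measurable_funN|apply/funext => x /=; rewrite cImJ].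
Qed.

Lemma measurable_real_complex (f : T -> R) : measurable_fun setT f ->
  measurable_fun setT (fun x => (f x)%:C).
Proof. by move=> mf; apply: ReIm_measurable => //; exact: measurable_cst. Qed.

Lemma measurable_normc f : measurable_fun setT f ->
  measurable_fun setT (fun x => normc (f x)).
Proof.
move=> /measurable_ReIm[f1 f2].
rewrite (_ : (fun _ => _) = Num.sqrt \o
  (((@complex.Re R \o f) \* (@complex.Re R \o f)) \+ ((@complex.Im R \o f) \* (@complex.Im R \o f)))).
  apply: (measurableT_comp measurable_sqrtr).
  by apply: measurable_funD; exact: measurable_funM.
by apply/funext => x /=; case: (f x).
Qed.

(** Via [z^-1 = conj z / |z| ^ 2], which also holds at [0] with the convention [0^-1 = 0]. *)
Lemma measurable_complexV f : measurable_fun setT f ->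
  measurable_fun setT (fun x => (f x)^-1).
Proof.
move=> mf; rewrite (_ : (fun _ => _) = fun x => (f x)^* * ((normc (f x) ^+ 2)^-1)%:C).
  apply: measurable_complexM; first exact: measurable_complexJ.
  apply: measurable_real_complex; apply: (measurableT_comp measurable_invr).
  by apply: measurable_funX; exact: measurable_normc.
apply/funext => x; have [->|fx0] := eqVneq (f x) 0.
  by rewrite invr0 conjC0 mul0r.
apply: (mulfI fx0); rewrite mulfV// mulrA mulcJ -rmorphM mulfV//.
by rewrite expf_neq0// gt_eqF// normc_gt0.
Qed.

Lemma measurable_cut (D : set T) f : measurable D -> measurable_fun D f ->
  measurable_fun setT (fun x => if x \in D then f x else 0).
Proof.
move=> mD /measurable_ReIm[f1 f2]; apply: ReIm_measurable.
- rewrite (_ : _ \o _ = (@complex.Re R \o f) \_ D).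
    by apply/(measurable_restrictT _ mD).
  by apply/funext => x /=; rewrite /patch; case: ifP.
- rewrite (_ : _ \o _ = (@complex.Im R \o f) \_ D).
    by apply/(measurable_restrictT _ mD).
  by apply/funext => x /=; rewrite /patch; case: ifP.
Qed.

End Ops.

Definition rect (a b c e : R) : set R[i] :=
  [set z | a < complex.Re z < b /\ c < complex.Im z < e].

Lemma rect_preimage a b c e :
  (@complex_of_pair R) @^-1` rect a b c e = `]a, b[%classic `*` `]c, e[%classic.
Proof. by apply/seteqP; split => -[x y] /=; rewrite !in_itv /=. Qed.

Lemma measurable_rect a b c e : measurable (rect a b c e).
Proof.
rewrite -[measurable _]/(measurable ((@complex_of_pair R) @^-1` _)) rect_preimage.
exact: measurableX.
Qed.

Lemma area_rect a b c e : a <= b -> c <= e ->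
  area (rect a b c e) = ((b - a) * (e - c))%:E.
Proof.
move=> ab ce; rewrite /area /pushforward rect_preimage product_measure1E//.
rewrite [X in (X * _)%E]lebesgue_measure_itv [X in (_ * X)%E]lebesgue_measure_itv.
rewrite /= !lte_fin.
have [ab'|] := ltP a b; last first.
  by move=> ba; rewrite mul0e (_ : b - a = 0) ?mul0r//; lra.
have [ce'|] := ltP c e; first by rewrite -!EFinB -EFinM.
by move=> ba; rewrite mule0 (_ : e - c = 0) ?mulr0//; lra.
Qed.

(* The squares with rational center and radius form a countable base. *)
Definition ratsquare (q : rat * rat * rat) : set R[i] :=
  rect (ratr q.1.1 - ratr q.2) (ratr q.1.1 + ratr q.2)
       (ratr q.1.2 - ratr q.2) (ratr q.1.2 + ratr q.2).

Lemma ratsquare_base (z : R[i]) (e : R) : 0 < e ->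
  exists q, ratsquare q z /\ forall w, ratsquare q w -> normc (w - z) < e.
Proof.
move=> e0; set x := complex.Re z; set y := complex.Im z.
have /rat_in_itvoo[r] : e / 8 < e / 4 by lra.
rewrite in_itv /= => /andP[r1 r2].
have /rat_in_itvoo[q1] : x < x + e / 8 by lra.
rewrite in_itv /= => /andP[q11 q12].
have /rat_in_itvoo[q2] : y < y + e / 8 by lra.
rewrite in_itv /= => /andP[q21 q22].
exists (q1, q2, r); split.
  by rewrite /ratsquare /rect /= -/x -/y; split; apply/andP; split; lra.
move=> w; rewrite /ratsquare /rect /= => -[/andP[w1 w2] /andP[w3 w4]].
apply: le_lt_trans (normc_le_ReIm _) _; rewrite !ReImE -/x -/y.
have h1 : `|complex.Re w - x| < e / 2 by rewrite ltr_norml; apply/andP; split; lra.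
have h2 : `|complex.Im w - y| < e / 2 by rewrite ltr_norml; apply/andP; split; lra.
lra.
Qed.

Lemma bigcup_countType (I : countType) d (T : sigmaRingType d) (F : I -> set T) :
  (forall i, measurable (F i)) -> measurable (\bigcup_i F i).
Proof.
move=> mF; rewrite (_ : \bigcup_i F i =
    \bigcup_n (if @unpickle I n is Some i then F i else set0)).
  by apply: bigcupT_measurable => n; case: unpickle.
apply/seteqP; split => x.
  by move=> [i _ Fx]; exists (pickle i) => //; rewrite pickleK.
by move=> [n _]; case: unpickle => // i Fx; exists i.
Qed.

(** The sigma-algebra is transported from [R * R], not generated by the topology of the modulus. The
    countable base links the two: an open set is the union of the rational squares inside it. *)
Lemma open_complex_measurable (A : set R[i]) : open A -> measurable A.
Proof.
move=> /open_normcP oA; rewrite (_ : A = \bigcup_(q : rat * rat * rat)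
    (if `[< ratsquare q `<=` A >] then ratsquare q else set0)).
  by apply: bigcup_countType => q; case: ifP => // _; exact: measurable_rect.
apply/seteqP; split => z.
  move=> /oA[e e0 H]; have [q [qz qe]] := ratsquare_base z e0.
  exists q => //; case: asboolP => // /asboolP; rewrite asboolE; case.
  by move=> w /qe /H.
by move=> [q _]; case: asboolP => // qA /qA.
Qed.

(** Real and imaginary parts are 1-Lipschitz, so preimages of open intervals are open in [D]; the
    general Borel set is then reached through the extension of [f] by [0]. *)
Lemma open_eps_measurable (D : set R[i]) (f : R[i] -> R[i]) : open D ->
  (forall z, D z -> forall e : R, 0 < e -> exists2 d : R, 0 < d &
    forall w, normc (w - z) < d -> normc (f w - f z) < e) ->
  measurable_fun D f.
Proof.
move=> oD cf.
have main (g : R[i] -> R) : (forall z w, `|g z - g w| <= normc (z - w)) ->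
    measurable_fun D (g \o f).
  move=> g1; apply: (measurability _ (RGenOpens.measurableE R)).
  move=> _ [_ [a [b ->] <-]]; apply: open_complex_measurable.
  apply/open_normcP => z [Dz]; rewrite /= in_itv /= => /andP[az zb].
  have e0 : 0 < Num.min (g (f z) - a) (b - g (f z)).
    by rewrite lt_min !subr_gt0 az zb.
  have [d d0 H] := cf z Dz _ e0; have [r r0 K] := (open_normcP _).1 oD z Dz.
  exists (Num.min d r); first by rewrite lt_min d0 r0.
  move=> w; rewrite lt_min => /andP[wd wr]; split; first exact: K.
  have := le_lt_trans (g1 (f w) (f z)) (H w wd).
  by rewrite lt_min !ltr_norml /= in_itv /= => /andP[/andP[? ?] /andP[? ?]]; lra.
have mr := main (@complex.Re R) (fun z w => _).
have mi := main (@complex.Im R) (fun z w => _).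
move=> _ A mA.
have mD : measurable D by exact: open_complex_measurable.
suff : measurable_fun setT (fun x => if x \in D then f x else 0).
  move=> /(_ measurableT A mA); rewrite setTI => H.
  rewrite (_ : D `&` f @^-1` A = D `&` (fun x => if x \in D then f x else 0) @^-1` A).
    exact: measurableI.
  by apply/seteqP; split => x /= [Dx]; rewrite mem_set.
apply: ReIm_measurable.
- rewrite (_ : _ \o _ = (@complex.Re R \o f) \_ D).
    apply/(measurable_restrictT _ mD); apply: mr => z w.
    by rewrite -cReN -cReD; exact: normr_Re_le.
  by apply/funext => x /=; rewrite /patch; case: ifP.
- rewrite (_ : _ \o _ = (@complex.Im R \o f) \_ D).
    apply/(measurable_restrictT _ mD); apply: mi => z w.
    by rewrite -cImN -cImD; exact: normr_Im_le.
  by apply/funext => x /=; rewrite /patch; case: ifP.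
Qed.

End ComplexMeasurability.

(** * Translation invariance and sigma-finiteness of area *)

Section AreaTranslation.
Context {R : realType}.

Lemma measurable_shiftR (a : R) : measurable_fun setT (fun x : R => x + a).
Proof. by apply: measurable_funD => //; exact: measurable_cst. Qed.

(** Translation preserves the lengths of half-open intervals, and these determine Lebesgue
    measure. *)
Lemma lebesgue_measure_shift (a : R) (A : set R) : measurable A ->
  lebesgue_measure ((fun x => x + a) @^-1` A) = lebesgue_measure A.
Proof.
move=> mA; rewrite -[LHS]/(pushforward lebesgue_measure
  ((fun x => x + a) : _ -> measurableTypeR R) A).
apply/esym/lebesgue_measure_unique => //=.
  exact: measurable_shiftR.
move=> ? _ [[x y] _ <-] /=.
rewrite /pushforward (_ : _ @^-1` _ = `]x - a, y - a]%classic); last first.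
  by apply/seteqP; split => z /=; rewrite !in_itv /= => /andP[? ?]; apply/andP; split; lra.
rewrite !lebesgue_measure_itv /= !lte_fin ltrD2r.
by case: ifP => // _; rewrite -!EFinB; congr EFin; ring.
Qed.

Definition shift_pair (a : R * R) (p : R * R) :
  R * R := (p.1 + a.1, p.2 + a.2).

Lemma measurable_shift_pair a : measurable_fun setT (shift_pair a).
Proof.
apply: measurable_fun_pair.
- by apply: (measurableT_comp (measurable_shiftR a.1)); exact: measurable_fst.
- by apply: (measurableT_comp (measurable_shiftR a.2)); exact: measurable_snd.
Qed.

(** Rectangles with measurable sides determine the product measure, and on them the claim is the
    one-dimensional one in each factor. *)
Lemma product_lebesgue_shift a (X : set (R * R)) :
  measurable X ->
  (@lebesgue_measure R \x @lebesgue_measure R)%E (shift_pair a @^-1` X) =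
  (@lebesgue_measure R \x @lebesgue_measure R)%E X.
Proof.
move=> mX.
rewrite -[LHS]/(pushforward (@lebesgue_measure R \x @lebesgue_measure R)%E
  (shift_pair a : _ -> measurableTypeR R * measurableTypeR R)%type X).
apply/esym/product_measure_unique => //=.
  exact: measurable_shift_pair.
move=> ? A B mA mB; rewrite /pushforward.
rewrite (_ : _ @^-1` _ = ((fun x => x + a.1) @^-1` A) `*` ((fun x => x + a.2) @^-1` B))//.
rewrite product_measure1E; first last.
- by rewrite -[_ @^-1` _]setTI; exact: measurable_shiftR.
- by rewrite -[_ @^-1` _]setTI; exact: measurable_shiftR.
by congr (_ * _)%E; exact: lebesgue_measure_shift.
Qed.

Lemma measurable_shift (a : R[i]) : measurable_fun setT (fun z : R[i] => z + a).
Proof. by apply: measurable_complexD => //; exact: measurable_cst. Qed.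

Lemma area_shift (a : R[i]) (A : set R[i]) : measurable A ->
  area ((fun z => z + a) @^-1` A) = area A.
Proof.
move=> mA; rewrite /area /pushforward.
rewrite (_ : complex_of_pair @^-1` _ =
  shift_pair (complex.Re a, complex.Im a) @^-1` (complex_of_pair @^-1` A)).
  exact: product_lebesgue_shift.
by apply/seteqP; split => -[x y] /=; rewrite /complex_of_pair /=; case: (a).
Qed.

Lemma ge0_integral_shift (a : R[i]) (f : R[i] -> \bar R) :
  measurable_fun setT f -> (forall z, 0 <= f z)%E ->
  (\int[area]_z f (z + a)%R = \int[area]_z f z)%E.
Proof.
move=> mf f0; rewrite -[RHS](@eq_measure_integral _ _ _ _ _
   (measure_function_pushforward__canonical__measure_function_Measure
     (@area R) (measurable_shift a))).
  by rewrite /= (ge0_integral_pushforward (measurable_shift a))// preimage_setT.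
by move=> A mA _; rewrite /= /pushforward area_shift.
Qed.

Lemma integral_shift (a : R[i]) (f : R[i] -> \bar R) :
  area.-integrable setT f ->
  area.-integrable setT (fun z => f (z + a)) /\
  (\int[area]_z f (z + a)%R = \int[area]_z f z)%E.
Proof.
move=> /integrableP[mf fi].
have H : area.-integrable setT (fun z => f (z + a)).
  apply/integrableP; split.
    exact: (measurableT_comp mf (measurable_shift a)).
  rewrite (ge0_integral_shift a (f := abse \o f))//; last first.
    by move=> z; exact: abse_ge0.
  by apply: (measurableT_comp (@abse_measurable R setT)); exact: mf.
split => //.
rewrite -[RHS](@eq_measure_integral _ _ _ _ _
   (measure_function_pushforward__canonical__measure_function_Measure
     (@area R) (measurable_shift a))).
  by rewrite /= (integral_pushforward (measurable_shift a))// preimage_setT.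
by move=> A mA _; rewrite /= /pushforward area_shift.
Qed.

Definition square (c : R[i]) (r : R) : set R[i] :=
  rect (complex.Re c - r) (complex.Re c + r) (complex.Im c - r) (complex.Im c + r).

Lemma area_square c r : 0 <= r -> area (square c r) = (4 * r ^+ 2)%:E.
Proof.
by move=> r0; rewrite area_rect; [congr EFin; ring|lra|lra].
Qed.

Lemma measurable_square c r : measurable (square c r).
Proof. exact: measurable_rect. Qed.

Lemma normc_lt_square c z r : normc (z - c) < r -> square c r z.
Proof.
move=> H; have := le_lt_trans (normr_Re_le _) H; have := le_lt_trans (normr_Im_le _) H.
by rewrite !ReImE !ltr_norml => /andP[? ?] /andP[? ?]; rewrite /square /rect /=; split;
  apply/andP; split; lra.
Qed.

Lemma square_normc_lt c z r : square c r z -> normc (z - c) < 2 * r.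
Proof.
rewrite /square /rect /= => -[/andP[? ?] /andP[? ?]].
apply: le_lt_trans (normc_le_ReIm _) _; rewrite !ReImE.
have h1 : `|complex.Re z - complex.Re c| < r by rewrite ltr_norml; apply/andP; split; lra.
have h2 : `|complex.Im z - complex.Im c| < r by rewrite ltr_norml; apply/andP; split; lra.
lra.
Qed.

(** Required to form the product of [area] with itself, on which Fubini's theorem is applied. *)
Lemma area_sigma_finite : sigma_finite setT (@area R).
Proof.
exists (fun n => square 0 n%:R).
  apply/esym/seteqP; split => // z _.
  have /ltW/le_lt_trans := archi_boundP (normc_ge0 z).
  exists (Num.bound (normc z)) => //; apply: normc_lt_square.
  by rewrite subr0; exact: archi_boundP (normc_ge0 z).
by move=> n; split; [exact: measurable_square|rewrite area_square// ltry].
Qed.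

HB.instance Definition _ := Measure_isSigmaFinite.Build _ _ _ (@area R)
  area_sigma_finite.

Lemma area_singleton (z : R[i]) : area [set z] = 0%E.
Proof.
apply/eqP; rewrite eq_le measure_ge0 andbT.
have mz : measurable [set z].
  rewrite -[measurable _]/(measurable ((@complex_of_pair R) @^-1` _)).
  rewrite (_ : _ @^-1` _ = [set complex.Re z] `*` [set complex.Im z]).
    exact: measurableX.
  apply/seteqP; split => -[x y]; rewrite /= /complex_of_pair /=.
    by move=> <-.
  by move=> [-> ->]; case: (z).
apply/lee_addgt0Pr => e e0; rewrite add0e.
(* With [r <= 1] and [r <= e / 4] the area [4 * r ^ 2] of the surrounding square is at most [e]. *)
pose r := Num.min 1 (e / 4).
have r0 : 0 < r by rewrite lt_min ltr01 /=; lra.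
apply: (@le_trans _ _ (area (square z r))).
  apply: le_measure; rewrite ?inE//; first exact: measurable_square.
  by move=> _ ->; apply: normc_lt_square; rewrite subrr normc0.
rewrite (area_square z (ltW r0)) lee_fin.
have r1 : r <= 1 by rewrite ge_min lexx.
have re : r <= e / 4 by rewrite ge_min lexx orbT.
nra.
Qed.

Lemma measurable_singleton (z : R[i]) : measurable [set z].
Proof.
rewrite -[measurable _]/(measurable ((@complex_of_pair R) @^-1` _)).
rewrite (_ : _ @^-1` _ = [set complex.Re z] `*` [set complex.Im z]).
  exact: measurableX.
apply/seteqP; split => -[x y]; rewrite /= /complex_of_pair /=.
  by move=> <-.
by move=> [-> ->]; case: (z).
Qed.

End AreaTranslation.

(** * Integration of complex functions over the plane *)

Section ComplexIntegral.
Context {R : realType}.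
Implicit Types f g : R[i] -> R[i].

(** Everything is integrated over the whole plane; a function on [D] is first extended by [0], so
    that translations, limits and Fubini apply without reference to [D]. *)
Definition cintegrable f :=
  area.-integrable setT (EFin \o (@complex.Re R \o f)) /\
  area.-integrable setT (EFin \o (@complex.Im R \o f)).

Definition cint f : R[i] := complex_integral setT f.

Lemma cintegrable_measurable f : cintegrable f -> measurable_fun setT f.
Proof.
by move=> [/measurable_int/measurable_EFinP mr /measurable_int/measurable_EFinP mi];
  exact: ReIm_measurable.
Qed.

Lemma cintegrable_le f (g : R[i] -> R) : measurable_fun setT f ->
  (forall z, normc (f z) <= g z) -> area.-integrable setT (EFin \o g) ->
  cintegrable f.
Proof.
move=> /measurable_ReIm[mr mi] fg ig.
have g0 z : 0 <= g z by apply: le_trans (fg z); exact: normc_ge0.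
split; (apply: le_integrable ig => //; first exact/measurable_EFinP) => z _ /=;
  rewrite lee_fin (ger0_norm (g0 z)); apply: le_trans (fg z).
- exact: normr_Re_le.
- exact: normr_Im_le.
Qed.

Lemma cintegrable_normc f : cintegrable f -> 
  area.-integrable setT (EFin \o (fun z => normc (f z))).
Proof.
move=> [fr fi].
have mf := cintegrable_measurable (conj fr fi).
have h := integrableD measurableT (integrable_abse fr) (integrable_abse fi).
apply: le_integrable h => //.
  by apply/measurable_EFinP; exact: measurable_normc.
move=> z _ /=; rewrite lee_fin (ger0_norm (normc_ge0 _)).
exact: le_trans (normc_le_ReIm _) (ler_norm _).
Qed.

Lemma cintegrable_dom f g : measurable_fun setT f -> cintegrable g ->
  (forall z, normc (f z) <= normc (g z)) -> cintegrable f.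
Proof. by move=> mf /cintegrable_normc ig fg; exact: cintegrable_le fg ig. Qed.

Lemma cintegrableD f g : cintegrable f -> cintegrable g ->
  cintegrable (fun z => f z + g z).
Proof.
move=> [f1 f2] [g1 g2]; split.
- by apply: eq_integrable (integrableD measurableT f1 g1) => // z _ /=; rewrite cReD.
- by apply: eq_integrable (integrableD measurableT f2 g2) => // z _ /=; rewrite cImD.
Qed.

Lemma cintD f g : cintegrable f -> cintegrable g ->
  cint (fun z => f z + g z) = cint f + cint g.
Proof.
move=> [f1 f2] [g1 g2]; apply: eq_ReIm; rewrite /= -RintegralD//;
  by apply: eq_Rintegral => z _; rewrite ReImE.
Qed.

Lemma cintegrableZ c f : cintegrable f -> cintegrable (fun z => c * f z).
Proof.
move=> [f1 f2]; split.
- apply: eq_integrable (integrableB measurableT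
    (integrableZl measurableT (complex.Re c) f1)
    (integrableZl measurableT (complex.Im c) f2)) => // z _ /=.
  by rewrite cReM.
- apply: eq_integrable (integrableD measurableT
    (integrableZl measurableT (complex.Re c) f2)
    (integrableZl measurableT (complex.Im c) f1)) => // z _ /=.
  by rewrite cImM.
Qed.

Lemma cintZ c f : cintegrable f -> cint (fun z => c * f z) = c * cint f.
Proof.
move=> [f1 f2].
have h a h1 : area.-integrable setT (EFin \o h1) ->
    area.-integrable setT (EFin \o (fun z => a * h1 z)).
  by move=> /(integrableZl measurableT a).
apply: eq_ReIm; rewrite ReImE /= -?RintegralZl// -?RintegralB -?RintegralD//;
  try exact: h; by apply: eq_Rintegral => z _; rewrite ReImE.
Qed.

Lemma cintegrableN f : cintegrable f -> cintegrable (fun z => - f z).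
Proof.
move=> /(cintegrableZ (-1)); rewrite (_ : (fun z => -1 * f z) = (fun z => - f z))//.
by apply/funext => z; rewrite mulN1r.
Qed.

Lemma cintN f : cintegrable f -> cint (fun z => - f z) = - cint f.
Proof.
move=> /(cintZ (-1)); rewrite (_ : (fun z => -1 * f z) = (fun z => - f z)).
  by move=> ->; rewrite mulN1r.
by apply/funext => z; rewrite mulN1r.
Qed.

Lemma cintegrableB f g : cintegrable f -> cintegrable g ->
  cintegrable (fun z => f z - g z).
Proof. by move=> hf hg; apply: cintegrableD => //; exact: cintegrableN. Qed.

Lemma cintB f g : cintegrable f -> cintegrable g ->
  cint (fun z => f z - g z) = cint f - cint g.
Proof.
by move=> hf hg; rewrite cintD//; [rewrite cintN|exact: cintegrableN].
Qed.

Lemma cintegrable0 : cintegrable (fun=> 0).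
Proof. by split; exact: integrable0. Qed.

Lemma cint0 : cint (fun=> 0) = 0.
Proof.
by apply: eq_ReIm; rewrite /= /Rintegral; under eq_integral do rewrite /=;
  rewrite integral0.
Qed.

Lemma cintegrable_sum I (s : seq I) (F : I -> R[i] -> R[i]) :
  (forall i, cintegrable (F i)) -> cintegrable (fun z => \sum_(i <- s) F i z).
Proof.
move=> iF; elim: s => [|i s IH].
  by under eq_fun do rewrite big_nil; exact: cintegrable0.
by under eq_fun do rewrite big_cons; exact: cintegrableD.
Qed.

Lemma cint_sum I (s : seq I) (F : I -> R[i] -> R[i]) :
  (forall i, cintegrable (F i)) ->
  cint (fun z => \sum_(i <- s) F i z) = \sum_(i <- s) cint (F i).
Proof.
move=> iF; elim: s => [|i s IH].
  by under eq_fun do rewrite big_nil; rewrite big_nil cint0.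
under eq_fun do rewrite big_cons.
by rewrite cintD ?IH ?big_cons//; exact: cintegrable_sum.
Qed.

Lemma cintJ f : cintegrable f -> cint (fun z => (f z)^*) = (cint f)^*.
Proof.
move=> [f1 f2]; apply: eq_ReIm; rewrite ReImE /=.
  by apply: eq_Rintegral => z _; rewrite cReJ.
rewrite -[RHS]mulN1r -RintegralZl//; apply: eq_Rintegral => z _.
by rewrite cImJ mulN1r.
Qed.

Lemma cint_ae f g : cintegrable f -> measurable_fun setT g ->
  {ae area, forall z, f z = g z} -> cintegrable g /\ cint f = cint g.
Proof.
move=> [f1 f2] /measurable_ReIm[g1 g2] fg.
have er : {ae area, forall z, setT z -> (EFin \o (@complex.Re R \o f)) z =
                                       (EFin \o (@complex.Re R \o g)) z}.
  by apply: filterS fg => z /= -> _.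
have ei : {ae area, forall z, setT z -> (EFin \o (@complex.Im R \o f)) z =
                                       (EFin \o (@complex.Im R \o g)) z}.
  by apply: filterS fg => z /= -> _.
have mr := measurable_int _ f1; have mi := measurable_int _ f2.
have gr : measurable_fun setT (EFin \o (@complex.Re R \o g)) by exact/measurable_EFinP.
have gi : measurable_fun setT (EFin \o (@complex.Im R \o g)) by exact/measurable_EFinP.
have main (h k : R[i] -> \bar R) : area.-integrable setT h -> measurable_fun setT k ->
    {ae area, forall z, setT z -> h z = k z} -> area.-integrable setT k.
  move=> /integrableP[mh hoo] mk hk; apply/integrableP; split => //.
  apply: le_lt_trans hoo; rewrite le_eqVlt; apply/orP; left; apply/eqP.
  apply: ae_eq_integral => //.
  - exact: (measurableT_comp (@abse_measurable R setT) mk).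
  - exact: (measurableT_comp (@abse_measurable R setT) mh).
  - by apply: filterS hk => z /= H zT; rewrite H.
split; first by split; [exact: main er|exact: main ei].
by apply: eq_ReIm; rewrite /= /Rintegral; congr fine; apply: ae_eq_integral.
Qed.

Lemma normc_cint_le f (g : R[i] -> R) : cintegrable f ->
  (forall z, normc (f z) <= g z) -> area.-integrable setT (EFin \o g) ->
  normc (cint f) <= 2 * \int[area]_z g z.
Proof.
move=> [f1 f2] fg ig; apply: le_trans (normc_le_ReIm _) _.
have g0 z : 0 <= g z by apply: le_trans (fg z); exact: normc_ge0.
have main (h : R[i] -> R) : area.-integrable setT (EFin \o h) ->
    (forall z, `|h z| <= g z) -> `|\int[area]_z h z| <= \int[area]_z g z.
  move=> ih hg; apply: le_trans (le_normr_Rintegral measurableT ih) _.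
  by apply: le_Rintegral => //; exact: (integrable_norm ih).
rewrite mulr2n mulrDl mul1r; apply: lerD; apply: main => // z.
- by apply: le_trans (fg z); exact: normr_Re_le.
- by apply: le_trans (fg z); exact: normr_Im_le.
Qed.

Lemma cint_shift (a : R[i]) f : cintegrable f ->
  cintegrable (fun z => f (z + a)) /\ cint (fun z => f (z + a)) = cint f.
Proof.
move=> [/(integral_shift a)[f1 e1] /(integral_shift a)[f2 e2]]; split => //.
by apply: eq_ReIm; rewrite /= /Rintegral; congr fine.
Qed.

Lemma integrable_indic_bounded (D : set R[i]) (M : R) : measurable D ->
  (area D < +oo)%E ->
  area.-integrable setT (EFin \o (fun z => M * \1_D z)) /\
  \int[area]_z (M * \1_D z) = M * fine (area D).
Proof.
move=> mD Doo.
have i1 : area.-integrable setT (EFin \o (\1_D : R[i] -> R)).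
  apply/integrableP; split; first by apply/measurable_EFinP; exact: measurable_indic.
  rewrite (eq_integral (fun x => (\1_D x)%:E)) => [|z _]; last by rewrite /= ger0_norm // indicE ler0n.
  by rewrite integral_indic// setIT.
split; first exact: (integrableZl measurableT M i1).
rewrite RintegralZl//; congr (_ * _).
by rewrite /Rintegral integral_indic// setIT.
Qed.

(* The constant 2 comes from estimating real and imaginary parts separately. *)
Lemma cint_bounded f (D : set R[i]) (M : R) : measurable_fun setT f ->
  measurable D -> (area D < +oo)%E ->
  (forall z, D z -> normc (f z) <= M) -> (forall z, ~ D z -> f z = 0) ->
  cintegrable f /\ normc (cint f) <= 2 * M * fine (area D).
Proof.
move=> mf mD Doo fM f0.
have [i e] := integrable_indic_bounded M mD Doo.
have fg z : normc (f z) <= M * \1_D z.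
  rewrite indicE; have [zD|zD] := boolP (z \in D).
    by rewrite mulr1 fM//; exact: set_mem.
  by rewrite mulr0 f0 ?normc0//; move/negP: zD => zD Dz; apply: zD; exact: mem_set.
have fi := cintegrable_le mf fg i.
by split => //; rewrite -mulrA -e; exact: normc_cint_le.
Qed.

Lemma cint_dominated (f_ : nat -> R[i] -> R[i]) f (g : R[i] -> R) :
  (forall n, measurable_fun setT (f_ n)) -> measurable_fun setT f ->
  (forall n z, normc (f_ n z) <= g z) -> (forall z, normc (f z) <= g z) ->
  area.-integrable setT (EFin \o g) ->
  {ae area, forall z, (fun n => normc (f_ n z - f z)) @ \oo --> 0} ->
  (fun n => normc (cint (f_ n) - cint f)) @ \oo --> 0.
Proof.
move=> mf_ mf fg_ fg ig fcv.
have i_ n : cintegrable (f_ n) by exact: cintegrable_le (fg_ n) ig.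
have i : cintegrable f by exact: cintegrable_le fg ig.
have mh n : measurable_fun setT (fun z => normc (f_ n z - f z)).
  by apply: measurable_normc; exact: measurable_complexB.
have g0 z : 0 <= g z by apply: le_trans (fg z); exact: normc_ge0.
have ih n : area.-integrable setT (EFin \o (fun z => normc (f_ n z - f z))).
  by apply: cintegrable_normc; exact: cintegrableB.
(* The real theorem is applied to the moduli of the differences, which are bounded by [2 * g] and
   tend to [0]; the difference of the integrals is then squeezed. *)
have [|||||_ _] := @dominated_convergence _ _ _ (@area R) setT measurableT
  (fun n => EFin \o (fun z => normc (f_ n z - f z))) (cst 0%E)
  (EFin \o (fun z => 2 * g z)).
- by move=> n; apply/measurable_EFinP; exact: mh.
- exact: measurable_cst.
- apply: filterS fcv => z H _; apply: cvg_EFin; last exact: H.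
  exact: nearW.
- exact: (integrableZl measurableT 2 ig).
- apply: aeW => z n _ /=; rewrite lee_fin ger0_norm ?normc_ge0//.
  apply: le_trans (normcB _ _) _.
  by rewrite mulr2n mulrDl mul1r; apply: lerD.
rewrite integral0 => H1.
have H2 : (fun n => 2 * \int[area]_z normc (f_ n z - f z)) @ \oo --> 0.
  rewrite -[X in _ --> X](mulr0 2); apply: cvgMr.
  by move/fine_cvg : H1; apply: cvg_trans; apply: near_eq_cvg; exact: nearW.
apply: (@squeeze_cvgr _ _ _ _ (cst 0) (fun n => 2 * \int[area]_z normc (f_ n z - f z)));
  [|exact: cvg_cst|exact: H2].
apply: nearW => n; apply/andP; split; first exact: normc_ge0.
rewrite -cintB//.
by apply: normc_cint_le => //; exact: cintegrableB.
Qed.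

Lemma complex_integralE (D : set R[i]) f :
  complex_integral D f = cint (fun z => if z \in D then f z else 0).
Proof.
apply: eq_ReIm; rewrite /= Rintegral_mkcond; apply: eq_Rintegral => z _;
  by rewrite /patch; case: ifP.
Qed.

Lemma eq_cint f g : (forall z, f z = g z) -> cint f = cint g.
Proof. by move=> /funext ->. Qed.

End ComplexIntegral.

(** * Test functions and their conjugate derivatives *)

Section TestFunctions.
Context {R : realType}.
Implicit Types (w : R[i]) (G D H F E : R[i] -> R[i]).

Lemma normc1_le1 : normc (1 : R[i]) <= 1.
Proof. by rewrite normc1. Qed.

Lemma normci_le1 : normc ('i : R[i]) <= 1.
Proof. by rewrite normci. Qed.

Lemma normcM_le (x y : R[i]) (p q : R) :
  normc x <= p -> normc y <= q -> normc (x * y) <= p * q.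
Proof. by move=> h1 h2; rewrite normcM ler_pM// normc_ge0. Qed.

(** Along the direction [w], [D] is the derivative of [G] with a quadratic remainder, uniform on
    every disc. The bounds on [G] and [D] themselves are part of the notion because the product rule
    consumes them. *)
Definition taylor1 w G D := forall rho : R, exists2 M : R, 0 <= M &
  forall z (t : R), normc z <= rho -> 0 <= t <= 1 ->
  [/\ normc (G z) <= M, normc (D z) <= M &
      normc (G (z + t%:C * w) - G z - t%:C * D z) <= M * t ^+ 2].

(* [E] is twice the derivative of [G] with respect to the conjugate variable;
   the second order bound makes differentiation under the integral trivial. *)
Definition dbar_pair G E := exists Dx Dy,
  [/\ [/\ measurable_fun setT G, measurable_fun setT Dx & measurable_fun setT Dy],
      taylor1 1 G Dx, taylor1 'i G Dy & forall z, E z = Dx z + 'i * Dy z].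

Lemma taylor1_cst w c : taylor1 w (fun=> c) (fun=> 0).
Proof.
move=> rho; exists (normc c); first exact: normc_ge0.
move=> z t _ /andP[t0 _]; rewrite subrr mulr0 subr0 normc0.
by rewrite normc_ge0 mulr_ge0 ?normc_ge0 ?sqr_ge0.
Qed.

Lemma taylor1D w G D H F : taylor1 w G D -> taylor1 w H F ->
  taylor1 w (fun z => G z + H z) (fun z => D z + F z).
Proof.
move=> tG tH rho; have [M M0 hG] := tG rho; have [N N0 hH] := tH rho.
exists (M + N); first exact: addr_ge0.
move=> z t zr t01; have [a1 a2 a3] := hG z t zr t01.
have [b1 b2 b3] := hH z t zr t01; split.
- by apply: le_trans (normcD _ _) _; exact: lerD.
- by apply: le_trans (normcD _ _) _; exact: lerD.
rewrite [X in normc X](_ : _ = (G (z + t%:C * w) - G z - t%:C * D z) +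
  (H (z + t%:C * w) - H z - t%:C * F z)); last by ring.
by apply: le_trans (normcD _ _) _; rewrite mulrDl; exact: lerD.
Qed.

Lemma taylor1M w G D H F : taylor1 w G D -> taylor1 w H F ->
  taylor1 w (fun z => G z * H z) (fun z => D z * H z + G z * F z).
Proof.
move=> tG tH rho; have [M M0 hG] := tG rho; have [N N0 hH] := tH rho.
(* [6 = 1 + 3 + 2], from the three summands into which the remainder of the product is split. *)
exists (6 * M * N); first by rewrite !mulr_ge0.
move=> z t zr t01; have [a1 a2 a3] := hG z t zr t01.
have [b1 b2 b3] := hH z t zr t01; have /andP[t0 t1] := t01.
have MN0 := mulr_ge0 M0 N0.
split.
- by apply: le_trans (normcM_le a1 b1) _; nra.
- apply: le_trans (normcD _ _) _.
  apply: le_trans (lerD (normcM_le a2 b1) (normcM_le a1 b2)) _; nra.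
set r := G _ - _ - _ in a3; set s := H _ - _ - _ in b3.
rewrite [X in normc X](_ : _ = (t ^+ 2)%:C * (D z * F z) +
  (r * (H z + t%:C * F z + s) + (G z + t%:C * D z) * s)); last first.
  by rewrite rmorphXn /r /s /=; ring.
have tn x p : normc x <= p -> normc (t%:C * x) <= p.
  move=> xp; rewrite normcM normc_real ger0_norm//.
  by have := normc_ge0 x; nra.
have c1 : normc (H z + t%:C * F z + s) <= 3 * N.
  apply: le_trans (normcD _ _) _; have := normcD (H z) (t%:C * F z).
  have := tn _ _ b2; have : N * t ^+ 2 <= N by rewrite ler_piMr// expr_le1.
  lra.
have c2 : normc (G z + t%:C * D z) <= 2 * M.
  by have := normcD (G z) (t%:C * D z); have := tn _ _ a2; lra.
have c3 := normcM_le a3 c1; have c4 := normcM_le c2 b3.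
have c5 : normc ((t ^+ 2)%:C * (D z * F z)) <= t ^+ 2 * (M * N).
  apply: normcM_le (normcM_le a2 b2).
  by rewrite normc_real ger0_norm// sqr_ge0.
apply: le_trans (normcD _ _) _; apply: le_trans (lerD c5 (normcD _ _)) _.
nra.
Qed.

Lemma taylor1V w G D (c : R) : 0 < c -> (forall z, c <= normc (G z)) ->
  taylor1 w G D -> taylor1 w (fun z => (G z)^-1) (fun z => - D z / G z ^+ 2).
Proof.
move=> c0 cG tG rho; have [M M0 hG] := tG rho.
have nz z : G z != 0 by rewrite -normc_gt0; exact: lt_le_trans (cG z).
have iG z : normc (G z)^-1 <= c^-1.
  by rewrite normcV lef_pV2 ?posrE// ?normc_gt0.
have ic0 : 0 <= c^-1 by rewrite invr_ge0 ltW.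
(* The numerator of the remainder of [1 / G] is [- r * G + t * D * (t * D + r)], of size
   [(1 + 2) * (M * t) ^ 2]; each of the three reciprocals multiplying it is at most [c^-1]. *)
pose K := 3 * M ^+ 2 * (c^-1 * c^-1 * c^-1).
have K0 : 0 <= K by rewrite !mulr_ge0// sqr_ge0.
have L0 : 0 <= M * (c^-1 * c^-1) by rewrite !mulr_ge0.
exists (K + c^-1 + M * (c^-1 * c^-1)); first by rewrite !addr_ge0.
move=> z t zr t01; have [a1 a2 a3] := hG z t zr t01; have /andP[t0 t1] := t01.
split.
- by apply: le_trans (iG z) _; lra.
- rewrite expr2 invfM; apply: (@le_trans _ _ (M * (c^-1 * c^-1))); last by lra.
  by apply: normcM_le; [rewrite normcN|by apply: normcM_le (iG z) (iG z)].
set g' := G (z + _) in a3 *; set r := g' - _ - _ in a3.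
have g'0 : g' != 0 by exact: nz.
rewrite [X in normc X](_ : _ = (- (r * G z) + t%:C * D z * (t%:C * D z + r)) *
  ((G z)^-1 * (G z)^-1 * g'^-1)); last first.
  by rewrite /r; field; rewrite ?g'0 ?nz.
apply: (@le_trans _ _ (K * t ^+ 2)); last by have := sqr_ge0 t; nra.
rewrite (_ : K * t ^+ 2 = 3 * M ^+ 2 * t ^+ 2 * (c^-1 * c^-1 * c^-1)); last by rewrite /K; ring.
apply: normcM_le; last first.
  by apply: normcM_le (normcM_le (iG z) (iG z)) (iG _).
have tn : normc (t%:C * D z) <= t * M.
  by rewrite normcM normc_real ger0_norm//; exact: ler_wpM2l.
have h1 := normcM_le a3 a1.
have tM : M * t ^+ 2 <= M * t by rewrite expr2; have := mulr_ge0 M0 t0; nra.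
have h2 : normc (t%:C * D z * (t%:C * D z + r)) <= (t * M) * (2 * (t * M)).
  by apply: normcM_le => //; apply: le_trans (normcD _ _) _; lra.
apply: le_trans (normcD _ _) _; rewrite normcN.
by nra.
Qed.

Lemma dbar_pair_measurable G E : dbar_pair G E ->
  measurable_fun setT G /\ measurable_fun setT E.
Proof.
move=> [Dx [Dy [[mG mx my] _ _ H]]]; split => //.
rewrite (_ : E = fun z => Dx z + 'i * Dy z); last exact/funext.
by apply: measurable_complexD => //; apply: measurable_complexM.
Qed.

Lemma dbar_pair_eq G E E' : dbar_pair G E -> (forall z, E z = E' z) -> dbar_pair G E'.
Proof. by move=> h /funext <-. Qed.

Lemma dbar_cst c : dbar_pair (fun=> c) (fun=> 0).
Proof.
exists (fun=> 0), (fun=> 0); split => //; try exact: taylor1_cst.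
by move=> z; rewrite mulr0 addr0.
Qed.

Lemma dbarD G E H F : dbar_pair G E -> dbar_pair H F ->
  dbar_pair (fun z => G z + H z) (fun z => E z + F z).
Proof.
move=> [Dx [Dy [[mG mx my] tx ty eE]]] [Fx [Fy [[mH nx ny] ux uy eF]]].
exists (fun z => Dx z + Fx z), (fun z => Dy z + Fy z); split.
- by split; exact: measurable_complexD.
- exact: taylor1D.
- exact: taylor1D.
- by move=> z; rewrite eE eF; ring.
Qed.

Lemma dbarM G E H F : dbar_pair G E -> dbar_pair H F ->
  dbar_pair (fun z => G z * H z) (fun z => E z * H z + G z * F z).
Proof.
move=> [Dx [Dy [[mG mx my] tx ty eE]]] [Fx [Fy [[mH nx ny] ux uy eF]]].
exists (fun z => Dx z * H z + G z * Fx z), (fun z => Dy z * H z + G z * Fy z); split.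
- by split; [exact: measurable_complexM|..]; apply: measurable_complexD;
    exact: measurable_complexM.
- exact: taylor1M.
- exact: taylor1M.
- by move=> z; rewrite eE eF; ring.
Qed.

Lemma dbarZ G E c : dbar_pair G E -> dbar_pair (fun z => c * G z) (fun z => c * E z).
Proof.
move=> /(dbarM (dbar_cst c)) h; apply: dbar_pair_eq h _ => z.
by rewrite mul0r add0r.
Qed.

Lemma dbar_sum I (s : seq I) (G E : I -> R[i] -> R[i]) :
  (forall i, dbar_pair (G i) (E i)) ->
  dbar_pair (fun z => \sum_(i <- s) G i z) (fun z => \sum_(i <- s) E i z).
Proof.
move=> h; elim: s => [|i s IH].
  by under eq_fun do rewrite big_nil; under [X in dbar_pair _ X]eq_fun do rewrite big_nil;
    exact: dbar_cst.
by under eq_fun do rewrite big_cons; under [X in dbar_pair _ X]eq_fun do rewrite big_cons;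
  exact: dbarD.
Qed.

Lemma dbarV G E (c : R) : 0 < c -> (forall z, c <= normc (G z)) ->
  dbar_pair G E -> dbar_pair (fun z => (G z)^-1) (fun z => - E z / G z ^+ 2).
Proof.
move=> c0 cG [Dx [Dy [[mG mx my] tx ty eE]]].
exists (fun z => - Dx z / G z ^+ 2), (fun z => - Dy z / G z ^+ 2); split.
- split; first exact: measurable_complexV.
  + apply: measurable_complexM; first exact: measurable_complexN.
    by apply: measurable_complexV; exact: measurable_complexX.
  + apply: measurable_complexM; first exact: measurable_complexN.
    by apply: measurable_complexV; exact: measurable_complexX.
- exact: taylor1V c0 cG tx.
- exact: taylor1V c0 cG ty.
- by move=> z; rewrite eE; ring.
Qed.

(** A real-linear [L] has no remainder, and [u], [v] are its partial derivatives. The two uses are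
    the identity, with value [0], and conjugation, with value [2]. *)
Lemma dbar_linear (u v : R[i]) (L : R[i] -> R[i]) :
  (forall z, normc (L z) <= normc z) -> measurable_fun setT L ->
  (forall z (t : R), L (z + t%:C * 1) = L z + t%:C * u) ->
  (forall z (t : R), L (z + t%:C * 'i) = L z + t%:C * v) ->
  dbar_pair L (fun=> u + 'i * v).
Proof.
move=> L1 mL Lu Lv; exists (fun=> u), (fun=> v); split => //.
- move=> rho; exists (`|rho| + normc u); first by rewrite addr_ge0 ?normc_ge0.
  move=> z t zr _; split.
  + apply: le_trans (L1 z) _; apply: le_trans zr _.
    by apply: le_trans (ler_norm _) _; rewrite lerDl normc_ge0.
  + by rewrite lerDr.
  + rewrite Lu [X in normc X](_ : _ = 0) ?normc0; last by ring.
    by rewrite mulr_ge0 ?sqr_ge0// addr_ge0 ?normc_ge0.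
- move=> rho; exists (`|rho| + normc v); first by rewrite addr_ge0 ?normc_ge0.
  move=> z t zr _; split.
  + apply: le_trans (L1 z) _; apply: le_trans zr _.
    by apply: le_trans (ler_norm _) _; rewrite lerDl normc_ge0.
  + by rewrite lerDr.
  + rewrite Lv [X in normc X](_ : _ = 0) ?normc0; last by ring.
    by rewrite mulr_ge0 ?sqr_ge0// addr_ge0 ?normc_ge0.
Qed.

Lemma dbar_id : dbar_pair id (fun=> 0).
Proof.
rewrite (_ : (fun=> 0) = (fun=> 1 + 'i * 'i)); last first.
  by apply/funext => z; rewrite -expr2 sqr_i subrr.
by apply: dbar_linear.
Qed.

Lemma dbar_conj : dbar_pair (fun z => z^*) (fun=> 2).
Proof.
rewrite (_ : (fun=> 2) = (fun=> 1 + 'i * (- 'i))); last first.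
  by apply/funext => z; rewrite mulrN -expr2 sqr_i opprK.
apply: dbar_linear.
- by move=> z; rewrite normc_conj.
- exact: measurable_complexJ.
- by move=> z t; apply: eq_ReIm; rewrite !ReImE /=; ring.
- by move=> z t; apply: eq_ReIm; rewrite !ReImE /=; ring.
Qed.

(** Every cutoff function below is built from squares of [pospart]: they vanish on a half-line and
    are just smooth enough, with a Lipschitz derivative, for the quadratic remainder in
    [taylor1]. *)
Definition pospart (x : R) : R := Num.max x 0.

(** The second derivative jumps from [0] to [2] at the origin, and the remainder is at most half of
    its supremum times [t ^ 2]. *)
Lemma pospart_taylor (x t : R) :
  `|pospart (x + t) ^+ 2 - pospart x ^+ 2 - t * (2 * pospart x)| <= t ^+ 2.
Proof.
rewrite /pospart; case: (leP x 0) => hx; case: (leP (x + t) 0) => ht;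
  rewrite ler_norml; apply/andP; split; nra.
Qed.

Lemma pospart_ge0 x : 0 <= pospart x.
Proof. by rewrite /pospart le_max lexx orbT. Qed.

Lemma pospart_le x : pospart x <= `|x|.
Proof. by rewrite /pospart ge_max ler_norm normr_ge0. Qed.

Lemma measurable_pospart d (T : measurableType d) (f : T -> R) :
  measurable_fun setT f -> measurable_fun setT (fun x => pospart (f x)).
Proof. by move=> mf; apply: measurable_maxr. Qed.

Lemma dbar_pospart (L : R[i] -> R) (u v a b : R) :
  (forall z, `|L z| <= normc z) -> measurable_fun setT L ->
  (forall z (t : R), L (z + t%:C * 1) = L z + t * u) ->
  (forall z (t : R), L (z + t%:C * 'i) = L z + t * v) ->
  dbar_pair (fun z => (pospart (a * L z + b) ^+ 2)%:C)
    (fun z => (2 * a * pospart (a * L z + b))%:C * (u%:C + 'i * v%:C)).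
Proof.
move=> L1 mL Lu Lv.
have mp : measurable_fun setT (fun z => pospart (a * L z + b)).
  by apply: measurable_pospart; apply: measurable_funD => //; exact: measurable_funM.
have main s w : (forall z (t : R), L (z + t%:C * w) = L z + t * s) ->
    taylor1 w (fun z => (pospart (a * L z + b) ^+ 2)%:C)
      (fun z => (2 * a * s * pospart (a * L z + b))%:C).
  move=> Ls rho; pose B := `|a| * `|rho| + `|b|.
  have B0 : 0 <= B by rewrite addr_ge0// mulr_ge0.
  exists (B ^+ 2 + 2 * `|a * s| * B + (a * s) ^+ 2).
    by rewrite !addr_ge0 ?sqr_ge0// !mulr_ge0.
  move=> z t zr t01.
  have pB : pospart (a * L z + b) <= B.
    apply: le_trans (pospart_le _) _; apply: le_trans (ler_normD _ _) _.
    rewrite lerD2r normrM ler_wpM2l//; apply: le_trans (L1 z) _.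
    exact: le_trans zr (ler_norm _).
  have p0 := pospart_ge0 (a * L z + b).
  have as0 := sqr_ge0 (a * s); have B20 := sqr_ge0 B; have asB := mulr_ge0 (normr_ge0 (a * s)) B0.
  split.
  - rewrite normc_real ger0_norm ?sqr_ge0//.
    have : pospart (a * L z + b) ^+ 2 <= B ^+ 2 by rewrite ler_sqr ?nnegrE.
    lra.
  - rewrite normc_real (_ : 2 * a * s * _ = (a * s) * (2 * pospart (a * L z + b))); last by ring.
    rewrite normrM [X in _ * X]ger0_norm ?mulr_ge0//.
    have := ler_wpM2l (normr_ge0 (a * s)) pB; lra.
  - rewrite -!rmorphM -!rmorphB normc_real Ls.
    have := pospart_taylor (a * L z + b) (t * (a * s)).
    rewrite (_ : a * (L z + t * s) + b = a * L z + b + t * (a * s)); last by ring.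
    rewrite (_ : t * (2 * a * s * _) = t * (a * s) * (2 * pospart (a * L z + b))); last by ring.
    move=> h; apply: le_trans h _; rewrite exprMn mulrC ler_wpM2r ?sqr_ge0//.
    lra.
exists (fun z => (2 * a * u * pospart (a * L z + b))%:C),
       (fun z => (2 * a * v * pospart (a * L z + b))%:C); split.
- by split; apply: measurable_real_complex; [exact: measurable_funX|exact: measurable_funM..].
- exact: main.
- exact: main.
- by move=> z; rewrite !rmorphM; ring.
Qed.

Lemma dbar_pospart_Re (a b : R) :
  dbar_pair (fun z => (pospart (a * complex.Re z + b) ^+ 2)%:C)
    (fun z => (2 * a * pospart (a * complex.Re z + b))%:C).
Proof.
have h := @dbar_pospart (@complex.Re R) 1 0 a b.
apply: dbar_pair_eq (h _ _ _ _) _.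
- exact: normr_Re_le.
- exact: measurable_complex_Re.
- by move=> z t; rewrite !ReImE /=; ring.
- by move=> z t; rewrite !ReImE /=; ring.
- by move=> z; rewrite mulr0 addr0 mulr1.
Qed.

Lemma dbar_pospart_Im (a b : R) :
  dbar_pair (fun z => (pospart (a * complex.Im z + b) ^+ 2)%:C)
    (fun z => 'i * (2 * a * pospart (a * complex.Im z + b))%:C).
Proof.
have h := @dbar_pospart (@complex.Im R) 0 1 a b.
apply: dbar_pair_eq (h _ _ _ _) _.
- exact: normr_Im_le.
- exact: measurable_complex_Im.
- by move=> z t; rewrite !ReImE /=; ring.
- by move=> z t; rewrite !ReImE /=; ring.
- by move=> z; rewrite add0r mulr1 mulrC.
Qed.

(** A point outside the closed disc stays outside under small steps, so both values of [G] vanish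
    there and the expansion leaves [normc (D z) <= M * t] for arbitrarily small [t]. *)
Lemma taylor1_support w G D (rho : R) : normc w <= 1 -> taylor1 w G D ->
  (forall z, rho < normc z -> G z = 0) -> forall z, rho < normc z -> D z = 0.
Proof.
move=> w1 tG G0 z zr; apply: eq0_normc; apply/eqP; rewrite eq_le normc_ge0 andbT.
have [M M0 H] := tG (normc z).
apply/ler_addgt0Pr => e e0; rewrite add0r.
pose t := Num.min 1 (Num.min ((normc z - rho) / 2) (e / (M + 1))).
have M1 : 0 < M + 1 by rewrite ltr_wpDl.
have t0 : 0 < t by rewrite !lt_min ltr01 /= !divr_gt0// subr_gt0.
have [t1 tz te] : [/\ t <= 1, t <= (normc z - rho) / 2 & t <= e / (M + 1)].
  by split; rewrite /t !ge_min lexx ?orbT.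
have [|_ _] := H z t (lexx _); first by rewrite ltW.
rewrite [G z]G0// [G _]G0; last first.
  have h : normc (t%:C * w) <= t by rewrite normcM normc_real gtr0_norm// ler_piMr// ltW.
  have := normc_distD z (z + t%:C * w) 0; rewrite !subr0 opprD addrA subrr sub0r normcN.
  lra.
rewrite subrr sub0r normcN normcM normc_real gtr0_norm// mulrC expr2 mulrA.
rewrite ler_pM2r// => h; apply: le_trans h _.
rewrite mulrC; move: te; rewrite ler_pdivlMr// => te; lra.
Qed.

(** Translation invariance replaces integration by parts: the difference quotient of [G] integrates
    to [0], and [D] differs from it by at most [M * t] on a fixed square. *)
Lemma cint_taylor1 w G D (rho : R) : normc w <= 1 -> taylor1 w G D ->
  measurable_fun setT G -> measurable_fun setT D ->
  (forall z, rho < normc z -> G z = 0) -> cintegrable D /\ cint D = 0.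
Proof.
move=> w1 tG mG mD G0.
have D0 := taylor1_support w1 tG G0.
have [M M0 H] := tG (`|rho| + 1).
have zb z : normc z <= rho -> normc z <= `|rho| + 1.
  by move=> h; apply: le_trans h _; apply: le_trans (ler_norm _) _; rewrite lerDl.
pose B : set R[i] := square 0 (`|rho| + 2).
have rr : 0 <= `|rho| + 2 by rewrite addr_ge0.
have mB : measurable B by exact: measurable_square.
have Boo : (area B < +oo)%E by rewrite area_square// ltry.
have outB z : ~ B z -> `|rho| + 2 <= normc z.
  by move=> h; rewrite leNgt; apply/negP => h'; apply: h; apply: normc_lt_square; rewrite subr0.
have rn := ler_norm rho.
have h01 : is_true (0 <= (0 : R) <= 1) by rewrite lexx /=.
have [iD _] : cintegrable D /\ normc (cint D) <= 2 * M * fine (area B).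
  apply: cint_bounded => // z Bz; last by apply: D0; have := outB z Bz; lra.
  have [zr|zr] := leP (normc z) rho; last by rewrite D0// normc0.
  by have [] := H z 0 (zb _ zr) h01.
have [iG _] : cintegrable G /\ normc (cint G) <= 2 * M * fine (area B).
  apply: cint_bounded => // z Bz; last by apply: G0; have := outB z Bz; lra.
  have [zr|zr] := leP (normc z) rho; last by rewrite G0// normc0.
  by have [] := H z 0 (zb _ zr) h01.
split => //; apply: eq0_normc; apply/eqP; rewrite eq_le normc_ge0 andbT.
have A0 : 0 <= fine (area B) by exact: fine_ge0.
apply/ler_addgt0Pr => e e0; rewrite add0r.
pose K := 2 * M * fine (area B).
have K0 : 0 <= K by rewrite !mulr_ge0.
pose t := Num.min 1 (e / (K + 1)).
have K1 : 0 < K + 1 by rewrite ltr_wpDl.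
have t0 : 0 < t by rewrite lt_min ltr01 /= divr_gt0.
have [t1 te] : t <= 1 /\ t <= e / (K + 1) by split; rewrite /t ge_min lexx ?orbT.
have [iGs eGs] := cint_shift (t%:C * w) iG.
have tC0 : t%:C != 0 :> R[i].
  by apply/eqP => -[/eqP]; rewrite gt_eqF.
have iQ := cintegrableB iGs iG.
pose rem z := D z - (t%:C)^-1 * (G (z + t%:C * w) - G z).
have -> : cint D = cint rem.
  by rewrite cintB//; [rewrite cintZ// cintB// eGs subrr mulr0 subr0|exact: cintegrableZ].
have wt : normc (t%:C * w) <= t by rewrite normcM normc_real gtr0_norm// ler_piMr// ltW.
have rem0 z : `|rho| + 1 < normc z -> rem z = 0.
  move=> zr; rewrite /rem D0; last lra.
  rewrite [G z]G0; last lra.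
  rewrite G0 ?subrr ?mulr0 ?subrr//.
  have := normc_distD z (z + t%:C * w) 0.
  by rewrite !subr0 opprD addrA subrr sub0r normcN; lra.
have [] : cintegrable rem /\ normc (cint rem) <= 2 * (M * t) * fine (area B).
  apply: cint_bounded => //.
  - apply: measurable_complexB => //; apply: measurable_complexM => //.
    exact: cintegrable_measurable iQ.
  - move=> z Bz; have [zr|zr] := leP (normc z) (`|rho| + 1).
      have [|_ _] := H z t zr; first by rewrite ltW.
      rewrite (_ : G _ - G z - _ = - t%:C * rem z); last by rewrite /rem; field.
      rewrite normcM normcN normc_real gtr0_norm// mulrC.
      by rewrite expr2 mulrA ler_pM2r.
    by rewrite rem0// normc0 mulr_ge0// ltW.
  - by move=> z /outB zB; apply: rem0; lra.
move=> _ h; apply: le_trans h _.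
rewrite (_ : 2 * (M * t) * _ = K * t); last by rewrite /K; ring.
move: te; rewrite ler_pdivlMr// => te; lra.
Qed.

(** Green's formula without boundary term; applied to a product formed by [dbarM] it is integration
    by parts. *)
Lemma cint_dbar G E (rho : R) : dbar_pair G E ->
  (forall z, rho < normc z -> G z = 0) -> cintegrable E /\ cint E = 0.
Proof.
move=> [Dx [Dy [[mG mx my] tx ty /funext->]]] G0.
have [ix ex] := cint_taylor1 normc1_le1 tx mG mx G0.
have [iy ey] := cint_taylor1 normci_le1 ty mG my G0.
split; first by apply: cintegrableD => //; exact: cintegrableZ.
by rewrite cintD//; [rewrite cintZ// ex ey mulr0 addr0|exact: cintegrableZ].
Qed.

Lemma dbar_bounded G E (rho : R) : dbar_pair G E -> exists2 M : R, 0 < M &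
  forall z, normc z <= rho -> normc (G z) <= M /\ normc (E z) <= M.
Proof.
move=> [Dx [Dy [_ tx ty eE]]]; have [M M0 HM] := tx rho; have [N N0 HN] := ty rho.
exists (M + N + 1); first lra.
move=> z zr; have t0 : is_true (0 <= (0 : R) <= 1) by rewrite lexx /=.
have [a1 a2 _] := HM z 0 zr t0; have [b1 b2 _] := HN z 0 zr t0; split; first lra.
rewrite eE; apply: le_trans (normcD _ _) _; rewrite normcM normci mul1r; lra.
Qed.

Lemma dbar_support G E (rho : R) : dbar_pair G E ->
  (forall z, rho < normc z -> G z = 0) -> forall z, rho < normc z -> E z = 0.
Proof.
move=> [Dx [Dy [_ tx ty eE]]] G0 z zr; rewrite eE.
rewrite (taylor1_support normc1_le1 tx G0 zr).
by rewrite (taylor1_support normci_le1 ty G0 zr) mulr0 addr0.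
Qed.

End TestFunctions.

(** * Local integrability of [1 / |z|] *)

Section WeakSingularity.
Context {R : realType}.

Definition cauchy_trunc (B : R) (n : nat) (z : R[i]) : R :=
  (normc z)^-1 * \1_(square 0 B `\` square 0 (B / 2 ^+ n)) z.

Lemma measurable_inv_normc d (T : measurableType d) (f : T -> R[i]) :
  measurable_fun setT f -> measurable_fun setT (fun z => (normc (f z))^-1).
Proof. by move=> mf; apply: (measurableT_comp measurable_invr); exact: measurable_normc. Qed.

Lemma measurable_cauchy_trunc B n : measurable_fun setT (cauchy_trunc B n).
Proof.
apply: measurable_funM; first exact: measurable_inv_normc.
by apply: measurable_indic; apply: measurableD; exact: measurable_square.
Qed.

Lemma cauchy_trunc_ge0 B n z : 0 <= cauchy_trunc B n z.
Proof. by rewrite mulr_ge0 ?invr_ge0 ?normc_ge0// indicE ler0n. Qed.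

Lemma square_subset (r s : R) : r <= s -> square (0 : R[i]) r `<=` square 0 s.
Proof.
by move=> rs z [/andP[? ?] /andP[? ?]]; split; apply/andP; split; lra.
Qed.

Lemma notin_square_normc (r : R) (z : R[i]) : ~ square 0 r z -> r <= normc z.
Proof.
by move=> h; rewrite leNgt; apply/negP => zr; apply: h; apply: normc_lt_square; rewrite subr0.
Qed.

(** Dyadic shells in place of polar coordinates: outside the square of radius [B / 2 ^ (n + 1)] the
    function is at most [2 ^ (n + 1) / B], and the new shell lies in a square of area
    [4 * (B / 2 ^ n) ^ 2]. It adds at most [8 * B / 2 ^ n], and these terms sum to the right-hand
    side. *)
Lemma integral_cauchy_trunc (B : R) n : 0 < B ->
  (\int[area]_z (cauchy_trunc B n z)%:E <= (16 * B * (1 - 2 ^- n))%:E)%E.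
Proof.
move=> B0; elim: n => [|n IH].
  rewrite (eq_integral (cst 0%E)) ?integral0; first by rewrite expr0 invr1 subrr mulr0.
  move=> z _; rewrite /cauchy_trunc expr0 divr1 setDv indicE in_set0 mulr0//.
have p0 : 0 < 2 ^+ n :> R by rewrite exprn_gt0.
have r0 : 0 < B / 2 ^+ n by rewrite divr_gt0.
have r1 : 0 < B / 2 ^+ n.+1 by rewrite divr_gt0// exprn_gt0.
pose g (z : R[i]) : R := 2 ^+ n.+1 / B * \1_(square 0 (B / 2 ^+ n)) z.
have mg : measurable_fun setT g.
  by apply: measurable_funM => //; apply: measurable_indic; exact: measurable_square.
have g0 z : 0 <= g z.
  by rewrite mulr_ge0// ?indicE ?ler0n// divr_ge0 ?exprn_ge0// ltW.
have step z : cauchy_trunc B n.+1 z <= cauchy_trunc B n z + g z.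
  rewrite /cauchy_trunc /g !indicE !in_setD.
  have [i1|i1] := boolP (z \in square 0 B); last by rewrite !mulr0 add0r mulr_ge0// ?ler0n// divr_ge0 ?exprn_ge0// ltW.
  have [i2|i2] := boolP (z \in square 0 (B / 2 ^+ n)) => /=; last first.
    rewrite !mulr1 mulr0 addr0 ler_piMr ?invr_ge0 ?normc_ge0//.
    by rewrite lern1 leq_b1.
  rewrite mulr0 add0r mulr1.
  have [i3|i3] := boolP (z \in square 0 (B / 2 ^+ n.+1)) => /=.
    by rewrite mulr0 divr_ge0 ?exprn_ge0// ltW.
  rewrite mulr1 -invf_div lef_pV2 ?posrE//.
    by apply: notin_square_normc => h; move/negP : i3; apply; exact: mem_set.
  apply: lt_le_trans r1 _.
  by apply: notin_square_normc => h; move/negP : i3; apply; exact: mem_set.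
apply: (@le_trans _ _ (\int[area]_z ((cauchy_trunc B n z)%:E + (g z)%:E))%E).
  apply: ge0_le_integral => //.
  - by move=> z _; rewrite lee_fin cauchy_trunc_ge0.
  - by apply/measurable_EFinP; exact: measurable_cauchy_trunc.
  - by apply: emeasurable_funD; apply/measurable_EFinP => //; exact: measurable_cauchy_trunc.
  - by move=> z _; rewrite -EFinD lee_fin.
have mc : measurable_fun setT (fun z => (cauchy_trunc B n z)%:E).
  by apply/measurable_EFinP; exact: measurable_cauchy_trunc.
have mgE : measurable_fun setT (fun z => (g z)%:E) by apply/measurable_EFinP.
have c0 z : setT z -> (0 <= (cauchy_trunc B n z)%:E)%E.
  by rewrite lee_fin cauchy_trunc_ge0.
have gE0 z : setT z -> (0 <= (g z)%:E)%E by rewrite lee_fin.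
rewrite ge0_integralD//.
have -> : (\int[area]_z (g z)%:E = (8 * B * 2 ^- n)%:E)%E.
  rewrite /g; under eq_integral do rewrite EFinM.
  have mi : measurable_fun setT (fun z : R[i] => (\1_(square 0 (B / 2 ^+ n)) z : R)%:E).
    by apply/measurable_EFinP; apply: measurable_indic; exact: measurable_square.
  have c2 : (0 <= (2 ^+ n.+1 / B)%:E)%E by rewrite lee_fin divr_ge0 ?exprn_ge0// ltW.
  rewrite ge0_integralZl//.
  rewrite integral_indic//; last exact: measurable_square.
  rewrite setIT -[X in (_ * X)%E]/(area (square 0 (B / 2 ^+ n))).
  rewrite (area_square _ (ltW r0)) -EFinM; congr EFin.
  rewrite exprS; field; rewrite expf_neq0//= gt_eqF//.
apply: le_trans (leeD IH (lexx _)) _.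
rewrite -EFinD lee_fin le_eqVlt; apply/orP; left; apply/eqP.
by rewrite exprS; field; rewrite expf_neq0.
Qed.

Definition inv_normc (B : R) (z : R[i]) : R := (normc z)^-1 * \1_(square 0 B) z.

(** Monotone convergence of the truncations. They are eventually constant at every point, including
    [0], where all values are [0] because [0^-1 = 0]. *)
Lemma integral_inv_normc (B : R) : 0 < B ->
  (\int[area]_z (inv_normc B z)%:E <= (16 * B)%:E)%E.
Proof.
move=> B0.
have cv z : (fun n => (cauchy_trunc B n z)%:E) @ \oo --> (inv_normc B z)%:E.
  have [->|z0] := eqVneq z 0.
    rewrite /inv_normc normc0 invr0 mul0r.
    by rewrite (_ : (fun n => _) = cst 0%E);
      [exact: cvg_cst|apply/funext => n; rewrite /cauchy_trunc normc0 invr0 mul0r].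
  apply: cvg_near_cst.
  have nz : 0 < normc z by rewrite normc_gt0.
  have : (fun n => B / 2 ^+ n) @ \oo --> (0 : R).
    rewrite -(mulr0 B); apply: cvgMr; under eq_fun do rewrite -exprVn.
    by apply: cvg_expr; rewrite ger0_norm ?invf_lt1// ltr1n.
  move=> /cvgrPdist_lt/(_ (normc z / 4)).
  rewrite divr_gt0// => /(_ isT); apply: filterS => n.
  rewrite sub0r normrN => hn; rewrite /cauchy_trunc /inv_normc; congr (_ * _)%:E.
  rewrite !indicE in_setD (_ : z \in square 0 (B / 2 ^+ n) = false) ?andbT//.
  apply/negP => /set_mem /square_normc_lt; rewrite subr0.
  have := ler_norm (B / 2 ^+ n); lra.
have nd z : {homo (fun n => (cauchy_trunc B n z)%:E) : m n / (m <= n)%N >-> (m <= n)%E}.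
  move=> m n mn; rewrite lee_fin /cauchy_trunc ler_wpM2l ?invr_ge0 ?normc_ge0//.
  rewrite !indicE ler_nat !in_setD; case: (z \in square 0 B) => //=.
  have [h|_] := boolP (z \in square 0 (B / 2 ^+ n)); last by rewrite leq_b1.
  rewrite (mem_set (square_subset _ (set_mem h)))//.
  by rewrite ler_wpM2l// ?(ltW B0)// lef_pV2 ?posrE ?exprn_gt0// ler_weXn2l// ler1n.
have lim_e : (\int[area]_z (inv_normc B z)%:E)%E =
    limn (fun n => \int[area]_z (cauchy_trunc B n z)%:E)%E.
  have m1 : forall n, measurable_fun setT (fun z : R[i] => (cauchy_trunc B n z)%:E).
    by move=> n; apply/measurable_EFinP; exact: measurable_cauchy_trunc.
  have m2 : forall n (z : R[i]), setT z -> (0 <= (cauchy_trunc B n z)%:E)%E.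
    by move=> n z _; rewrite lee_fin cauchy_trunc_ge0.
  rewrite -(monotone_convergence _ measurableT m1 m2 (fun z _ => nd z)).
  by apply: eq_integral => z _; apply/esym/cvg_lim => //; exact: cv.
apply: (@le_trans _ _ (limn (fun n => \int[area]_z (cauchy_trunc B n z)%:E)%E)).
  by rewrite -lim_e.
apply: lime_le; last first.
  apply: nearW => n; apply: le_trans (integral_cauchy_trunc n B0) _.
  have h : 0 <= (2 ^+ n)^-1 :> R by rewrite invr_ge0 exprn_ge0.
  by rewrite lee_fin; have := mulr_ge0 (ltW B0) h; lra.
apply: ereal_nondecreasing_is_cvgn => m n mn; apply: ge0_le_integral => //.
- by move=> z _; rewrite lee_fin cauchy_trunc_ge0.
- by apply/measurable_EFinP; exact: measurable_cauchy_trunc.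
- by apply/measurable_EFinP; exact: measurable_cauchy_trunc.
- by move=> z _; exact: nd.
Qed.

Lemma measurable_inv_normc_square B : measurable_fun setT (inv_normc B).
Proof.
apply: measurable_funM; first exact: measurable_inv_normc.
by apply: measurable_indic; exact: measurable_square.
Qed.

Lemma inv_normc_ge0 B z : 0 <= inv_normc B z.
Proof. by rewrite mulr_ge0 ?invr_ge0 ?normc_ge0// indicE ler0n. Qed.

Lemma integrable_inv_normc B : 0 < B ->
  area.-integrable setT (EFin \o inv_normc B).
Proof.
move=> B0; apply/integrableP; split.
  by apply/measurable_EFinP; exact: measurable_inv_normc_square.
apply: le_lt_trans (ltry (16 * B)); apply: le_trans (integral_inv_normc B0).
rewrite le_eqVlt; apply/orP; left; apply/eqP; apply: eq_integral => z _ /=.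
by rewrite ger0_norm// inv_normc_ge0.
Qed.

Lemma integrable_inv_normc_shift (a : R[i]) B : 0 < B ->
  area.-integrable setT (EFin \o (fun z => inv_normc B (z - a))).
Proof. by move=> /integrable_inv_normc/(integral_shift (- a))[]. Qed.

Lemma cintegrable_cauchy (g : R[i] -> R[i]) (a : R[i]) (M rho : R) :
  measurable_fun setT g -> (forall z, normc (g z) <= M) ->
  (forall z, rho < normc z -> g z = 0) -> cintegrable (fun z => g z / (z - a)).
Proof.
move=> mg gM g0.
have M0 : 0 <= M by apply: le_trans (gM 0); exact: normc_ge0.
(* Large enough for the support of [g], seen from [a], to lie in the square of radius [B]. *)
pose B := `|rho| + normc a + 1.
have B0 : 0 < B by rewrite ltr_wpDl// addr_ge0// normc_ge0.
have := integrableZl measurableT M (integrable_inv_normc_shift a B0).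
apply: cintegrable_le.
  apply: measurable_complexM => //; apply: measurable_complexV.
  exact: measurable_shift.
move=> z; rewrite /inv_normc normcM normcV mulrA.
have [zr|zr] := leP (normc z) rho; last first.
  by rewrite g0// normc0 mul0r !mulr_ge0 ?invr_ge0 ?normc_ge0// indicE ler0n.
rewrite indicE mem_set ?mulr1 ?ler_wpM2r ?invr_ge0 ?normc_ge0//.
apply: normc_lt_square; rewrite subr0; have := normcB z a; have := ler_norm rho.
rewrite /B; lra.
Qed.

End WeakSingularity.

(** * Bisection of boxes *)

Section Bisection.
Context {R : realType}.

Definition cbox (p : R[i]) (d : R) : set R[i] := [set z |
  complex.Re p <= complex.Re z <= complex.Re p + 3 * d /\
  complex.Im p <= complex.Im z <= complex.Im p + 3 * d].

Definition subcorner (p : R[i]) (d : R) (j k : 'I_4) : R[i] :=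
  (complex.Re p + d / 2 * j%:R) +i* (complex.Im p + d / 2 * k%:R).

(* The boxes follow the supports of quadratic B-splines: the refined support
   [j, j + 3] / 2, with 0 <= j <= 3, overlaps its neighbours inside [0, 3]. *)
Lemma bisection (P : R[i] -> R -> Prop) (p0 : R[i]) (d0 : R) : 0 < d0 ->
  (forall p d, 0 < d -> (forall j k, P (subcorner p d j k) (d / 2)) -> P p d) ->
  (forall c, cbox p0 d0 c -> exists2 r : R, 0 < r &
    forall p d, 0 < d < r -> cbox p d c -> P p d) ->
  P p0 d0.
Proof.
move=> d00 Hsub Hloc; apply: contrapT => nP.
(* The implications stand inside the existential so that choice yields a total function [nxt]. *)
have step p d : exists q : R[i], 0 < d -> ~ P p d ->
    ~ P q (d / 2) /\ exists j k, q = subcorner p d j k.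
  have [h|h] := pselect (0 < d /\ ~ P p d); last first.
    by exists 0 => d_ P_; exfalso; apply: h.
  case: h => d_ nPd.
  have [j /existsNP[k nk]] : exists j, ~ forall k, P (subcorner p d j k) (d / 2).
    by apply/existsNP => H; apply: nPd; exact: Hsub.
  by exists (subcorner p d j k) => _ _; split => //; exists j, k.
pose nxt p d := sval (cid (step p d)).
have nxtP p d : 0 < d -> ~ P p d -> ~ P (nxt p d) (d / 2) /\
    exists j k, nxt p d = subcorner p d j k by exact: svalP (cid (step p d)).
pose ps := fix ps n := if n is m.+1 then nxt (ps m) (d0 / 2 ^+ m) else p0.
have dn n : 0 < d0 / 2 ^+ n by rewrite divr_gt0// exprn_gt0.
have dS n : d0 / 2 ^+ n.+1 = d0 / 2 ^+ n / 2 by rewrite exprSr invfM mulrA.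
have nPn n : ~ P (ps n) (d0 / 2 ^+ n).
  elim: n => [|n IH]; first by rewrite expr0 divr1.
  by rewrite dS; exact: (nxtP _ _ (dn n) IH).1.
pose nested (g : R[i] -> R) := forall n m, (n <= m)%N ->
  g (ps n) <= g (ps m) /\ g (ps m) + 3 * (d0 / 2 ^+ m) <= g (ps n) + 3 * (d0 / 2 ^+ n).
have main (g : R[i] -> R) :
    (forall p d j k, 0 < d -> g p <= g (subcorner p d j k) <= g p + 3 * (d / 2)) ->
    nested g.
  move=> hg n m; elim: m => [|m IH].
    by rewrite leqn0 => /eqP ->.
  rewrite leq_eqVlt => /predU1P[->//|]; rewrite ltnS => /IH[h1 h2].
  have [_ [j [k e]]] := nxtP _ _ (dn m) (nPn m).
  have /andP[] := hg (ps m) _ j k (dn m); rewrite -e -/(ps m.+1) dS.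
  by lra.
have ordb (j : 'I_4) : 0 <= (j%:R : R) <= 3.
  by rewrite ler0n (ler_nat _ j 3) -ltnS ltn_ord.
have gR : nested (@complex.Re R).
  apply: main => p d j k d_; have /andP[j0 j3] := ordb j.
  by rewrite /=; apply/andP; split; nra.
have gI : nested (@complex.Im R).
  apply: main => p d j k d_; have /andP[k0 k3] := ordb k.
  by rewrite /=; apply/andP; split; nra.
(* Lower ends increase and upper ends decrease along the chain of bad boxes, so in each coordinate
   the supremum of the lower ends lies in all of them. *)
have supP (g : R[i] -> R) : nested g ->
    exists s, forall n, g (ps n) <= s <= g (ps n) + 3 * (d0 / 2 ^+ n).
  move=> hg; pose A := [set g (ps n) | n in setT].
  have ub n : ubound A (g (ps n) + 3 * (d0 / 2 ^+ n)).
    move=> _ [m _ <-]; have [nm|/ltnW mn] := leqP n m.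
      have [_] := hg _ _ nm; have := dn m; lra.
    have [] := hg _ _ mn; have := dn n; lra.
  exists (sup A) => n; apply/andP; split.
    apply: ub_le_sup; last by exists n.
    by exists (g (ps 0%N) + 3 * (d0 / 2 ^+ 0)); exact: ub.
  apply: ge_sup; last exact: ub.
  by exists (g (ps 0%N)), 0%N.
have [x hx] := supP _ gR; have [y hy] := supP _ gI.
have cP n : cbox (ps n) (d0 / 2 ^+ n) (x +i* y) by split; [exact: hx|exact: hy].
have := cP 0%N; rewrite /= expr0 divr1 => /Hloc[r r0 Hr].
have : (fun n => d0 / 2 ^+ n) @ \oo --> (0 : R).
  rewrite -(mulr0 d0); apply: cvgMr; under eq_fun do rewrite -exprVn.
  by apply: cvg_expr; rewrite ger0_norm ?invf_lt1// ltr1n.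
move=> /cvgrPdist_lt/(_ r r0)[n _ /(_ n (leqnn _))]; rewrite sub0r normrN.
rewrite ger0_norm ?(ltW (dn n))// => hn.
by apply: (nPn n); apply: Hr => //; rewrite dn hn.
Qed.

End Bisection.

(** * Quadratic B-splines and the hats built from them *)

Section BSpline.
Context {R : realType}.
Implicit Types (t : R) (z p : R[i]).

(** Twice the cardinal quadratic B-spline with knots [0, 1, 2, 3], in the form of a third difference
    of the squared positive part. *)
Definition spline t : R := pospart t ^+ 2 - 3 * pospart (t - 1) ^+ 2 +
  3 * pospart (t - 2) ^+ 2 - pospart (t - 3) ^+ 2.

Definition dspline t : R := 2 * (pospart t - 3 * pospart (t - 1) +
  3 * pospart (t - 2) - pospart (t - 3)).

Lemma pospart_scale (a t : R) : 0 <= a -> pospart (a * t) = a * pospart t.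
Proof.
move=> a0; rewrite /pospart; case: (leP t 0) => ht.
  by rewrite mulr0; apply/max_idPr; nra.
by apply/max_idPl; nra.
Qed.

Lemma pospart_id t : 0 <= t -> pospart t = t.
Proof. by move=> h; exact/max_idPl. Qed.

Lemma pospart_0 t : t <= 0 -> pospart t = 0.
Proof. by move=> h; exact/max_idPr. Qed.

Lemma pospart2 t (k : R) : pospart (2 * t - k) = 2 * pospart (t - k / 2).
Proof. by rewrite -pospart_scale//; congr pospart; field. Qed.

Lemma pospart2B t (k j : R) : pospart (2 * t - k - j) = 2 * pospart (t - (k + j) / 2).
Proof. by rewrite -pospart2 opprD addrA. Qed.

(** Two-scale relation with binomial weights [1, 3, 3, 1]. Both sides are combinations of the
    squares of [pospart (t - k / 2)], and the coefficients agree because [(1 - x ^ 2) ^ 3 = (1 + x)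
    ^ 3 * (1 - x) ^ 3], with [x] standing for a shift by one half. *)
Lemma spline_refine t : spline t =
  4^-1 * (spline (2 * t) + 3 * spline (2 * t - 1) + 3 * spline (2 * t - 2) + spline (2 * t - 3)).
Proof.
rewrite (_ : spline (2 * t) = spline (2 * t - 0)); last by rewrite subr0.
rewrite /spline.
rewrite !pospart2B !pospart2.
rewrite (_ : t - 0 / 2 = t); last by rewrite mul0r subr0.
rewrite (_ : (0 + 1) / 2 = 1 / 2); last by field.
rewrite (_ : (0 + 2) / 2 = 1); last by field.
rewrite (_ : (0 + 3) / 2 = 3 / 2); last by field.
rewrite (_ : (1 + 1) / 2 = 1); last by field.
rewrite (_ : (1 + 2) / 2 = 3 / 2); last by field.
rewrite (_ : (1 + 3) / 2 = 2); last by field.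
rewrite (_ : (2 + 1) / 2 = 3 / 2); last by field.
rewrite (_ : (2 + 2) / 2 = 2); last by field.
rewrite (_ : (2 + 3) / 2 = 5 / 2); last by field.
rewrite (_ : (3 + 1) / 2 = 2); last by field.
rewrite (_ : (3 + 2) / 2 = 5 / 2); last by field.
rewrite (_ : (3 + 3) / 2 = 3); last by field.
by field.
Qed.

(** Derivative of the two-scale relation; the chain rule turns [4^-1] into [2^-1]. *)
Lemma dspline_refine t : dspline t =
  2^-1 * (dspline (2 * t) + 3 * dspline (2 * t - 1) + 3 * dspline (2 * t - 2) + dspline (2 * t - 3)).
Proof.
rewrite (_ : dspline (2 * t) = dspline (2 * t - 0)); last by rewrite subr0.
rewrite /dspline.
rewrite !pospart2B !pospart2.
rewrite (_ : t - 0 / 2 = t); last by rewrite mul0r subr0.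
rewrite (_ : (0 + 1) / 2 = 1 / 2); last by field.
rewrite (_ : (0 + 2) / 2 = 1); last by field.
rewrite (_ : (0 + 3) / 2 = 3 / 2); last by field.
rewrite (_ : (1 + 1) / 2 = 1); last by field.
rewrite (_ : (1 + 2) / 2 = 3 / 2); last by field.
rewrite (_ : (1 + 3) / 2 = 2); last by field.
rewrite (_ : (2 + 1) / 2 = 3 / 2); last by field.
rewrite (_ : (2 + 2) / 2 = 2); last by field.
rewrite (_ : (2 + 3) / 2 = 5 / 2); last by field.
rewrite (_ : (3 + 1) / 2 = 2); last by field.
rewrite (_ : (3 + 2) / 2 = 5 / 2); last by field.
rewrite (_ : (3 + 3) / 2 = 3); last by field.
by field.
Qed.

(** To the right of [3] all positive parts are linear, and a third difference annihilates
    polynomials of degree at most two. *)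
Lemma spline_out t : ~ (0 <= t <= 3) -> spline t = 0 /\ dspline t = 0.
Proof.
move=> /negP; rewrite negb_and -!ltNge => /orP[t0|t3]; rewrite /spline /dspline.
  by rewrite !pospart_0 ?expr0n; [split; ring|lra..].
by rewrite !pospart_id; [split; ring|lra..].
Qed.

(** Crude: on [[0, 3]] every positive part is at most [3], and [36 = 9 + 3 * 9]. *)
Lemma spline_bound t : `|spline t| <= 36 /\ `|dspline t| <= 36.
Proof.
have [/andP[t0 t3]|nt] := boolP (0 <= t <= 3); last first.
  by have [-> ->] := spline_out (negP nt); rewrite normr0.
have pb k : 0 <= k -> 0 <= pospart (t - k) <= 3.
  by move=> k0; rewrite pospart_ge0 /= /pospart ge_max; apply/andP; split; lra.
have := pb 0 (lexx _); rewrite subr0 => /andP[a0 a1].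
have /andP[b0 b1] := pb 1 ler01; have /andP[c0 c1] := pb 2 ltac:(by []).
have /andP[d0 d1] := pb 3 ltac:(by []).
rewrite /spline /dspline !ler_norml; split; apply/andP; split; nra.
Qed.

Definition coordx p (d : R) z : R := (complex.Re z - complex.Re p) / d.
Definition coordy p (d : R) z : R := (complex.Im z - complex.Im p) / d.

Definition hat p d z : R[i] := (spline (coordx p d z) * spline (coordy p d z))%:C.
Definition dhat p d z : R[i] := (d^-1)%:C *
  ((dspline (coordx p d z) * spline (coordy p d z))%:C +
   'i * (spline (coordx p d z) * dspline (coordy p d z))%:C).

Lemma dbar_spline_Re p d : d != 0 ->
  dbar_pair (fun z => (spline (coordx p d z))%:C) (fun z => (d^-1 * dspline (coordx p d z))%:C).
Proof.
move=> d0.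
have h (x : R) k : (x - complex.Re p) / d - k = d^-1 * x + (- complex.Re p / d - k) by field.
have h0 (x : R) : (x - complex.Re p) / d = d^-1 * x + (- complex.Re p / d - 0) by field.
pose c k := dbar_pospart_Re d^-1 (- complex.Re p / d - k).
have := dbarD (dbarD (dbarD (c 0) (dbarZ (- 3)%:C (c 1))) (dbarZ 3%:C (c 2))) (dbarZ (-1)%:C (c 3)).
congr dbar_pair; apply/funext => z; rewrite -!rmorphM -!rmorphD; congr (_%:C);
  by rewrite /spline /dspline /coordx !h !h0; ring.
Qed.

Lemma dbar_spline_Im p d : d != 0 ->
  dbar_pair (fun z => (spline (coordy p d z))%:C)
    (fun z => 'i * (d^-1 * dspline (coordy p d z))%:C).
Proof.
move=> d0.
have h (x : R) k : (x - complex.Im p) / d - k = d^-1 * x + (- complex.Im p / d - k) by field.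
have h0 (x : R) : (x - complex.Im p) / d = d^-1 * x + (- complex.Im p / d - 0) by field.
pose c k := dbar_pospart_Im d^-1 (- complex.Im p / d - k).
have := dbarD (dbarD (dbarD (c 0) (dbarZ (- 3)%:C (c 1))) (dbarZ 3%:C (c 2))) (dbarZ (-1)%:C (c 3)).
congr dbar_pair; apply/funext => z.
  rewrite -!rmorphM -!rmorphD; congr (_%:C).
  by rewrite /spline /coordy !h !h0; ring.
rewrite ![_ * ('i * _)]mulrCA -!mulrDr -!rmorphM -!rmorphD; congr (_ * _%:C).
by rewrite /dspline /coordy !h !h0; ring.
Qed.

Lemma dbar_hat p d : d != 0 -> dbar_pair (hat p d) (dhat p d).
Proof.
move=> d0; have := dbarM (dbar_spline_Re p d0) (dbar_spline_Im p d0).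
congr dbar_pair; apply/funext => z; rewrite /hat /dhat !rmorphM//.
by ring.
Qed.

End BSpline.

(** * Goursat's lemma with spline cutoffs *)

Section Goursat.
Context {R : realType}.
Implicit Types (z p c : R[i]) (d : R) (f s Es : R[i] -> R[i]).

Definition bweight (j : 'I_4) : R := nth 0 [:: 1; 3; 3; 1] j.

Lemma spline_sum t : spline t = 4^-1 * \sum_(j < 4) bweight j * spline (2 * t - j%:R) :> R.
Proof.
rewrite spline_refine !big_ord_recr big_ord0 /= /bweight /=.
by rewrite subr0; ring.
Qed.

Lemma dspline_sum t : dspline t = 2^-1 * \sum_(j < 4) bweight j * dspline (2 * t - j%:R) :> R.
Proof.
rewrite dspline_refine !big_ord_recr big_ord0 /= /bweight /=.
by rewrite subr0; ring.
Qed.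

Lemma coordx_sub p d j k z : d != 0 ->
  coordx (subcorner p d j k) (d / 2) z = 2 * coordx p d z - j%:R.
Proof. by move=> d0; rewrite /coordx /=; field. Qed.

Lemma coordy_sub p d j k z : d != 0 ->
  coordy (subcorner p d j k) (d / 2) z = 2 * coordy p d z - k%:R.
Proof. by move=> d0; rewrite /coordy /=; field. Qed.

Definition bweight2 (j k : 'I_4) : R[i] := (bweight j * bweight k / 16)%:C.

Lemma product_sum (a b : 'I_4 -> R) (u v w : R) : u * v = w / 16 ->
  (u * \sum_j bweight j * a j) * (v * \sum_k bweight k * b k) =
  w * \sum_j \sum_k bweight j * bweight k / 16 * (a j * b k).
Proof.
move=> uv; rewrite mulrACA uv big_distrlr /= !mulr_sumr; apply: eq_bigr => j _.
by rewrite !mulr_sumr; apply: eq_bigr => k _; ring.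
Qed.

Lemma hat_refine p d z : d != 0 ->
  hat p d z = \sum_j \sum_k bweight2 j k * hat (subcorner p d j k) (d / 2) z.
Proof.
move=> d0; rewrite /hat spline_sum [in X in _ * X]spline_sum.
rewrite (@product_sum _ _ _ _ 1); last by field.
rewrite mul1r rmorph_sum; apply: eq_bigr => j _; rewrite rmorph_sum; apply: eq_bigr => k _.
by rewrite coordx_sub// coordy_sub// rmorphM.
Qed.

Lemma dhat_refine p d z : d != 0 ->
  dhat p d z = \sum_j \sum_k bweight2 j k * dhat (subcorner p d j k) (d / 2) z.
Proof.
move=> d0; rewrite /dhat.
rewrite {1}spline_sum {1}dspline_sum {1}[in X in _ + _ * X]spline_sum [in X in _ + _ * X]dspline_sum.
rewrite (@product_sum _ _ _ _ 2); last by field.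
rewrite (@product_sum _ _ _ _ 2); last by field.
rewrite !rmorphM !rmorph_sum !mulr_sumr -big_split /= mulr_sumr; apply: eq_bigr => j _.
rewrite !rmorph_sum !mulr_sumr -big_split /= mulr_sumr; apply: eq_bigr => k _.
rewrite coordx_sub// coordy_sub// /bweight2 invfM invrK !rmorphM.
by ring.
Qed.

Lemma bweight_ge0 j : 0 <= bweight j.
Proof. by case: j => -[|[|[|[|]]]]. Qed.

(** The total [8 * 8 / 16 = 4] offsets the factor [(1 / 2) ^ 2] lost by halving [d], so a bound of
    order [d ^ 2] passes from the sixteen sub-boxes to the box without loss. *)
Lemma bweight2_sum : \sum_j \sum_k normc (bweight2 j k) = 4.
Proof.
under eq_bigr => j _ do under eq_bigr => k _ do
  rewrite normc_real ger0_norm ?divr_ge0 ?mulr_ge0 ?bweight_ge0//.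
by rewrite !big_ord_recr !big_ord0 /= /bweight /=; field.
Qed.

Lemma cbox_dist p d z c : cbox p d z -> cbox p d c -> normc (z - c) <= 6 * d.
Proof.
move=> [/andP[? ?] /andP[? ?]] [/andP[? ?] /andP[? ?]].
apply: le_trans (normc_le_ReIm _) _; rewrite !ReImE.
have h1 : `|complex.Re z - complex.Re c| <= 3 * d by rewrite ler_norml; apply/andP; split; lra.
have h2 : `|complex.Im z - complex.Im c| <= 3 * d by rewrite ler_norml; apply/andP; split; lra.
lra.
Qed.

Lemma cbox_corner p d : 0 <= d -> cbox p d p.
Proof. by move=> d0; split; apply/andP; split; lra. Qed.

Lemma subcorner_cbox p d j k : 0 <= d -> cbox (subcorner p d j k) (d / 2) `<=` cbox p d.
Proof.
move=> d0; have hj (i : 'I_4) : 0 <= (i%:R : R) <= 3.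
  by rewrite ler0n (ler_nat _ i 3) -ltnS ltn_ord.
have /andP[j0 j3] := hj j; have /andP[k0 k3] := hj k.
move=> z [/= /andP[? ?] /andP[? ?]]; split; apply/andP; split; nra.
Qed.

(** Index [0] reaches up to [3 * (d / 2)], where index [3] begins, so the four extreme sub-boxes
    suffice. *)
Lemma cbox_cover p d z : 0 < d -> cbox p d z ->
  exists j k, (j \in [:: ord0; ord_max]) /\ (k \in [:: ord0; ord_max]) /\
    cbox (subcorner p d j k) (d / 2) z.
Proof.
move=> d0 [/andP[x0 x1] /andP[y0 y1]].
exists (if complex.Re z <= complex.Re p + 3 * (d / 2) then ord0 else ord_max : 'I_4).
exists (if complex.Im z <= complex.Im p + 3 * (d / 2) then ord0 else ord_max : 'I_4).
do 2 (split; first by case: ifP).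
rewrite /cbox /=.
by split; case: ifPn; rewrite -?ltNge /= => h; apply/andP; split; lra.
Qed.

Lemma cderiv_bound f c L : cderiv f c L -> exists2 r : R, 0 < r &
  forall z, normc (z - c) < r -> normc (f z - f c) <= (normc L + 1) * normc (z - c).
Proof.
move=> /(_ 1 ltr01)[r r0 H]; exists r => // z /H.
rewrite [c + _]addrC subrK mul1r => h.
rewrite (_ : f z - f c = (f z - f c - L * (z - c)) + L * (z - c)); last by ring.
by apply: le_trans (normcD _ _) _; rewrite normcM; lra.
Qed.

(** Differentiability bounds [f] near each point; bisection glues the local bounds, as compactness
    would. *)
Lemma cbox_bounded f p d : 0 < d ->
  (forall z, cbox p d z -> exists L, cderiv f z L) ->
  exists M, forall z, cbox p d z -> normc (f z) <= M.
Proof.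
move=> d0 df.
pose P p' d' := exists M, forall z, cbox p d z -> cbox p' d' z -> normc (f z) <= M.
suff : P p d by move=> [M H]; exists M => z zb; exact: H.
apply: bisection => //.
- move=> q e e0 H; pose S j k := sval (cid (H j k)).
  have HS j k : forall z, cbox p d z -> cbox (subcorner q e j k) (e / 2) z -> normc (f z) <= S j k.
    exact: svalP (cid (H j k)).
  exists (\sum_j \sum_k `|S j k|) => z zb /(cbox_cover e0)[j [k [_ [_ zq]]]].
  apply: le_trans (HS j k z zb zq) _; apply: le_trans (ler_norm _) _.
  rewrite (bigD1 j)//= (bigD1 k)//= -addrA lerDl addr_ge0// sumr_ge0//.
  by move=> i _; rewrite sumr_ge0.
- move=> c cb; have [L /cderiv_bound[r r0 Hr]] := df c cb.
  exists (r / 6); first by rewrite divr_gt0.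
  move=> q e /andP[e0 er] qc; exists (normc (f c) + (normc L + 1) * r) => z _ zq.
  have zc := cbox_dist zq qc; have zr : normc (z - c) < r by lra.
  have := Hr z zr; have := normcD (f z - f c) (f c); rewrite subrK.
  have := normc_ge0 L; have := normc_ge0 (z - c); nra.
Qed.

Definition hatprod s Es p d z := Es z * hat p d z + s z * dhat p d z.

Lemma dbar_hatprod s Es p d : d != 0 -> dbar_pair s Es ->
  dbar_pair (fun z => s z * hat p d z) (hatprod s Es p d).
Proof. by move=> d0 h; exact: dbarM h (dbar_hat p d0). Qed.

Lemma coord_cbox p d z : 0 < d -> ~ cbox p d z ->
  ~ (0 <= coordx p d z <= 3) \/ ~ (0 <= coordy p d z <= 3).
Proof.
move=> d0 H; apply: contrapT => /not_orP[/contrapT/andP[a b] /contrapT/andP[a' b']].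
apply: H; move: a b a' b'; rewrite /coordx /coordy !pmulr_lge0 ?invr_gt0// !ler_pdivrMr// => ? ? ? ?.
by split; apply/andP; split; lra.
Qed.

Lemma hat_out p d z : 0 < d -> ~ cbox p d z -> hat p d z = 0 /\ dhat p d z = 0.
Proof.
move=> d0 /(coord_cbox d0)[] /spline_out[e1 e2]; rewrite /hat /dhat e1 e2.
  by rewrite !mul0r !mulr0 addr0 mulr0.
by rewrite !mulr0 addr0 mulr0.
Qed.

Lemma hat_bound : exists2 C : R, 0 < C & forall p d z, 0 < d ->
  normc (hat p d z) <= C /\ normc (dhat p d z) <= C / d.
Proof.
exists (36 * 36 + 36 * 36); first by rewrite addr_gt0// mulr_gt0.
move=> p d z d0.
have [a1 a2] := spline_bound (coordx p d z); have [b1 b2] := spline_bound (coordy p d z).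
have mb (x y : R) : `|x| <= 36 -> `|y| <= 36 -> normc (x * y)%:C <= 36 * 36.
  by move=> hx hy; rewrite normc_real normrM; exact: ler_pM.
split; first by apply: le_trans (mb _ _ a1 b1) _; rewrite lerDl mulr_ge0.
rewrite /dhat normcM normc_real ger0_norm ?invr_ge0 ?(ltW d0)// mulrC.
rewrite ler_pM2r ?invr_gt0//; apply: le_trans (normcD _ _) _.
by rewrite normcM normci mul1r; apply: lerD; exact: mb.
Qed.

Lemma hatprod_out s Es p d z : 0 < d -> ~ cbox p d z -> hatprod s Es p d z = 0.
Proof. by move=> d0 /(hat_out d0)[e1 e2]; rewrite /hatprod e1 e2 !mulr0 addr0. Qed.

Lemma hatprod_bound s Es p d : 0 < d -> dbar_pair s Es -> exists2 K : R, 0 < K &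
  forall q e z, 0 < e -> cbox q e `<=` cbox p d -> normc (hatprod s Es q e z) <= K / e.
Proof.
move=> d0 /(dbar_bounded (normc p + 6 * d))[M M0 HM].
have [C C0 HC] := hat_bound.
have MC := mulr_gt0 M0 C0.
(* The derivative of the hat costs [1 / e]; the other term is at most [M * C <= M * C * d / e],
   because a sub-box has [e <= d]. *)
exists (M * C * (d + 1)); first by rewrite mulr_gt0// addr_gt0.
move=> q e z e0 qp.
have ed : e <= d.
  have [/andP[a _] _] := qp _ (cbox_corner q (ltW e0)).
  have := qp ((complex.Re q + 3 * e) +i* complex.Im q); rewrite /cbox /= => -[].
    by split; apply/andP; split; lra.
  by move=> /andP[? ?] _; lra.
have [zq|/(hatprod_out s Es e0)->] := pselect (cbox q e z); last first.
  by rewrite normc0 divr_ge0 ?(ltW e0)// mulr_ge0 ?(ltW MC)// addr_ge0// ltW.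
have zM : normc z <= normc p + 6 * d.
  have := cbox_dist (qp z zq) (cbox_corner p (ltW d0)).
  have := normcD (z - p) p; rewrite subrK; lra.
have [h1 h2] := HM z zM; have [b1 b2] := HC q e z e0.
apply: le_trans (normcD _ _) _.
have := lerD (normcM_le h2 b1) (normcM_le h1 b2).
move=> h; apply: le_trans h _; rewrite ler_pdivlMr//.
rewrite mulrDl !mulrA divfK ?gt_eqF//.
nra.
Qed.

Lemma cint_cbox f p d M : 0 < d -> measurable_fun setT f ->
  (forall z, cbox p d z -> normc (f z) <= M) -> (forall z, ~ cbox p d z -> f z = 0) ->
  cintegrable f /\ normc (cint f) <= 32 * M * d ^+ 2.
Proof.
move=> d0 mf fM f0.
(* A closed box of side [3 * d] lies in the open square of radius [2 * d] about its centre, of area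
   [16 * d ^ 2]; doubled by [cint_bounded], this is the [32]. *)
pose c := (complex.Re p + 3 / 2 * d) +i* (complex.Im p + 3 / 2 * d).
have r0 : 0 <= 2 * d by rewrite mulr_ge0// ltW.
have bs : cbox p d `<=` square c (2 * d).
  by move=> z [/andP[? ?] /andP[? ?]]; split; apply/andP; split; rewrite /=; lra.
have M0 : 0 <= M by apply: le_trans (fM p (cbox_corner p (ltW d0))); exact: normc_ge0.
have [||z _|z zs|i h] := @cint_bounded R f (square c (2 * d)) M mf.
- exact: measurable_square.
- by rewrite area_square// ltry.
- have [/fM//|/f0->] := pselect (cbox p d z); by rewrite normc0.
- by apply: f0 => /bs.
split => //; apply: le_trans h _; rewrite area_square//=.
by rewrite exprMn le_eqVlt; apply/orP; left; apply/eqP; ring.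
Qed.

(** Goursat's argument with a smooth weight in place of a contour. The refinement equations
    distribute the integral over the sub-boxes; near a point where [f] is differentiable its affine
    part integrates to [0] by [cint_dbar], and the rest is small compared with the area. *)
Theorem goursat_hat f s Es p d : 0 < d -> measurable_fun setT f ->
  (forall z, cbox p d z -> exists L, cderiv f z L) -> dbar_pair s Es ->
  cintegrable (fun z => f z * hatprod s Es p d z) /\
  cint (fun z => f z * hatprod s Es p d z) = 0.
Proof.
move=> d0 mf df ds.
have [Mf HMf] := cbox_bounded d0 df.
have [K K0 HK] := hatprod_bound p d0 ds.
have Mf0 : 0 <= Mf by apply: le_trans (HMf p (cbox_corner p (ltW d0))); exact: normc_ge0.
have mQ q e : 0 < e -> measurable_fun setT (hatprod s Es q e).
  by move=> e0; have [_] := dbar_pair_measurable (dbar_hatprod q (lt0r_neq0 e0) ds).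
have iQ q e : 0 < e -> cbox q e `<=` cbox p d ->
    cintegrable (fun z => f z * hatprod s Es q e z).
  move=> e0 qp; have [|z zq|z zq|//] := @cint_cbox (fun z => f z * hatprod s Es q e z) q e (Mf * (K / e)) e0.
  - by apply: measurable_complexM => //; exact: mQ.
  - by apply: normcM_le; [exact/HMf/qp|exact: HK].
  - by rewrite hatprod_out// mulr0.
split; first exact: iQ.
apply: eq0_normc; apply/eqP; rewrite eq_le normc_ge0 andbT.
(* The bound [eta * d ^ 2] is the form that is stable under refinement, by [bweight2_sum]. *)
suff main (eta : R) : 0 < eta ->
    normc (cint (fun z => f z * hatprod s Es p d z)) <= eta * d ^+ 2.
  apply/ler_addgt0Pr => e e0; rewrite add0r.
  have d2 : 0 < d ^+ 2 by rewrite exprn_gt0.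
  by have := main (e / d ^+ 2); rewrite divr_gt0// => /(_ isT); rewrite divfK// gt_eqF.
move=> eta0.
pose P q e := cbox q e `<=` cbox p d ->
  normc (cint (fun z => f z * hatprod s Es q e z)) <= eta * e ^+ 2.
suff : P p d by exact.
apply: bisection => // {mQ}.
- move=> q e e0 H qp.
  have e2 : 0 < e / 2 by rewrite divr_gt0.
  have sub j k : cbox (subcorner q e j k) (e / 2) `<=` cbox p d.
    by apply: subset_trans qp; apply: subcorner_cbox; exact: ltW.
  have ijk j k := iQ _ _ e2 (sub j k).
  rewrite (@eq_cint _ _ (fun z => \sum_j \sum_k bweight2 j k *
      (f z * hatprod s Es (subcorner q e j k) (e / 2) z))); last first.
    move=> z; rewrite /hatprod hat_refine ?gt_eqF// dhat_refine ?gt_eqF//.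
    rewrite !mulr_sumr -big_split /= mulr_sumr; apply: eq_bigr => j _.
    rewrite !mulr_sumr -big_split /= mulr_sumr; apply: eq_bigr => k _.
    by ring.
  rewrite cint_sum; last by move=> j; apply: cintegrable_sum => k; exact: cintegrableZ.
  have nsum (I : finType) (F : I -> R[i]) : normc (\sum_i F i) <= \sum_i normc (F i).
    elim/big_ind2 : _ => //; first by rewrite normc0.
    by move=> x1 x2 y1 y2 h1 h2; apply: le_trans (normcD _ _) _; exact: lerD.
  apply: le_trans (nsum _ _) _.
  have -> : eta * e ^+ 2 = \sum_j \sum_k normc (bweight2 j k) * (eta * (e / 2) ^+ 2).
    under eq_bigr do rewrite -mulr_suml.
    by rewrite -mulr_suml bweight2_sum; field.
  apply: ler_sum => j _; rewrite cint_sum; last by move=> k; exact: cintegrableZ.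
  apply: le_trans (nsum _ _) _; apply: ler_sum => k _.
  rewrite cintZ// normcM ler_wpM2l ?normc_ge0//.
  exact: H.
- move=> c cb; have [L dL] := df c cb.
  (* [192 = 32 * 6]: the error is [eta / (192 * K)] times the diameter bound [6 * e], times [K / e]
     from the weight, times [32 * e ^ 2] from the integration. *)
  have eta'0 : 0 < eta / (192 * K) by rewrite divr_gt0// mulr_gt0.
  have [r r0 Hr] := dL _ eta'0.
  exists (r / 6); first by rewrite divr_gt0.
  move=> q e /andP[e0 er] qc qp.
  pose l z := f c + L * (z - c).
  have dl : dbar_pair l (fun=> 0).
    apply: dbar_pair_eq (dbarD (dbar_cst (f c)) (dbarZ L (dbarD (dbar_id) (dbar_cst (- c))))) _.
    by move=> z; cbv beta; ring.
  have e0' : e != 0 by rewrite gt_eqF.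
  have dlQ := dbarM dl (dbar_hatprod q e0' ds).
  have [] := cint_dbar (rho := normc q + 6 * e) dlQ.
    move=> z zq; have [zc|zc] := pselect (cbox q e z); last first.
      by rewrite (hat_out e0 zc).1 !mulr0.
    exfalso; have := cbox_dist zc (cbox_corner q (ltW e0)).
    by have := normcD (z - q) q; rewrite subrK; lra.
  under eq_fun do rewrite mul0r add0r.
  move=> il el; have iq := iQ q e e0 qp.
  rewrite -(subr0 (cint _)) -el -cintB//.
  have [|z zq|z zq|_ h] := @cint_cbox (fun z => f z * hatprod s Es q e z - l z * hatprod s Es q e z) q e
      (eta / (192 * K) * (6 * e) * (K / e)) e0.
  - by apply: cintegrable_measurable; exact: cintegrableB.
  - rewrite -mulrBl; apply: normcM_le; last exact: HK.
    have zc := cbox_dist zq qc.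
    have := Hr (z - c); rewrite [c + _]addrC subrK => /(_ _)/le_trans; rewrite /l opprD addrA; apply; first lra.
    by rewrite ler_pM2l.
  - by rewrite hatprod_out// !mulr0 subrr.
  apply: le_trans h _; rewrite le_eqVlt; apply/orP; left; apply/eqP.
  by field; rewrite e0' gt_eqF.
Qed.

End Goursat.

(** * The Cauchy-Pompeiu formula *)

Section CauchyPompeiu.
Context {R : realType}.
Implicit Types (z a c : R[i]) (G E u e g : R[i] -> R[i]) (eps : R).

(** The kernel [1 / (z - a)] smoothed at distance about [sqrt eps]; its partner [dkreg] is an
    approximate point mass at [a]. *)
Definition kreg eps a z := (z - a)^* / ((z - a) * (z - a)^* + eps%:C).
Definition dkreg eps a z := (2 * eps)%:C / ((z - a) * (z - a)^* + eps%:C) ^+ 2.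

Lemma kreg_den eps a z :
  (z - a) * (z - a)^* + eps%:C = (normc (z - a) ^+ 2 + eps)%:C.
Proof. by rewrite mulcJ rmorphD. Qed.

Lemma kreg_den_gt0 eps a z : 0 < eps -> 0 < normc (z - a) ^+ 2 + eps.
Proof. by move=> e0; rewrite ltr_wpDl// sqr_ge0. Qed.

Lemma dbar_kreg eps a : 0 < eps -> dbar_pair (kreg eps a) (dkreg eps a).
Proof.
move=> e0.
have h1 : dbar_pair (fun z => z - a) (fun=> 0).
  by apply: dbar_pair_eq (dbarD dbar_id (dbar_cst (- a))) _ => z; rewrite addr0.
have h2 : dbar_pair (fun z => (z - a)^*) (fun=> 2).
  have := dbarD dbar_conj (dbar_cst (- a^*)); congr dbar_pair; apply/funext => z.
    by rewrite rmorphB.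
  by rewrite addr0.
have h3 := dbarD (dbarM h1 h2) (dbar_cst eps%:C).
have h4 := dbarV e0 _ h3.
apply: dbar_pair_eq (dbarM h2 (h4 _)) _ => z.
  rewrite kreg_den normc_real (ger0_norm (ltW (kreg_den_gt0 a z e0))).
  by rewrite lerDr sqr_ge0.
rewrite /dkreg; cbv beta.
have q0 : (z - a) * (z - a)^* + eps%:C != 0.
  by rewrite kreg_den; apply/eqP => -[/eqP]; rewrite gt_eqF// kreg_den_gt0.
have -> : (2 * eps)%:C = 2 * eps%:C :> R[i] by rewrite rmorphM rmorph_nat.
rewrite -[conjc (z - a)]/(Num.conj (z - a)); move: q0.
by move: (Num.conj (z - a)) (eps%:C) (z - a) => u v w q0; field.
Qed.

Lemma kreg_bound eps a z : 0 < eps ->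
  normc (kreg eps a z) <= (normc (z - a))^-1.
Proof.
move=> e0; rewrite /kreg kreg_den normcM normcV normc_conj normc_real.
rewrite (ger0_norm (ltW (kreg_den_gt0 a z e0))).
have [->|w0] := eqVneq (z - a) 0; first by rewrite normc0 mul0r invr0.
have n0 : 0 < normc (z - a) by rewrite normc_gt0.
rewrite ler_pdivrMr ?kreg_den_gt0// mulrDr expr2 mulKf ?gt_eqF// lerDl.
by rewrite mulr_ge0 ?invr_ge0 ?(ltW e0) ?(ltW n0).
Qed.

(** The factor [normc (z - a)] will be provided by a function vanishing at [a]. With it the
    approximate point mass is dominated by the locally integrable [1 / |z - a|], uniformly in
    [eps]. *)
Lemma dkreg_bound eps a z : 0 < eps ->
  normc (z - a) * normc (dkreg eps a z) <= (normc (z - a))^-1.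
Proof.
move=> e0; rewrite /dkreg kreg_den -rmorphXn normcM normcV !normc_real.
have q0 := kreg_den_gt0 a z e0.
rewrite (ger0_norm (sqr_ge0 _)) (@ger0_norm _ (2 * eps)) ?mulr_ge0 ?(ltW e0)//.
have [->|w0] := eqVneq (z - a) 0; first by rewrite normc0 mul0r invr0.
have n0 : 0 < normc (z - a) by rewrite normc_gt0.
rewrite -(ler_pM2l n0) mulfV ?gt_eqF// mulrA mulrA ler_pdivrMr ?exprn_gt0// mul1r.
have := sqr_ge0 (normc (z - a) ^+ 2 - eps); set x := normc _ in n0 *.
by have := sqr_ge0 (x ^+ 2 + eps); nra.
Qed.

Lemma kreg_cvg eps a z : 0 < eps -> z != a ->
  normc (kreg eps a z - (z - a)^-1) <= eps / normc (z - a) ^+ 3 /\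
  normc (dkreg eps a z) <= 2 * eps / normc (z - a) ^+ 4.
Proof.
move=> e0; rewrite -subr_eq0; set w := z - a => w0.
have n0 : 0 < normc w by rewrite normc_gt0.
have q0 : 0 < normc w ^+ 2 + eps by rewrite ltr_wpDl// sqr_ge0.
have qC0 : (normc w ^+ 2 + eps)%:C != 0 :> R[i].
  by apply/eqP => -[/eqP]; rewrite gt_eqF.
have nq : normc w ^+ 2 <= normc w ^+ 2 + eps by rewrite lerDl ltW.
split.
  rewrite /kreg kreg_den -/w.
  have -> : w^* / (normc w ^+ 2 + eps)%:C - w^-1 = - (eps%:C / ((normc w ^+ 2 + eps)%:C * w)).
    have -> : Num.conj w = (normc w ^+ 2)%:C / w by rewrite -mulcJ mulrAC mulfV ?mul1r.
    have -> : (normc w ^+ 2)%:C = (normc w ^+ 2 + eps)%:C - eps%:C by rewrite -rmorphB addrK.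
    by move: ((normc w ^+ 2 + eps)%:C) qC0 => q qC0; field; rewrite ?qC0 ?w0.
  rewrite normcN normcM normcV normcM !normc_real (ger0_norm (ltW e0)) (ger0_norm (ltW q0)).
  rewrite ler_pM2l// lef_pV2 ?posrE ?mulr_gt0 ?exprn_gt0//.
  by rewrite exprSr ler_pM2r.
rewrite /dkreg kreg_den -/w -rmorphXn normcM normcV !normc_real.
rewrite (ger0_norm (sqr_ge0 _)) (@ger0_norm _ (2 * eps)) ?mulr_ge0 ?(ltW e0)//.
rewrite ler_pM2l ?mulr_gt0// lef_pV2 ?posrE ?exprn_gt0//.
by rewrite (exprM _ 2 2) ler_sqr ?nnegrE ?sqr_ge0 ?(ltW q0).
Qed.

(** Since [g] vanishes at [a] to first order, [g * dkreg] is dominated and tends to [0] pointwise.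
    No point mass survives, and dominated convergence along [eps = 1 / (n + 1)] removes the
    smoothing. *)
Lemma cauchy_approx g e a (M L rho : R) :
  measurable_fun setT g -> measurable_fun setT e ->
  (forall z, normc (e z) <= M) -> (forall z, normc (g z) <= L * normc (z - a)) ->
  (forall z, rho < normc z -> e z = 0) -> (forall z, rho < normc z -> g z = 0) ->
  (forall eps, 0 < eps ->
     cint (fun z => e z * kreg eps a z + g z * dkreg eps a z) = 0) ->
  cint (fun z => e z / (z - a)) = 0.
Proof.
move=> mg me eM gL e0 g0 H.
have M0 : 0 <= M by apply: le_trans (eM 0); exact: normc_ge0.
have L0 : 0 <= `|L| by [].
have gL' z : normc (g z) <= `|L| * normc (z - a).
  by apply: le_trans (gL z) _; rewrite ler_wpM2r ?normc_ge0 ?ler_norm.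
pose B := `|rho| + normc a + 1.
have B0 : 0 < B by rewrite ltr_wpDl// addr_ge0// normc_ge0.
pose ep n : R := n.+1%:R^-1.
have ep0 n : 0 < ep n by rewrite invr_gt0.
pose dom z := (M + `|L|) * inv_normc B (z - a).
have domE z : normc z <= rho -> dom z = (M + `|L|) * (normc (z - a))^-1.
  move=> zr; rewrite /dom /inv_normc indicE mem_set ?mulr1//.
  apply: normc_lt_square; rewrite subr0; have := normcB z a; have := ler_norm rho.
  by rewrite /B; lra.
have dom0 z : 0 <= dom z by rewrite mulr_ge0 ?addr_ge0// inv_normc_ge0.
have mk n : measurable_fun setT (kreg (ep n) a) /\ measurable_fun setT (dkreg (ep n) a).
  exact: dbar_pair_measurable (dbar_kreg a (ep0 n)).
pose F n z := e z * kreg (ep n) a z + g z * dkreg (ep n) a z.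
have : (fun n => normc (cint (F n) - cint (fun z => e z / (z - a)))) @ \oo --> (0 : R).
  apply: (@cint_dominated R F _ dom); rewrite /F.
  - move=> n; have [m1 m2] := mk n.
    by apply: measurable_complexD; exact: measurable_complexM.
  - apply: measurable_complexM => //; apply: measurable_complexV.
    exact: measurable_shift.
  - move=> n z; have [zr|zr] := leP (normc z) rho; last first.
      by rewrite e0// g0// !mul0r addr0 normc0.
    rewrite domE// mulrDl; apply: le_trans (normcD _ _) _; apply: lerD.
      by apply: normcM_le => //; exact: kreg_bound.
    rewrite normcM; apply: le_trans (ler_wpM2r (normc_ge0 _) (gL' z)) _.
    by rewrite -mulrA ler_wpM2l// dkreg_bound.
  - move=> z; have [zr|zr] := leP (normc z) rho; last first.
      by rewrite e0// mul0r normc0.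
    rewrite domE// normcM normcV ler_wpM2r ?invr_ge0 ?normc_ge0//.
    by apply: le_trans (eM z) _; rewrite lerDl.
  - exact: (integrableZl measurableT (M + `|L|) (integrable_inv_normc_shift a B0)).
  - apply: aeW => z; have [->|za] := eqVneq z a.
      have -> : g a = 0 by apply/eqP; rewrite -normc_le0; have := gL a; rewrite subrr normc0 mulr0.
      apply: cvg_near_cst; apply: nearW => n.
      by rewrite /kreg subrr conjC0 !mul0r invr0 !mulr0 addr0 subrr normc0.
    have [K HK] : exists K, forall n, normc (e z * kreg (ep n) a z + g z * dkreg (ep n) a z - e z / (z - a)) <= K * ep n.
      exists (normc (e z) / normc (z - a) ^+ 3 + normc (g z) * 2 / normc (z - a) ^+ 4) => n.
      have [k1 k2] := kreg_cvg (ep0 n) za.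
      rewrite (_ : _ - _ = e z * (kreg (ep n) a z - (z - a)^-1) + g z * dkreg (ep n) a z); last by ring.
      apply: le_trans (normcD _ _) _; rewrite mulrDl (normcM (e z)) (normcM (g z)); apply: lerD.
        apply: le_trans (ler_wpM2l (normc_ge0 _) k1) _.
        by rewrite mulrA mulrAC.
      apply: le_trans (ler_wpM2l (normc_ge0 _) k2) _.
      by rewrite !mulrA mulrAC.
    apply: (@squeeze_cvgr _ _ _ _ (cst 0) (fun n => K * ep n)).
    - by apply: nearW => n; rewrite HK normc_ge0.
    - exact: cvg_cst.
    - by rewrite -(mulr0 K); apply: cvgMr; exact: cvg_harmonic.
move=> cv; apply: eq0_normc.
have : (fun n : nat => normc (- cint (fun z => e z / (z - a)))) @ \oo --> (0 : R).
  by apply: cvg_trans cv; apply: near_eq_cvg; apply: nearW => n; rewrite H// sub0r.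
by rewrite normcN => /(cvg_unique _ (cvg_cst _))->.
Qed.

Lemma taylor1_lip w G D (rho : R) : normc w <= 1 -> taylor1 w G D ->
  exists2 L : R, 0 <= L & forall z (t : R), normc z <= rho -> `|t| <= 1 ->
    normc (G (z + t%:C * w) - G z) <= L * `|t|.
Proof.
move=> w1 tG; have [M M0 H] := tG (rho + 1).
have pos z (t : R) : normc z <= rho + 1 -> 0 <= t <= 1 ->
    normc (G (z + t%:C * w) - G z) <= (2 * M) * t.
  move=> zr t01; have [_ h1 h2] := H z t zr t01; have /andP[t0 t1] := t01.
  rewrite (_ : _ - _ = (G (z + t%:C * w) - G z - t%:C * D z) + t%:C * D z); last by ring.
  apply: le_trans (normcD _ _) _; rewrite normcM normc_real ger0_norm//.
  have : M * t ^+ 2 <= M * t by rewrite ler_wpM2l// expr2 ler_piMr.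
  have : t * normc (D z) <= t * M by rewrite ler_wpM2l.
  lra.
exists (2 * M) => [|z t zr t1]; first by rewrite mulr_ge0.
have [t0|t0] := leP 0 t.
  by rewrite ger0_norm//; apply: pos; [lra|rewrite t0 -(ger0_norm t0)].
rewrite ltr0_norm// in t1 *.
(* For a negative step the expansion is applied at the end point with step [- t], which is why the
   larger disc of radius [rho + 1] is used. *)
have := pos (z + t%:C * w) (- t); rewrite rmorphN mulNr addrK normc_distC; apply.
  apply: le_trans (normcD _ _) _; rewrite normcM normc_real ltr0_norm//.
  by have := normc_ge0 w; nra.
by apply/andP; split; lra.
Qed.

Lemma dbar_lip G E (rho : R) : dbar_pair G E -> exists2 L : R, 0 <= L &
  forall z a, normc z <= rho -> normc a <= rho -> normc (z - a) <= 1 ->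
    normc (G z - G a) <= L * normc (z - a).
Proof.
move=> [Dx [Dy [_ tx ty _]]].
have [L L0 HL] := taylor1_lip (rho + 1) normc1_le1 tx.
have [N N0 HN] := taylor1_lip (rho + 1) normci_le1 ty.
exists (L + N) => [|z a zr ar za]; first exact: addr_ge0.
pose x := complex.Re (z - a); pose y := complex.Im (z - a).
(* From [a] to [z] by one step parallel to each axis; the corner [m] may leave the disc by at most
   [1]. *)
have zE : z = (a + x%:C * 1) + y%:C * 'i%C.
  by apply: eq_ReIm; rewrite /x /y !ReImE /=; ring.
have xb : `|x| <= normc (z - a) by exact: normr_Re_le.
have yb : `|y| <= normc (z - a) by exact: normr_Im_le.
rewrite {1}zE; set m := a + x%:C * 1.
have mr : normc m <= rho + 1.
  by apply: le_trans (normcD _ _) _; rewrite mulr1 normc_real; lra.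
rewrite (_ : _ - _ = (G (m + y%:C * 'i%C) - G m) + (G m - G a)); last by ring.
have x1 : `|x| <= 1 by exact: le_trans xb za.
have y1 : `|y| <= 1 by exact: le_trans yb za.
have ar' : normc a <= rho + 1 by lra.
have := lerD (HN m y mr y1) (HL a x ar' x1); rewrite -/m => h.
apply: le_trans (normcD _ _) _; apply: le_trans h _.
by rewrite mulrDl addrC; apply: lerD; exact: ler_wpM2l.
Qed.

Lemma dbar_lip_support G E (rho : R) a : dbar_pair G E ->
  (forall z, rho < normc z -> G z = 0) ->
  exists2 L : R, 0 <= L & forall z, normc (G z - G a) <= L * normc (z - a).
Proof.
move=> dG G0; have [M M0 HM] := dbar_bounded (`|rho| + 1) dG.
have [L L0 HL] := dbar_lip (`|rho| + normc a + 1) dG.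
have Gb z : normc (G z) <= M.
  have [zr|zr] := leP (normc z) rho; last by rewrite G0// normc0 ltW.
  have [|//] := HM z; have := ler_norm rho; lra.
exists (L + 2 * M) => [|z]; first by rewrite addr_ge0// mulr_ge0// ltW.
have n0 := normc_ge0 (z - a).
have a0 := normc_ge0 a.
have rn : rho <= `|rho| := ler_norm _.
have r0 : 0 <= `|rho| by [].
have [h1|h1] := leP (normc (z - a)) 1.
  have zb : normc z <= normc a + 1 by have := normcD (z - a) a; rewrite subrK; lra.
  have := HL z a ltac:(lra) ltac:(lra) h1.
  have := mulr_ge0 (ltW M0) n0; lra.
apply: le_trans (normcB _ _) _; have := Gb z; have := Gb a.
by have := mulr_ge0 L0 n0; nra.
Qed.

Lemma dbar_shift G E a : dbar_pair G E ->
  dbar_pair (fun z => G (z - a)) (fun z => E (z - a)).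
Proof.
have tshift w D : taylor1 w G D -> taylor1 w (fun z => G (z - a)) (fun z => D (z - a)).
  move=> tG rho; have [M M0 H] := tG (rho + normc a); exists M => // z t zr t01.
  have [|h1 h2 h3] := H (z - a) t _ t01.
    by apply: le_trans (normcB _ _) _; lra.
  by split => //; rewrite (addrAC z).
move=> [Dx [Dy [[mG mx my] tx ty eE]]].
have ms (F : R[i] -> R[i]) : measurable_fun setT F -> measurable_fun setT (fun z : R[i] => F (z - a)).
  by move=> mF; apply: (measurableT_comp mF); exact: (measurable_shift (- a)).
exists (fun z => Dx (z - a)), (fun z => Dy (z - a)); split.
- by split; exact: ms.
- exact: tshift.
- exact: tshift.
- by move=> z; exact: eE.
Qed.

(** On [[-1, 1]] this is [(1 - x ^ 2) ^ 2], elsewhere [0]; the factors [-1 * x + 1] and [1 * x + 1]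
    have the shape [a * L z + b] of [dbar_pospart]. *)
Definition bumpx (x : R) : R := pospart (-1 * x + 1) ^+ 2 * pospart (1 * x + 1) ^+ 2.
Definition dbumpx (x : R) : R :=
  2 * -1 * pospart (-1 * x + 1) * pospart (1 * x + 1) ^+ 2 +
  pospart (-1 * x + 1) ^+ 2 * (2 * 1 * pospart (1 * x + 1)).

Definition chi0 z : R[i] := (bumpx (complex.Re z) * bumpx (complex.Im z))%:C.
Definition dchi0 z : R[i] := (dbumpx (complex.Re z) * bumpx (complex.Im z))%:C +
  'i * (bumpx (complex.Re z) * dbumpx (complex.Im z))%:C.

Lemma dbar_chi0 : dbar_pair chi0 dchi0.
Proof.
have h := dbarM (dbarM (@dbar_pospart_Re R (-1) 1) (@dbar_pospart_Re R 1 1))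
              (dbarM (@dbar_pospart_Im R (-1) 1) (@dbar_pospart_Im R 1 1)).
rewrite (_ : chi0 = fun z => ((pospart (-1 * complex.Re z + 1) ^+ 2)%:C *
    (pospart (1 * complex.Re z + 1) ^+ 2)%:C) *
    ((pospart (-1 * complex.Im z + 1) ^+ 2)%:C *
    (pospart (1 * complex.Im z + 1) ^+ 2)%:C)); last first.
  by apply/funext => z; rewrite -!rmorphM.
apply: dbar_pair_eq h _ => z.
by apply: eq_ReIm; rewrite !ReImE /= /bumpx /dbumpx; ring.
Qed.

Lemma bumpx_out x : 1 <= `|x| -> bumpx x = 0 /\ dbumpx x = 0.
Proof.
rewrite ler_normr => /orP[] h; rewrite /bumpx /dbumpx.
  by rewrite (@pospart_0 _ (-1 * x + 1)); [split; ring|lra].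
by rewrite (@pospart_0 _ (1 * x + 1)); [split; ring|lra].
Qed.

Lemma bumpx_in x : `|x| <= 1 -> bumpx x = (1 - x ^+ 2) ^+ 2 /\ x * dbumpx x = - 4 * x ^+ 2 * (1 - x ^+ 2).
Proof.
rewrite ler_norml => /andP[h1 h2]; rewrite /bumpx /dbumpx.
by rewrite !pospart_id; [split; ring|lra..].
Qed.

Lemma chi0_out z : 2 < normc z -> chi0 z = 0 /\ dchi0 z = 0.
Proof.
move=> z2; have [h|h] := leP 1 `|complex.Re z|.
  by have [e1 e2] := bumpx_out h; split; apply: eq_ReIm; rewrite /chi0 /dchi0 ?ReImE /= ?e1 ?e2; ring.
have h' : 1 <= `|complex.Im z| by have := normc_le_ReIm z; lra.
by have [e1 e2] := bumpx_out h'; split; apply: eq_ReIm; rewrite /chi0 /dchi0 ?ReImE /= ?e1 ?e2; ring.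
Qed.

Lemma chi0_0 : chi0 0 = 1.
Proof. by have [e _] := bumpx_in (x := 0) ltac:(by rewrite normr0); rewrite /chi0 /= e; congr (_ +i* _); ring. Qed.

(** The true value is [-2 * pi], as [dchi0] is twice the conjugate derivative and [chi0 0 = 1]. Only
    its nonvanishing is established, which spares the evaluation. *)
Definition kappa0 : R[i] := cint (fun z => dchi0 z / z).

Lemma dchi0_div_integrable a : cintegrable (fun z => dchi0 z / (z - a)).
Proof.
have [M M0 HM] := dbar_bounded 2 dbar_chi0.
apply: (@cintegrable_cauchy _ dchi0 a M 2).
- by have [] := dbar_pair_measurable dbar_chi0.
- move=> z; have [/HM[]//|/chi0_out[_ ->]] := leP (normc z) 2.
  by rewrite normc0 ltW.
- by move=> z /chi0_out[].
Qed.

(** The real part is [x * d/dx + y * d/dy] applied to [chi0], over [|z| ^ 2], and the bump decreases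
    radially. On the square of radius [1 / 2] both [1 - x ^ 2] and [1 - y ^ 2] are at least [3 / 4],
    whence [4 * (3 / 4) ^ 3 = 27 / 16]. The origin is removed because the quotient is [0] there. *)
Lemma Re_dchi0_div z : complex.Re (dchi0 z / z) <= - (27 / 16 * \1_(square 0 2^-1 `\` [set 0]) z).
Proof.
have [->|z0] := eqVneq z 0.
  by rewrite invr0 mulr0 /= indicE in_setD (mem_set (_ : [set 0] 0))// andbF mulr0 oppr0.
set x := complex.Re z; set y := complex.Im z.
have n2 : normc z ^+ 2 = x ^+ 2 + y ^+ 2 by exact: sqr_normc.
have n0 : 0 < x ^+ 2 + y ^+ 2 by rewrite -n2 exprn_gt0// normc_gt0.
have -> : complex.Re (dchi0 z / z) =
    ((x * dbumpx x) * bumpx y + bumpx x * (y * dbumpx y)) / (x ^+ 2 + y ^+ 2).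
  have -> : z^-1 = z^* * ((x ^+ 2 + y ^+ 2)^-1)%:C.
    apply: (mulfI z0); rewrite mulfV// mulrA mulcJ n2 -rmorphM mulfV ?gt_eqF//.
  rewrite /dchi0 !ReImE /= -/x -/y.
  by field; rewrite gt_eqF.
have [h|h] := leP 1 `|x|.
  have [-> ->] := bumpx_out h; rewrite mulr0 !mul0r addr0 mul0r.
  rewrite indicE; have -> : (z \in square 0 2^-1 `\` [set 0]) = false.
    apply/negP => /set_mem[[/andP[]]]; rewrite -/x /= => ? ? _ _.
    by move: h; rewrite ler_normr => /orP[]; lra.
  by rewrite mulr0 oppr0.
have [h'|h'] := leP 1 `|y|.
  have [-> ->] := bumpx_out h'; rewrite !mulr0 addr0 mul0r.
  rewrite indicE; have -> : (z \in square 0 2^-1 `\` [set 0]) = false.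
    apply/negP => /set_mem[[_ /andP[]]]; rewrite -/y /= => ? ? _.
    by move: h'; rewrite ler_normr => /orP[]; lra.
  by rewrite mulr0 oppr0.
have [-> ->] := bumpx_in (ltW h); have [-> ->] := bumpx_in (ltW h').
have x1 : x ^+ 2 <= 1 by move: h; rewrite ltr_norml => /andP[? ?]; nra.
have y1 : y ^+ 2 <= 1 by move: h'; rewrite ltr_norml => /andP[? ?]; nra.
have x0 := sqr_ge0 x; have y0 := sqr_ge0 y.
set X := x ^+ 2 in x0 x1 n0 *; set Y := y ^+ 2 in y0 y1 n0 *.
have XY : 0 <= (1 - X) * (1 - Y) by rewrite mulr_ge0// subr_ge0.
rewrite ler_pdivrMr// mulNr.
have [h2|h2] := boolP (z \in square 0 2^-1 `\` [set 0]); rewrite indicE ?h2 ?(negbTE h2).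
  have [[/andP[a1 a2] /andP[b1 b2]] _] := set_mem h2.
  have X4 : X <= 4^-1 by rewrite /X; move: a1 a2; rewrite -/x /=; nra.
  have Y4 : Y <= 4^-1 by rewrite /Y; move: b1 b2; rewrite -/y /=; nra.
  have f1 : 9 / 16 <= (1 - X) * (1 - Y) by nra.
  have f2 : 27 / 64 <= (1 - X) * (1 - Y) * (1 - Y) by nra.
  have f3 : 27 / 64 <= (1 - X) * (1 - Y) * (1 - X) by nra.
  have := ler_wpM2l x0 f2; have := ler_wpM2l y0 f3; rewrite mulr1; lra.
have f2 : 0 <= (1 - X) * (1 - Y) * (1 - Y) by rewrite mulr_ge0// subr_ge0.
have f3 : 0 <= (1 - X) * (1 - Y) * (1 - X) by rewrite mulr_ge0// subr_ge0.
have := mulr_ge0 x0 f2; have := mulr_ge0 y0 f3; rewrite /= ?mulr0 ?mul0r; lra.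
Qed.

Lemma kappa0_neq0 : kappa0 != 0.
Proof.
apply/eqP => k0; have [ir _] := dchi0_div_integrable 0.
have : complex.Re kappa0 <= - (27 / 16).
  have mS : measurable (square (0 : R[i]) 2^-1 `\` [set 0]).
    by apply: measurableD; [exact: measurable_square|exact: measurable_singleton].
  have aS : area (square (0 : R[i]) 2^-1 `\` [set 0]) = 1%:E.
    have a1 : area (square (0 : R[i]) 2^-1) = 1%:E.
      by rewrite area_square//; congr EFin; field.
    have e0 : square (0 : R[i]) 2^-1 `&` [set 0] = [set 0].
      apply/seteqP; split => [z []//|z ->]; split => //.
      by apply: normc_lt_square; rewrite subrr normc0.
    rewrite measureD ?e0; [|exact: measurable_square|exact: measurable_singleton|].
      rewrite -[X in (X - _)%E]/(area (square (0 : R[i]) 2^-1)) a1.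
      by rewrite -[X in (_ - X)%E]/(area [set (0 : R[i])]) area_singleton sube0.
    by rewrite -[X in (X < _)%E]/(area (square (0 : R[i]) 2^-1)) a1 ltry.
  have [ii ei] := @integrable_indic_bounded R _ (- (27 / 16)) mS ltac:(by rewrite aS ltry).
  rewrite aS /= mulr1 in ei; rewrite -ei /kappa0 /=.
  apply: le_Rintegral => //.
    by apply: eq_integrable ir => // z _ /=; rewrite subr0.
  by move=> z _; rewrite mulNr; exact: Re_dchi0_div.
by rewrite k0 /=; lra.
Qed.

(** Subtracting [u a] times the translated bump makes the function vanish at [a], so [cauchy_approx]
    applies, and the bump contributes [kappa0 * u a]. The hypotheses are integrals and not a
    [dbar_pair], in order to cover an analytic function times a cutoff, for which they come from
    [goursat_hat]. *)
Lemma cauchy_pompeiu u e a (M L rho : R) :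
  measurable_fun setT u -> measurable_fun setT e ->
  (forall z, normc (e z) <= M) -> (forall z, normc (u z - u a) <= L * normc (z - a)) ->
  (forall z, rho < normc z -> e z = 0) -> (forall z, rho < normc z -> u z = 0) ->
  (forall eps, 0 < eps ->
     [/\ cintegrable (fun z => e z * kreg eps a z),
         cintegrable (fun z => u z * dkreg eps a z) &
         cint (fun z => e z * kreg eps a z + u z * dkreg eps a z) = 0]) ->
  cint (fun z => e z / (z - a)) = kappa0 * u a.
Proof.
move=> mu me eM uL e0 u0 H.
have dc := dbar_shift a dbar_chi0.
have rho' : forall z, 2 + normc a < normc z -> 2 < normc (z - a).
  by move=> z h; have := normcD (z - a) a; rewrite subrK; lra.
have c0 z : 2 + normc a < normc z -> chi0 (z - a) = 0 by move=> /rho' /chi0_out[].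
have dc0 z : 2 + normc a < normc z -> dchi0 (z - a) = 0 by move=> /rho' /chi0_out[].
have [Lc Lc0 HLc] := dbar_lip_support a dc c0.
have [Mc Mc0 HMc] := dbar_bounded (2 + normc a) dc.
have dcM z : normc (dchi0 (z - a)) <= Mc.
  have [/HMc[]//|/dc0->] := leP (normc z) (2 + normc a).
  by rewrite normc0 ltW.
have [mc mdc] := dbar_pair_measurable dc.
pose B := `|rho| + 2 + normc a.
have Brho : rho <= B /\ 2 + normc a <= B.
  by rewrite /B; have := ler_norm rho; have := normc_ge0 a; have := normr_ge0 rho; split; lra.
have ie : cintegrable (fun z => e z / (z - a)) by exact: cintegrable_cauchy me eM e0.
have ic : cintegrable (fun z => dchi0 (z - a) / (z - a)).
  exact: cintegrable_cauchy mdc dcM dc0.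
have : cint (fun z => (e z - u a * dchi0 (z - a)) / (z - a)) = 0.
  apply: (@cauchy_approx (fun z => u z - u a * chi0 (z - a)) (fun z => e z - u a * dchi0 (z - a))
    a (M + normc (u a) * Mc) (L + normc (u a) * Lc) B).
  - by apply: measurable_complexB => //; apply: measurable_complexM.
  - by apply: measurable_complexB => //; apply: measurable_complexM.
  - move=> z; apply: le_trans (normcB _ _) _; apply: lerD => //.
    by rewrite normcM ler_wpM2l ?normc_ge0.
  - move=> z; have := HLc z; rewrite subrr chi0_0 => h.
    rewrite (_ : u z - _ = (u z - u a) - u a * (chi0 (z - a) - 1)); last by ring.
    apply: le_trans (normcB _ _) _; rewrite mulrDl; apply: lerD => //.
    by rewrite normcM -mulrA ler_wpM2l ?normc_ge0.
  - by move=> z zB; rewrite e0 ?dc0 ?mulr0 ?subrr//; lra.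
  - by move=> z zB; rewrite u0 ?c0 ?mulr0 ?subrr//; lra.
  - move=> eps eps0; have [i1 i2 i3] := H eps eps0.
    have dp := dbarM dc (dbar_kreg a eps0).
    have [|j1 j2] := cint_dbar (rho := 2 + normc a) dp.
      by move=> z /c0 ->; rewrite mul0r.
    rewrite (@eq_cint _ _ (fun z => (e z * kreg eps a z + u z * dkreg eps a z) -
       u a * (dchi0 (z - a) * kreg eps a z + chi0 (z - a) * dkreg eps a z))); last first.
      by move=> z; ring.
    rewrite cintB; [|exact: cintegrableD|exact: cintegrableZ].
    by rewrite i3 cintZ// j2 mulr0 subrr.
rewrite (@eq_cint _ _ (fun z => e z / (z - a) - u a * (dchi0 (z - a) / (z - a)))); last first.
  by move=> z; ring.
rewrite cintB//; last exact: cintegrableZ.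
rewrite cintZ// => /eqP; rewrite subr_eq0 => /eqP ->; rewrite mulrC; congr (_ * _).
have [_] := cint_shift (- a) (dchi0_div_integrable 0).
under eq_fun do rewrite subr0.
move=> ->; apply: eq_cint => z; by rewrite subr0.
Qed.

Lemma cauchy_pompeiu_dbar G E (rho : R) a : dbar_pair G E ->
  (forall z, rho < normc z -> G z = 0) ->
  cint (fun z => E z / (z - a)) = kappa0 * G a.
Proof.
move=> dG G0; have [L L0 HL] := dbar_lip_support a dG G0.
have E0 := dbar_support dG G0.
have [M M0 HM] := dbar_bounded rho dG.
have [mG mE] := dbar_pair_measurable dG.
have EM z : normc (E z) <= M.
  by have [/HM[]//|/E0->] := leP (normc z) rho; rewrite normc0 ltW.
have GM z : normc (G z) <= M.
  by have [/HM[]//|/G0->] := leP (normc z) rho; rewrite normc0 ltW.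
apply: (cauchy_pompeiu mG mE EM HL E0 G0) => eps eps0.
have dk := dbar_kreg a eps0.
have [i1 i2] := cint_dbar (rho := rho) (dbarM dG dk) (fun z zr => etrans (congr1 (fun t => t * _) (G0 z zr)) (mul0r _)).
have [mk mdk] := dbar_pair_measurable dk.
have [N N0 HN] := dbar_bounded rho dk.
have rr : `|rho| + 1 = `|rho| + 1 by [].
have bd F h : measurable_fun setT F -> (forall z, normc (F z) <= M) ->
    (forall z, rho < normc z -> F z = 0) -> measurable_fun setT h ->
    (forall z, normc z <= rho -> normc (h z) <= N) -> cintegrable (fun z => F z * h z).
  move=> mF FM F0 mh hN.
  have [|||z _|z zs|//] := @cint_bounded R (fun z => F z * h z) (square 0 (`|rho| + 1)) (M * N).
  - exact: measurable_complexM.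
  - exact: measurable_square.
  - by rewrite area_square ?ltry// addr_ge0.
  - have [zr|/F0->] := leP (normc z) rho; first by apply: normcM_le => //; exact: hN.
    by rewrite mul0r normc0 mulr_ge0// ltW.
  - rewrite F0 ?mul0r//; have := notin_square_normc zs; have := ler_norm rho; lra.
split => //.
- by apply: bd => // z /HN[].
- by apply: bd => // z /HN[].
Qed.

End CauchyPompeiu.

(** * Cauchy's formula by a kernel on an annulus *)

Section CauchyKernel.
Context {R : realType}.
Implicit Types (z a c p h L N : R[i]) (f g : R[i] -> R[i]) (d : R).

Lemma cintegrable_bounded (F : R[i] -> R[i]) (M rho : R) : measurable_fun setT F ->
  (forall z, normc (F z) <= M) -> (forall z, rho < normc z -> F z = 0) ->
  cintegrable F.
Proof.
move=> mF FM F0; have [||z _|z zs|//] := @cint_bounded R F (square 0 (`|rho| + 1)) M mF.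
- exact: measurable_square.
- by rewrite area_square ?ltry// addr_ge0.
- exact: FM.
- by rewrite F0//; have := notin_square_normc zs; have := ler_norm rho; lra.
Qed.

(** Integer translates of a B-spline sum to a constant, [2] in this normalisation, and on [[2, 3]]
    only these three contribute. *)
Lemma plateau (x : R) : 2 <= x <= 3 ->
  spline x + spline (x - 1) + spline (x - 2) = 2 /\
  dspline x + dspline (x - 1) + dspline (x - 2) = 0.
Proof.
move=> /andP[x2 x3].
have A k : k <= 2 -> pospart (x - k) = x - k by move=> k2; apply: pospart_id; lra.
have B k : 3 <= k -> pospart (x - k) = 0 by move=> k3; apply: pospart_0; lra.
have e0 : pospart x = x by apply: pospart_id; lra.
rewrite /spline /dspline -!(addrA x) -!opprD.
rewrite e0 !(A 1) ?(A 2) ?(A (1 + 1)) ?(B 3) ?(B (1 + 2)) ?(B (1 + 3)) ?(B (2 + 1))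
  ?(B (2 + 2)) ?(B (2 + 3)); [split; ring|lra..].
Qed.

Definition platcorner p d (j k : 'I_3) : R[i] :=
  (complex.Re p + d * j%:R) +i* (complex.Im p + d * k%:R).

(** A cutoff written as a sum of nine hats, so that [goursat_hat] applies termwise. It lives on a
    box of side [5 * d = 3 * (5 / 3 * d)] and equals [4 = 2 * 2] on the central cell. *)
Definition plat p d z : R[i] := \sum_j \sum_k hat (platcorner p d j k) d z.
Definition dplat p d z : R[i] := \sum_j \sum_k dhat (platcorner p d j k) d z.

Lemma dbar_plat p d : d != 0 -> dbar_pair (plat p d) (dplat p d).
Proof.
move=> d0; apply: dbar_sum => j; apply: dbar_sum => k; exact: dbar_hat.
Qed.

Lemma platcorner_cbox p d j k : 0 < d -> cbox (platcorner p d j k) d `<=` cbox p (5 / 3 * d).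
Proof.
move=> d0; have hj (i : 'I_3) : 0 <= (i%:R : R) <= 2.
  by rewrite ler0n (ler_nat _ i 2) -ltnS ltn_ord.
have /andP[j0 j3] := hj j; have /andP[k0 k3] := hj k.
move=> z [/= /andP[? ?] /andP[? ?]]; split; apply/andP; split; nra.
Qed.

Lemma plat_out p d z : 0 < d -> ~ cbox p (5 / 3 * d) z -> plat p d z = 0 /\ dplat p d z = 0.
Proof.
move=> d0 zp; have H j k := hat_out d0 (fun zq => zp (@platcorner_cbox p d j k d0 z zq)).
by split; apply: big1 => j _; apply: big1 => k _; have [] := H j k.
Qed.

Lemma plat_in p d z : d != 0 -> 2 <= coordx p d z <= 3 -> 2 <= coordy p d z <= 3 ->
  plat p d z = 4 /\ dplat p d z = 0.
Proof.
move=> d0 /plateau[x1 x2] /plateau[y1 y2].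
have cx j k : coordx (platcorner p d j k) d z = coordx p d z - j%:R.
  by rewrite /coordx /=; field.
have cy j k : coordy (platcorner p d j k) d z = coordy p d z - k%:R.
  by rewrite /coordy /=; field.
have S (g : R -> R) t : \sum_(j < 3) g (t - j%:R) = g t + g (t - 1) + g (t - 2).
  by rewrite !big_ord_recr big_ord0 /= subr0 add0r.
have D (g g' : R -> R) s t : \sum_(j < 3) \sum_(k < 3) g (s - j%:R) * g' (t - k%:R) =
    (g s + g (s - 1) + g (s - 2)) * (g' t + g' (t - 1) + g' (t - 2)).
  by rewrite -(S g s) -(S g' t) big_distrlr.
split.
  rewrite /plat /hat.
  under eq_bigr => j _ do under eq_bigr => k _ do rewrite cx cy.
  under eq_bigr do rewrite -rmorph_sum.
  rewrite -rmorph_sum D x1 y1.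
  by rewrite (_ : 2 * 2 = 4%:R) ?rmorph_nat//; ring.
rewrite /dplat /dhat.
under eq_bigr => j _ do under eq_bigr => k _ do rewrite cx cy.
under eq_bigr do rewrite -mulr_sumr big_split /= -mulr_sumr -!rmorph_sum.
rewrite -mulr_sumr big_split /= -mulr_sumr -!rmorph_sum !D x2 y2.
by rewrite mul0r mulr0 rmorph0 mulr0 addr0 mulr0.
Qed.

(** Cauchy-Pompeiu for [f * plat]: on the central cell [dplat] vanishes, so for [a] there the
    singularity of [1 / (z - a)] is not met. The kernel depends neither on [f] nor on [a], which
    later gives estimates uniform over families of functions. *)
Theorem cauchy_kernel c d : 0 < d -> exists kap : R[i] -> R[i], exists K : R,
  [/\ measurable_fun setT kap, forall z, normc (kap z) <= K,
      forall z, normc (z - c) < d / 2 -> kap z = 0,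
      forall z, 10 * d < normc (z - c) -> kap z = 0 &
      forall f, measurable_fun setT f ->
        (forall z, normc (z - c) <= 10 * d -> exists L, cderiv f z L) ->
        forall a, normc (a - c) < d / 2 -> f a = cint (fun z => kap z * f z / (z - a))].
Proof.
move=> d0; have d0' : d != 0 by rewrite gt_eqF.
(* [c] is the centre of the box of side [5 * d], so the central cell is the square of radius [d / 2]
   about [c]; the reach [10 * d] is [6 * (5 / 3 * d)] from [cbox_dist]. *)
pose p := (complex.Re c - 5 / 2 * d) +i* (complex.Im c - 5 / 2 * d).
have D0 : 0 < 5 / 3 * d by rewrite mulr_gt0.
have pc : cbox p (5 / 3 * d) c by split; apply/andP; split; rewrite /=; lra.
have far z : 10 * d < normc (z - c) -> ~ cbox p (5 / 3 * d) z.
  by move=> zc zp; have := cbox_dist zp pc; lra.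
have near z : normc (z - c) < d / 2 -> 2 <= coordx p d z <= 3 /\ 2 <= coordy p d z <= 3.
  move=> zc; have := le_lt_trans (normr_Re_le _) zc; have := le_lt_trans (normr_Im_le _) zc.
  rewrite !ReImE !ltr_norml /coordx /coordy /= => /andP[? ?] /andP[? ?].
  by split; rewrite ler_pdivlMr// ler_pdivrMr//; apply/andP; split; lra.
have dP := dbar_plat p d0'.
pose rho := normc c + 10 * d.
have rhofar z : rho < normc z -> 10 * d < normc (z - c).
  by have := normcD (z - c) c; rewrite subrK /rho; lra.
have P0 z : rho < normc z -> plat p d z = 0 by move=> /rhofar/far/(plat_out d0)[].
have dP0 z : rho < normc z -> dplat p d z = 0 by move=> /rhofar/far/(plat_out d0)[].
have [M M0 HM] := dbar_bounded rho dP.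
have PM z : normc (plat p d z) <= M.
  by have [/HM[]//|/P0->] := leP (normc z) rho; rewrite normc0 ltW.
have dPM z : normc (dplat p d z) <= M.
  by have [/HM[]//|/dP0->] := leP (normc z) rho; rewrite normc0 ltW.
have [mP mdP] := dbar_pair_measurable dP.
have k40 : 4 * kappa0 != 0 :> R[i] by rewrite mulf_neq0 ?kappa0_neq0// pnatr_eq0.
exists (fun z => (4 * kappa0)^-1 * dplat p d z), (normc (4 * kappa0)^-1 * M); split.
- exact: measurable_complexM.
- by move=> z; exact: normcM_le.
- by move=> z /near[? ?]; have [_ ->] := plat_in d0' (z := z) ltac:(eassumption) ltac:(eassumption); rewrite mulr0.
- by move=> z /far/(plat_out d0)[_ ->]; rewrite mulr0.
move=> f mf df a ac.
have dfp z : cbox p (5 / 3 * d) z -> exists L, cderiv f z L.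
  by move=> zp; apply: df; have := cbox_dist zp pc; lra.
have [Mf HMf] := cbox_bounded D0 dfp.
have Mf0 : 0 <= Mf by apply: le_trans (HMf c pc); exact: normc_ge0.
have fPM (h : R[i] -> R[i]) : (forall z, normc (h z) <= M) ->
    (forall z, ~ cbox p (5 / 3 * d) z -> h z = 0) -> forall z, normc (f z * h z) <= Mf * M.
  move=> hM h0 z; have [zp|/h0->] := pselect (cbox p (5 / 3 * d) z).
    by apply: normcM_le => //; exact: HMf.
  by rewrite mulr0 normc0 mulr_ge0// ltW.
have uM := fPM _ PM (fun z zp => (plat_out d0 zp).1).
have eM := fPM _ dPM (fun z zp => (plat_out d0 zp).2).
have [ax ay] := near a ac; have [Pa dPa] := plat_in d0' ax ay.
have mu : measurable_fun setT (fun z => f z * plat p d z) by exact: measurable_complexM.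
have me : measurable_fun setT (fun z => f z * dplat p d z) by exact: measurable_complexM.
have u0 z : rho < normc z -> f z * plat p d z = 0 by move=> /P0->; rewrite mulr0.
have e0 z : rho < normc z -> f z * dplat p d z = 0 by move=> /dP0->; rewrite mulr0.
have [L dL] := df a ltac:(lra).
have [r r0 Hr] := cderiv_bound dL.
pose r' := Num.min r (d / 2 - normc (a - c)).
have r'0 : 0 < r' by rewrite lt_min r0 subr_gt0.
(* Within [r'] of [a] the cutoff is constantly [4] and the differentiability of [f] at [a] gives the
   bound; farther away the supremum bound is divided by [r']. *)
have lip z : normc (f z * plat p d z - f a * plat p d a) <=
    (4 * (normc L + 1) + 2 * (Mf * M) / r') * normc (z - a).
  have K0 : 0 <= 2 * (Mf * M) / r' by rewrite divr_ge0 ?mulr_ge0 ?(ltW M0) ?(ltW r'0).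
  have K1 : 0 <= 4 * (normc L + 1) by rewrite mulr_ge0// addr_ge0// normc_ge0.
  have [zr|zr] := ltP (normc (z - a)) r'.
    move: zr; rewrite lt_min => /andP[zr zc].
    have zc' : normc (z - c) < d / 2 by have := normc_distD z a c; lra.
    have [zx zy] := near z zc'; have [-> _] := plat_in d0' zx zy; rewrite Pa -mulrBl.
    rewrite mulrC normcM (_ : normc 4 = 4); last first.
      by rewrite -(rmorph_nat (real_complex R)) normc_real ger0_norm.
    have := Hr z zr; have := mulr_ge0 K0 (normc_ge0 (z - a)); lra.
  apply: le_trans (normcB _ _) _; have := uM z; have := uM a => h1 h2.
  have : 2 * (Mf * M) <= 2 * (Mf * M) / r' * normc (z - a).
    by rewrite mulrAC ler_pdivlMr// ler_wpM2l// ?mulr_ge0// ltW.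
  have := mulr_ge0 K1 (normc_ge0 (z - a)); lra.
have := cauchy_pompeiu mu me eM lip e0 u0.
rewrite Pa => H.
apply: (mulfI k40).
rewrite -(@cintZ _ _ (fun z => (4 * kappa0)^-1 * dplat p d z * f z / (z - a))); last first.
  apply: (@cintegrable_cauchy _ (fun z => (4 * kappa0)^-1 * dplat p d z * f z) a
    (normc (4 * kappa0)^-1 * (Mf * M)) rho).
  - by apply: measurable_complexM => //; exact: measurable_complexM.
  - by move=> z; rewrite -mulrA [_ * f z]mulrC; apply: normcM_le.
  - by move=> z /dP0->; rewrite mulr0 mul0r.
rewrite (_ : 4 * kappa0 * f a = kappa0 * (f a * 4)); last by ring.
rewrite -H => [|eps eps0].
  apply: eq_cint => z; rewrite !mulrA mulfV// mul1r; congr (_ / _); exact: mulrC.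
have dk := dbar_kreg a eps0.
have [mk mdk] := dbar_pair_measurable dk.
have [N N0 HN] := dbar_bounded rho dk.
have bd (F h : R[i] -> R[i]) : measurable_fun setT F -> (forall z, normc (F z) <= Mf * M) ->
    (forall z, rho < normc z -> F z = 0) -> measurable_fun setT h ->
    (forall z, normc z <= rho -> normc (h z) <= N) -> cintegrable (fun z => F z * h z).
  move=> mF FM F0 mh hN; apply: (@cintegrable_bounded _ (Mf * M * N) rho).
  - exact: measurable_complexM.
  - move=> z; have [zr|/F0->] := leP (normc z) rho; first by apply: normcM_le => //; exact: hN.
    by rewrite mul0r normc0 !mulr_ge0// ltW.
  - by move=> z /F0->; rewrite mul0r.
split.
- by apply: bd => // z /HN[].
- by apply: bd => // z /HN[].
(* The smoothed kernel is itself a test function, so it can serve as the weight [s] in Goursat's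
   lemma. *)
have G j k := goursat_hat d0 mf (fun z zq => dfp z (@platcorner_cbox p d j k d0 z zq)) dk.
rewrite (@eq_cint _ _ (fun z => \sum_j \sum_k f z * hatprod (kreg eps a) (dkreg eps a) (platcorner p d j k) d z)).
  rewrite cint_sum; last by move=> j; apply: cintegrable_sum => k; have [] := G j k.
  apply: big1 => j _; rewrite cint_sum; last by move=> k; have [] := G j k.
  by apply: big1 => k _; have [] := G j k.
move=> z; rewrite /plat /dplat !mulr_sumr !mulr_suml -big_split /=; apply: eq_bigr => j _.
rewrite !mulr_sumr !mulr_suml -big_split /=; apply: eq_bigr => k _.
by rewrite /hatprod; ring.
Qed.

(** Finite geometric expansion of [1 / (z - c - h)] with exact remainder
    [h ^ 3 / ((z - c) ^ 3 * (z - c - h))]; where [e] is nonzero the two factors of the denominator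
    are at least [dl ^ 3] and [dl / 2]. Order three is chosen so that a difference quotient still
    has a derivative at [c]. *)
Lemma cauchy_integral_expansion (e : R[i] -> R[i]) c (dl M rho : R) : 0 < dl ->
  measurable_fun setT e -> (forall z, normc (e z) <= M) ->
  (forall z, normc (z - c) < dl -> e z = 0) -> (forall z, rho < normc z -> e z = 0) ->
  exists A1 A2 A3, exists2 C : R, 0 <= C & forall h, normc h <= dl / 2 ->
    normc (cint (fun z => e z / (z - (c + h))) - A1 - h * A2 - h ^+ 2 * A3) <= C * normc h ^+ 3.
Proof.
move=> dl0 me eM ein eout.
have M0 : 0 <= M by apply: le_trans (eM 0); exact: normc_ge0.
have nz z : e z != 0 -> dl <= normc (z - c).
  by move=> ez; rewrite leNgt; apply/negP => /ein ze; rewrite ze eqxx in ez.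
have mc n h : measurable_fun setT (fun z => e z / (z - (c + h)) ^+ n).
  apply: measurable_complexM => //; apply: measurable_complexV; apply: measurable_complexX.
  exact: (measurable_shift (- (c + h))).
have ic n : cintegrable (fun z => e z / (z - c) ^+ n).
  apply: (@cintegrable_bounded _ (M / dl ^+ n) rho).
  - by have := mc n 0; rewrite addr0.
  - move=> z; have [->|ez] := eqVneq (e z) 0; first by rewrite mul0r normc0 divr_ge0// exprn_ge0 ?ltW.
    apply: normcM_le => //; rewrite normcV normcX lef_pV2 ?posrE ?exprn_gt0//.
      by rewrite lerXn2r ?nnegrE ?normc_ge0 ?(ltW dl0)//; exact: nz.
    by apply: lt_le_trans (nz z ez).
  - by move=> z /eout->; rewrite mul0r.
have ih h : cintegrable (fun z => e z / (z - (c + h))) by exact: cintegrable_cauchy eout.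
exists (cint (fun z => e z / (z - c) ^+ 1)), (cint (fun z => e z / (z - c) ^+ 2)),
  (cint (fun z => e z / (z - c) ^+ 3)).
pose A := fine (area (square (0 : R[i]) (`|rho| + 1))).
have A0 : 0 <= A by exact: fine_ge0.
have K0 : 0 <= 2 * (M * (2 / dl ^+ 4)) * A.
  by rewrite !mulr_ge0// invr_ge0 exprn_ge0// ltW.
exists (2 * (M * (2 / dl ^+ 4)) * A) => // h hd.
have i2 := cintegrableZ h (ic 2); have i3 := cintegrableZ (h ^+ 2) (ic 3).
have i1 := cintegrableB (ih h) (ic 1); have i12 := cintegrableB i1 i2.
pose g z := e z / (z - (c + h)) - e z / (z - c) ^+ 1 - h * (e z / (z - c) ^+ 2) - h ^+ 2 * (e z / (z - c) ^+ 3).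
have <- : cint g = cint (fun z => e z / (z - (c + h))) - cint (fun z => e z / (z - c) ^+ 1) -
    h * cint (fun z => e z / (z - c) ^+ 2) - h ^+ 2 * cint (fun z => e z / (z - c) ^+ 3).
  by rewrite (cintB i12 i3) (cintB i1 i2) (cintB (ih h) (ic 1)) (cintZ h (ic 2))
    (cintZ (h ^+ 2) (ic 3)).
have [|||z _|z zs|_ hb] := @cint_bounded R g (square 0 (`|rho| + 1)) (M * (2 / dl ^+ 4) * normc h ^+ 3).
- apply: measurable_complexB; last first.
    by apply: measurable_complexM => //; exact: cintegrable_measurable (ic 3).
  apply: measurable_complexB; last first.
    by apply: measurable_complexM => //; exact: cintegrable_measurable (ic 2).
  by apply: measurable_complexB; [exact: cintegrable_measurable (ih h)|exact: cintegrable_measurable (ic 1)].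
- exact: measurable_square.
- by rewrite area_square ?ltry// addr_ge0.
- have [ez|ez] := eqVneq (e z) 0.
    by rewrite /g ez !mul0r !mulr0 !subr0 normc0 !mulr_ge0 ?exprn_ge0 ?normc_ge0// invr_ge0 exprn_ge0 ?ltW.
  have nw := nz z ez.
  have w0 : z - c != 0 by rewrite -normc_gt0; exact: lt_le_trans nw.
  have nwh : dl / 2 <= normc (z - (c + h)).
    by have := normcD (z - (c + h)) h; rewrite opprD addrA subrK; lra.
  have wh0 : z - (c + h) != 0 by rewrite -normc_gt0; apply: lt_le_trans nwh; rewrite divr_gt0.
  rewrite (_ : g z = e z * ((z - c) ^+ 3 * (z - (c + h)))^-1 * h ^+ 3); last first.
    have key (u v : R[i]) : u != 0 -> v != 0 ->
        v^-1 - (u ^+ 1)^-1 - (u - v) / u ^+ 2 - (u - v) ^+ 2 / u ^+ 3 = (u ^+ 3 * v)^-1 * (u - v) ^+ 3.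
      by move=> u0 v0; field; rewrite u0 v0.
    have := key (z - c) (z - (c + h)) w0 wh0.
    rewrite (_ : z - c - (z - (c + h)) = h); last by ring.
    by move=> k; rewrite -mulrA -k /g; ring.
  rewrite normcM normcX ler_wpM2r ?exprn_ge0 ?normc_ge0//; apply: normcM_le => //.
  rewrite normcV -[leRHS]invrK invf_div lef_pV2 ?posrE.
  + rewrite normcM normcX exprSr -mulrA; apply: ler_pM => //.
    * by rewrite exprn_ge0 ?ltW.
    * by rewrite divr_ge0 ?ltW.
    * by rewrite lerXn2r ?nnegrE ?normc_ge0 ?(ltW dl0).
  + by rewrite normc_gt0 mulf_neq0 ?expf_neq0.
  + by rewrite divr_gt0 ?exprn_gt0.
- have zr : rho < normc z by have := notin_square_normc zs; have := ler_norm rho; lra.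
  by rewrite /g eout// !mul0r !mulr0 !subr0.
apply: le_trans hb _; rewrite le_eqVlt; apply/orP; left; apply/eqP; rewrite /A; ring.
Qed.

End CauchyKernel.

(** * Complex derivatives, zeros of analytic functions, null level sets *)

Section ComplexDerivative.
Context {R : realType}.
Implicit Types (z c L N : R[i]) (f g : R[i] -> R[i]) (D : set R[i]).

Lemma cderiv_near f g z L (r : R) : 0 < r ->
  (forall w, normc (w - z) < r -> f w = g w) -> cderiv f z L -> cderiv g z L.
Proof.
move=> r0 fg df e e0; have [d d0 H] := df e e0.
exists (Num.min d r); first by rewrite lt_min d0.
move=> h; rewrite lt_min => /andP[hd hr].
rewrite -!fg; first exact: H.
  by rewrite subrr normc0.
by rewrite addrC addKr.
Qed.

Lemma cderiv_cst c z : cderiv (fun=> c) z 0.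
Proof.
move=> e e0; exists 1 => // h _; rewrite subrr mul0r subr0 normc0.
by rewrite mulr_ge0 ?normc_ge0// ltW.
Qed.

Lemma cderivD f g z L N : cderiv f z L -> cderiv g z N ->
  cderiv (fun w => f w + g w) z (L + N).
Proof.
move=> df dg e e0; have e2 : 0 < e / 2 by rewrite divr_gt0.
have [d1 d10 H1] := df _ e2; have [d2 d20 H2] := dg _ e2.
exists (Num.min d1 d2); first by rewrite lt_min d10.
move=> h; rewrite lt_min => /andP[/H1 h1 /H2 h2].
rewrite (_ : _ - _ = (f (z + h) - f z - L * h) + (g (z + h) - g z - N * h)); last by ring.
by apply: le_trans (normcD _ _) _; lra.
Qed.

Lemma cderivM f g z L N : cderiv f z L -> cderiv g z N ->
  cderiv (fun w => f w * g w) z (L * g z + f z * N).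
Proof.
move=> df dg e e0.
pose K := normc (f z) + normc (g z) + normc L + normc N + 1.
have [f0 g0 L0 N0] : [/\ 0 <= normc (f z), 0 <= normc (g z), 0 <= normc L & 0 <= normc N].
  by split; exact: normc_ge0.
have K1 : 1 <= K by rewrite /K; lra.
have K0 : 0 < K by lra.
pose eta := Num.min 1 (e / (4 * K)).
have eta0 : 0 < eta by rewrite lt_min ltr01 divr_gt0// mulr_gt0.
have eta1 : eta <= 1 by rewrite /eta ge_min lexx.
have etae : eta * (4 * K) <= e.
  by rewrite -ler_pdivlMr ?mulr_gt0// /eta ge_min lexx orbT.
have [d1 d10 H1] := df _ eta0; have [d2 d20 H2] := dg _ eta0.
pose d3 := Num.min 1 (e / (4 * K ^+ 2)).
have K20 : 0 < K ^+ 2 by rewrite exprn_gt0.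
have d30 : 0 < d3 by rewrite lt_min ltr01 divr_gt0// mulr_gt0.
have d3e : d3 * (4 * K ^+ 2) <= e.
  by rewrite -ler_pdivlMr ?mulr_gt0// /d3 ge_min lexx orbT.
exists (Num.min d3 (Num.min d1 d2)); first by rewrite lt_min d30 lt_min d10.
move=> h; rewrite lt_min => /andP[h3]; rewrite lt_min => /andP[/H1 h1 /H2 h2].
have hn := normc_ge0 h.
have h31 : normc h <= 1 by apply: le_trans (ltW h3) _; rewrite /d3 ge_min lexx.
set r := f (z + h) - f z - L * h in h1; set s := g (z + h) - g z - N * h in h2.
rewrite (_ : _ - _ = r * (g z + N * h + s) + (f z + L * h) * s + (L * N) * (h * h)); last first.
  by rewrite /r /s; ring.
have b1 : normc (g z + N * h + s) <= K.
  apply: le_trans (normcD _ _) _; have := normcD (g z) (N * h); rewrite normcM.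
  have := ler_piMr N0 h31; have := ler_piMr (ltW eta0) h31; rewrite /K; lra.
have b2 : normc (f z + L * h) <= K.
  have := normcD (f z) (L * h); rewrite normcM; have := ler_piMr L0 h31; rewrite /K; lra.
have b3 : normc (L * N) <= K * K by apply: normcM_le; rewrite /K; lra.
have b4 : normc (h * h) <= d3 * normc h by rewrite normcM ler_wpM2r// ltW.
have c1 := normcM_le h1 b1; have c2 := normcM_le b2 h2; have c3 := normcM_le b3 b4.
apply: le_trans (normcD _ _) _; apply: le_trans (lerD (normcD _ _) (lexx _)) _.
have m1 := ler_wpM2r hn etae; have m2 := ler_wpM2r hn d3e.
have en : 0 <= e * normc h by rewrite mulr_ge0// ltW.
rewrite expr2 in m2; lra.
Qed.

Lemma cderiv_inv_sub c z : z != c -> cderiv (fun w => (w - c)^-1) z (- (z - c) ^- 2).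
Proof.
move=> zc e e0; have w0 : z - c != 0 by rewrite subr_eq0.
have n0 : 0 < normc (z - c) by rewrite normc_gt0.
set w := z - c in w0 n0 *.
have n3 : 0 < normc w ^+ 3 by rewrite exprn_gt0.
exists (Num.min (normc w / 2) (e * normc w ^+ 3 / 2)).
  by rewrite lt_min !divr_gt0// mulr_gt0.
move=> h; rewrite lt_min => /andP[h1 h2].
have wh : normc w / 2 <= normc (w + h).
  by have := normcB (w + h) h; rewrite addrK; lra.
have wh0 : w + h != 0 by rewrite -normc_gt0; apply: lt_le_trans wh; rewrite divr_gt0.
rewrite (_ : z + h - c = w + h); last by rewrite /w; ring.
rewrite (_ : _ - _ = h * h / (w ^+ 2 * (w + h))); last by field; rewrite w0 wh0.
rewrite !normcM normcV normcM normcX -mulrA mulrCA [e * _]mulrC ler_wpM2l ?normc_ge0//.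
rewrite ler_pdivrMr ?mulr_gt0 ?exprn_gt0 ?normc_gt0//.
have : normc w ^+ 2 * (normc w / 2) <= normc w ^+ 2 * normc (w + h).
  by rewrite ler_wpM2l// sqr_ge0.
rewrite mulrA -exprSr => k; have := ler_wpM2l (ltW e0) k; lra.
Qed.

Lemma cderiv_continuous f z L : cderiv f z L -> forall e : R, 0 < e ->
  exists2 d : R, 0 < d & forall w, normc (w - z) < d -> normc (f w - f z) < e.
Proof.
move=> /cderiv_bound[r r0 H] e e0; have L1 : 0 < normc L + 1 by rewrite ltr_wpDl// normc_ge0.
exists (Num.min r (e / (normc L + 1))); first by rewrite lt_min r0 divr_gt0.
move=> w; rewrite lt_min => /andP[/H h1]; rewrite ltr_pdivlMr// => h2.
by apply: le_lt_trans h1 _; rewrite mulrC.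
Qed.

Lemma analytic_cst D c : analytic_on D (fun=> c).
Proof. by apply/analytic_onP => z _; exists 0; exact: cderiv_cst. Qed.

Lemma analyticD D f g : analytic_on D f -> analytic_on D g -> analytic_on D (fun z => f z + g z).
Proof.
move=> /analytic_onP af /analytic_onP ag; apply/analytic_onP => z Dz.
have [L dL] := af z Dz; have [N dN] := ag z Dz; exists (L + N); exact: cderivD.
Qed.

Lemma analyticM D f g : analytic_on D f -> analytic_on D g -> analytic_on D (fun z => f z * g z).
Proof.
move=> /analytic_onP af /analytic_onP ag; apply/analytic_onP => z Dz.
have [L dL] := af z Dz; have [N dN] := ag z Dz; eexists; exact: (cderivM dL dN).
Qed.

Lemma analyticZ D f c : analytic_on D f -> analytic_on D (fun z => c * f z).
Proof. by apply: analyticM; exact: analytic_cst. Qed.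

Lemma analyticB D f g : analytic_on D f -> analytic_on D g -> analytic_on D (fun z => f z - g z).
Proof.
move=> af ag; have := analyticD af (@analyticZ D g (-1) ag).
by congr analytic_on; apply/funext => z; rewrite mulN1r.
Qed.

Lemma analyticX D f n : analytic_on D f -> analytic_on D (fun z => f z ^+ n).
Proof.
move=> af; elim: n => [|n IH]; first exact: analytic_cst.
by under eq_fun do rewrite exprS; exact: analyticM.
Qed.

Lemma analytic_measurable D f : open D -> analytic_on D f -> measurable_fun D f.
Proof.
move=> oD /analytic_onP af; apply: open_eps_measurable => // z Dz e e0.
by have [L dL] := af z Dz; exact: cderiv_continuous dL e e0.
Qed.

Definition cut D f z : R[i] := if z \in D then f z else 0.

Lemma cutE D f z : D z -> cut D f z = f z.
Proof. by move=> Dz; rewrite /cut mem_set. Qed.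

Lemma cut_out D f z : ~ D z -> cut D f z = 0.
Proof. by move=> Dz; rewrite /cut; case: ifP => // /set_mem. Qed.

Lemma measurable_cut_fun D f : measurable D -> measurable_fun D f ->
  measurable_fun setT (cut D f).
Proof. exact: measurable_cut. Qed.

Lemma measurable_cut_analytic D f : open D -> analytic_on D f ->
  measurable_fun setT (cut D f).
Proof.
move=> oD af; apply: measurable_cut_fun; first exact: open_complex_measurable.
exact: analytic_measurable.
Qed.

Lemma cut_cderiv D f z L : open D -> D z -> cderiv f z L -> cderiv (cut D f) z L.
Proof.
move=> /open_normcP oD /oD[r r0 Hr]; apply: (cderiv_near r0) => w /Hr Dw.
by rewrite cutE.
Qed.

Lemma analytic_bounded D f c (d : R) : 0 < d -> (forall z, normc (z - c) <= 2 * d -> D z) ->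
  analytic_on D f -> exists2 M : R, 0 < M & forall z, normc (z - c) <= d -> normc (f z) <= M.
Proof.
move=> d0 bD /analytic_onP af.
(* The closed square of radius [d] about [c] is the box of side [3 * (2 / 3 * d)], and it lies in
   the disc of radius [2 * d]. *)
pose p := (complex.Re c - d) +i* (complex.Im c - d).
have e0 : 0 < 2 / 3 * d by rewrite mulr_gt0.
have [|M HM] := @cbox_bounded _ f p (2 / 3 * d) e0.
  move=> z [/= /andP[? ?] /andP[? ?]]; apply: af; apply: bD.
  apply: le_trans (normc_le_ReIm _) _; rewrite !ReImE.
  have h1 : `|complex.Re z - complex.Re c| <= d by rewrite ler_norml; apply/andP; split; lra.
  have h2 : `|complex.Im z - complex.Im c| <= d by rewrite ler_norml; apply/andP; split; lra.
  lra.
exists (`|M| + 1) => [|z zc]; first by rewrite ltr_wpDl.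
apply: (@le_trans _ _ M); last by have := ler_norm M; lra.
apply: HM; have := le_trans (normr_Re_le _) zc; have := le_trans (normr_Im_le _) zc.
rewrite !ReImE !ler_norml => /andP[? ?] /andP[? ?].
by split; apply/andP; split; rewrite /=; lra.
Qed.

Lemma open_ball_radius D c (k : R) : 0 < k -> open D -> D c ->
  exists2 d : R, 0 < d & forall z, normc (z - c) <= k * d -> D z.
Proof.
move=> k0 /open_normcP oD /oD[r r0 Hr]; exists (r / (2 * k)); first by rewrite divr_gt0// mulr_gt0.
move=> z zc; apply: Hr; apply: le_lt_trans zc _.
rewrite (_ : k * (r / (2 * k)) = r / 2); first lra.
by field; rewrite gt_eqF.
Qed.

(* The Cauchy formula on [D] with a kernel concentrated on an annulus at [c]. *)
Lemma analytic_kernel D c (d : R) : 0 < d -> open D ->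
  (forall z, normc (z - c) <= 20 * d -> D z) ->
  exists kap : R[i] -> R[i], exists2 K : R, 0 < K &
  [/\ measurable_fun setT kap, forall z, normc (kap z) <= K,
      forall z, normc (z - c) < d / 2 -> kap z = 0,
      forall z, 10 * d < normc (z - c) -> kap z = 0 &
      forall f, analytic_on D f -> forall a, normc (a - c) < d / 2 ->
        f a = cint (fun z => kap z * cut D f z / (z - a))].
Proof.
move=> d0 oD bD; have [kap [K [mk kK kin kout kf]]] := cauchy_kernel c d0.
exists kap, (`|K| + 1); first by rewrite ltr_wpDl.
split => //.
  by move=> z; apply: le_trans (kK z) _; have := ler_norm K; lra.
move=> f af a ac; rewrite -kf ?cutE//.
- by apply: bD; lra.
- exact: measurable_cut_analytic.
- move=> z zc; have Dz : D z by apply: bD; have := normc_ge0 (z - c); lra.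
  by have [L dL] := (analytic_onP D f).1 af z Dz; exists L; exact: cut_cderiv.
Qed.

Lemma analytic_expansion D f c : open D -> D c -> analytic_on D f ->
  exists A2 A3, exists C : R, exists2 r : R, 0 < r & 0 <= C /\ forall h, normc h < r ->
    normc (f (c + h) - f c - h * A2 - h ^+ 2 * A3) <= C * normc h ^+ 3.
Proof.
(* [20 = 2 * 10]: the kernel reaches to distance [10 * d], and [analytic_bounded] wants twice that
   radius. *)
move=> oD Dc af; have [d d0 bD] := open_ball_radius (ltr0n R 20) oD Dc.
have [kap [K K0 [mk kK kin kout kf]]] := analytic_kernel d0 oD bD.
have d10 : 0 < 10 * d by rewrite mulr_gt0.
have [M M0 HM] := @analytic_bounded D f c (10 * d) d10 (fun z h => bD z ltac:(lra)) af.
have kM z : normc (kap z * cut D f z) <= K * M.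
  have [zc|zc] := leP (normc (z - c)) (10 * d).
    by apply: normcM_le => //; rewrite cutE; [exact: HM|apply: bD; lra].
  by rewrite kout// mul0r normc0 mulr_ge0// ltW.
have dh : 0 < d / 2 by rewrite divr_gt0.
have [||||A1 [A2 [A3 [C C0 H]]]] := @cauchy_integral_expansion _ (fun z => kap z * cut D f z) c
    (d / 2) (K * M) (normc c + 10 * d) dh.
- by apply: measurable_complexM => //; exact: measurable_cut_analytic.
- exact: kM.
- by move=> z /kin->; rewrite mul0r.
- by move=> z zc; rewrite kout ?mul0r//; have := normcD (z - c) c; rewrite subrK; lra.
exists A2, A3, C, (d / 2 / 2); first by rewrite divr_gt0.
have fE h : normc h <= d / 2 / 2 -> normc (f (c + h) - A1 - h * A2 - h ^+ 2 * A3) <= C * normc h ^+ 3.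
  move=> hd; have := H h hd; rewrite -kf//.
  by rewrite addrC addKr; lra.
(* The estimate at [h = 0] identifies the constant term. *)
have A1E : f c = A1.
  have h0 : normc (0 : R[i]) <= d / 2 / 2 by rewrite normc0; lra.
  have := fE 0 h0; rewrite addr0 normc0 !expr0n !mul0r !subr0 mulr0.
  by rewrite normc_le0 subr_eq0 => /eqP.
by split => // h hd; rewrite A1E; apply: fE; exact: ltW.
Qed.

Definition quot f c (A : R[i]) z : R[i] := if z == c then A else (f z - f c) / (z - c).

(** Removable singularity: [A] is the linear coefficient of the cubic expansion, and the quadratic
    coefficient becomes the derivative of the quotient at [c], since the remainder divided by [h] is
    still of second order. *)
Lemma quot_analytic D f c : open D -> D c -> analytic_on D f ->
  exists A, analytic_on D (quot f c A).
Proof.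
move=> oD Dc af; have [A2 [A3 [C [r r0 [C0 H]]]]] := analytic_expansion oD Dc af.
exists A2; apply/analytic_onP => z Dz; have [->|zc] := eqVneq z c.
  exists A3 => e e0; have C1 : 0 < C + 1 by rewrite ltr_wpDl.
  exists (Num.min r (e / (C + 1))); first by rewrite lt_min r0 divr_gt0.
  move=> h; rewrite lt_min => /andP[/H h1]; rewrite ltr_pdivlMr// => h2.
  rewrite /quot eqxx; have [->|h0] := eqVneq h 0.
    by rewrite addr0 eqxx subrr mulr0 subr0 normc0 mulr0.
  rewrite (_ : (c + h == c) = false); last by rewrite -subr_eq0 addrC addKr (negbTE h0).
  have n0 : 0 < normc h by rewrite normc_gt0.
  rewrite -(ler_pM2r n0) -normcM (_ : _ * h = f (c + h) - f c - h * A2 - h ^+ 2 * A3); last first.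
    by rewrite [c + h - c](_ : _ = h); [field|ring].
  apply: le_trans h1 _.
  rewrite (_ : C * normc h ^+ 3 = C * normc h * normc h * normc h); last by ring.
  by rewrite ler_pM2r// ler_pM2r//; rewrite mulrDr mulr1 in h2; lra.
have [L dL] := (analytic_onP D f).1 af z Dz.
have n0 : 0 < normc (z - c) by rewrite normc_gt0 subr_eq0.
eexists; apply: (cderiv_near n0 _ (cderivM (cderivD dL (cderiv_cst (- f c) z)) (cderiv_inv_sub zc))).
move=> w wz; rewrite /quot; case: eqVneq => // wc; exfalso.
by rewrite wc normc_distC ltxx in wz.
Qed.

(** If [g] is a power of [z - c] times a function nonzero at [c], a zero at [c] is isolated.
    Otherwise every power of [z - c] divides [g], and Cauchy's formula for the quotients forces
    [g = 0] near [c]. *)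
Lemma analytic_zero_dichotomy D g c : open D -> D c -> analytic_on D g ->
  (exists2 r : R, 0 < r & forall z, normc (z - c) < r -> g z = 0) \/
  (exists2 r : R, 0 < r & forall z, normc (z - c) < r -> z != c -> g z != 0).
Proof.
move=> oD Dc ag.
have [[q [m [aq gq qc]]]|no] := pselect (exists q m, [/\ analytic_on D q,
    forall z, D z -> g z = (z - c) ^+ m * q z & q c != 0]).
  right; have [r r0 Hr] := (open_normcP D).1 oD c Dc.
  have [L dL] := (analytic_onP D q).1 aq c Dc.
  have qc0 : 0 < normc (q c) by rewrite normc_gt0.
  have [e e0 He] := cderiv_continuous dL qc0.
  exists (Num.min r e); first by rewrite lt_min r0.
  move=> z; rewrite lt_min => /andP[/Hr Dz /He ze] zc.
  rewrite gq// mulf_neq0// ?expf_neq0 ?subr_eq0//; apply/eqP => qz.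
  by rewrite qz sub0r normcN ltxx in ze.
left; have all n : exists2 q, analytic_on D q & forall z, D z -> g z = (z - c) ^+ n * q z.
  elim: n => [|n [q aq gq]]; first by exists g => // z _; rewrite mul1r.
  have qc : q c = 0.
    by apply/eqP; apply: contrapT => /negP qc; apply: no; exists q, n.
  have [A aA] := quot_analytic oD Dc aq; exists (quot q c A) => // z Dz.
  rewrite gq// /quot; have [->|zc] := eqVneq z c; first by rewrite qc mulr0 subrr exprS !mul0r.
  by rewrite qc subr0 exprSr -mulrA; congr (_ * _); rewrite mulrC divfK// subr_eq0.
have [d d0 bD] := open_ball_radius (ltr0n R 20) oD Dc.
have [kap [K K0 [mk kK kin kout kf]]] := analytic_kernel d0 oD bD.
have d10 : 0 < 10 * d by rewrite mulr_gt0.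
have [M M0 HM] := @analytic_bounded D g c (10 * d) d10 (fun z h => bD z ltac:(lra)) ag.
exists (d / 4) => [|a ac]; first by rewrite divr_gt0.
have Da : D a by apply: bD; lra.
pose S := square c (11 * d).
have mS : measurable S by exact: measurable_square.
have Soo : (area S < +oo)%E by rewrite area_square ?ltry// mulr_ge0// ltW.
pose C0 := 2 * (K * M * (4 / d)) * fine (area S).
have C00 : 0 <= C0 by rewrite !mulr_ge0 ?fine_ge0// ?invr_ge0 ltW.
(* The kernel sees [q] only where [normc (z - c) >= d / 2], so [q a] is bounded by a constant times
   [(d / 2) ^- n]; the factor [(a - c) ^ n] is at most [(d / 4) ^ n], which leaves [2 ^- n]. *)
have small n : normc (g a) <= C0 * (2^-1) ^+ n.
  have [q aq gq] := all n.
  have dn : 0 < (d / 2) ^+ n by rewrite exprn_gt0// divr_gt0.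
  have qa : normc (q a) <= C0 / (d / 2) ^+ n.
    rewrite (kf q aq a); last by lra.
    have pos : 0 <= K * (M / (d / 2) ^+ n) * (4 / d) :=
      mulr_ge0 (mulr_ge0 (ltW K0) (divr_ge0 (ltW M0) (ltW dn))) (divr_ge0 (ler0n R 4) (ltW d0)).
    have [|||||_ h] := @cint_bounded R (fun z => kap z * cut D q z / (z - a)) S (K * (M / (d / 2) ^+ n) * (4 / d)).
    - apply: measurable_complexM; last by apply: measurable_complexV; exact: (measurable_shift (- a)).
      by apply: measurable_complexM => //; exact: measurable_cut_analytic.
    - exact: mS.
    - exact: Soo.
    - move=> z _; have [zc|zc] := ltP (normc (z - c)) (d / 2).
        by rewrite kin// !mul0r normc0.
      have [zc'|zc'] := leP (normc (z - c)) (10 * d); last first.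
        by rewrite kout// !mul0r normc0.
      have Dz : D z by apply: bD; lra.
      apply: normcM_le; last first.
        rewrite normcV -[leRHS]invrK invf_div lef_pV2 ?posrE ?divr_gt0//.
          by have := normc_distD z a c; lra.
        by have := normc_distD z a c; lra.
      apply: normcM_le => //; rewrite cutE// ler_pdivlMr//.
      apply: le_trans (HM z zc'); rewrite gq// normcM normcX mulrC ler_wpM2r ?normc_ge0//.
      by rewrite lerXn2r ?nnegrE ?normc_ge0// divr_ge0// ltW.
    - move=> z zS; rewrite kout ?mul0r//.
      rewrite ltNge; apply/negP => zc; apply: zS; apply: normc_lt_square; lra.
    apply: le_trans h _; rewrite le_eqVlt; apply/orP; left; apply/eqP.
    by rewrite /C0; field; rewrite gt_eqF// gt_eqF.
  rewrite gq// normcM normcX.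
  apply: (@le_trans _ _ ((d / 4) ^+ n * (C0 / (d / 2) ^+ n))).
    by rewrite ler_pM ?exprn_ge0 ?normc_ge0// lerXn2r ?nnegrE ?normc_ge0 ?divr_ge0 ?ltW.
  rewrite (_ : d / 4 = d / 2 * 2^-1); last by field.
  by rewrite exprMn le_eqVlt; apply/orP; left; apply/eqP; field; rewrite expf_neq0//= gt_eqF// divr_gt0.
apply/eqP; rewrite -normc_le0.
have cv : (fun n => C0 * (2^-1) ^+ n) @ \oo --> (0 : R).
  rewrite -(mulr0 C0); apply: cvgMr; apply: cvg_expr.
  by rewrite ger0_norm ?invf_lt1// ltr1n.
rewrite -(cvg_lim _ cv)//; apply: limr_ge; first by apply/cvg_ex; exists 0.
by apply: nearW => n; exact: small.
Qed.

(** Connectedness: the points near which [f - w] vanishes identically, and those with a punctured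
    neighbourhood free of zeros, form two disjoint open sets covering [D]; the first cannot be all
    of [D]. *)
Lemma identity_theorem D f (w : R[i]) : domain D -> analytic_on D f ->
  (exists z1 z2, [/\ D z1, D z2 & f z1 <> f z2]) ->
  forall c, D c -> exists2 r : R, 0 < r &
    forall z, normc (z - c) < r -> z != c -> f z != w.
Proof.
move=> [oD cD _] af [z1 [z2 [Dz1 Dz2 f12]]].
pose g z := f z - w.
have ag : analytic_on D g := analyticB af (@analytic_cst D w).
pose U := [set c | D c /\ exists2 r : R, 0 < r & forall z, normc (z - c) < r -> g z = 0].
pose V := [set c | D c /\ exists2 r : R, 0 < r & forall z, normc (z - c) < r -> z != c -> g z != 0].
have oU : open U.
  apply/open_normcP => c [Dc [r r0 Hr]]; have [s s0 Hs] := (open_normcP D).1 oD c Dc.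
  exists (Num.min (r / 2) s); first by rewrite lt_min divr_gt0.
  move=> z; rewrite lt_min => /andP[zr zs]; split; first exact: Hs.
  exists (r / 2) => [|y yz]; first by rewrite divr_gt0.
  by apply: Hr; have := normc_distD y z c; lra.
have oV : open V.
  apply/open_normcP => c [Dc [r r0 Hr]]; have [s s0 Hs] := (open_normcP D).1 oD c Dc.
  exists (Num.min (r / 2) s); first by rewrite lt_min divr_gt0.
  move=> z; rewrite lt_min => /andP[zr zs]; split; first exact: Hs.
  have [->|zc] := eqVneq z c; first by exists r.
  have n0 : 0 < normc (z - c) by rewrite normc_gt0 subr_eq0.
  exists (normc (z - c)) => // y yz _; apply: Hr; first by have := normc_distD y z c; lra.
  by apply/eqP => yc; rewrite yc normc_distC ltxx in yz.
have UV c : U c -> V c -> False.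
  move=> [_ [r r0 Hr]] [_ [s s0 Hs]]; pose t := Num.min (r / 2) (s / 2).
  have t0 : 0 < t by rewrite lt_min !divr_gt0.
  have [tr ts] : t <= r / 2 /\ t <= s / 2 by split; rewrite /t ge_min lexx ?orbT.
  have nt : normc (c + t%:C - c) = t by rewrite addrC addKr normc_real gtr0_norm.
  have := Hs (c + t%:C); rewrite nt Hr ?nt ?eqxx; last by lra.
  have ts' : t < s by lra.
  have ct : c + t%:C != c by rewrite -subr_eq0 -normc_gt0 nt.
  by move=> /(_ ts' ct).
have UVD c : D c -> U c \/ V c.
  by move=> Dc; have [h|h] := analytic_zero_dichotomy oD Dc ag; [left|right].
move=> c Dc; have [Uc|[_ [r r0 Hr]]] := UVD c Dc; last first.
  by exists r => // z zr zc; have := Hr z zr zc; rewrite subr_eq0.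
exfalso; have UD : U = D.
  apply: cD; first by exists c.
  - by exists U => //; apply/seteqP; split => [z Uz|z []//]; split => //; case: Uz.
  - exists (~` V); first exact: open_closedC.
    apply/seteqP; split => z.
      by move=> Uz; split; [case: Uz|move=> Vz; exact: UV Uz Vz].
    by move=> [Dz nV]; have [//|/nV] := UVD z Dz.
have g0 z : D z -> g z = 0.
  by rewrite -UD => -[_ [r r0]]; apply; rewrite subrr normc0.
by apply: f12; have /eqP := g0 z1 Dz1; have /eqP := g0 z2 Dz2; rewrite !subr_eq0 => /eqP-> /eqP->.
Qed.

(** Lindelof's argument: the rational squares whose intersection with [E] is negligible are
    countably many and cover [E]. *)
Lemma local_negligible (E : set R[i]) :
  (forall c, E c -> exists2 r : R, 0 < r &
    (area : set R[i] -> \bar R).-negligible (E `&` [set z | normc (z - c) < r])) ->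
  (area : set R[i] -> \bar R).-negligible E.
Proof.
move=> H; pose F (n : nat) : set R[i] := if @unpickle (rat * rat * rat)%type n is Some q then
  (if `[< (area : set R[i] -> \bar R).-negligible (E `&` ratsquare q) >] then E `&` ratsquare q else set0) else set0.
have nF n : (area : set R[i] -> \bar R).-negligible (F n).
  rewrite /F; case: unpickle => [q|]; last exact: negligible_set0.
  by case: asboolP => // _; exact: negligible_set0.
apply: negligibleS (negligible_bigcup nF) => c Ec; have [r r0 Hr] := H c Ec.
have [q [qc qr]] := ratsquare_base c r0.
exists (pickle q); first exact: I.
rewrite /F pickleK ifT; first by split.
by apply/asboolP; apply: negligibleS Hr => z [Ez qz]; split; [exact: Ez|exact: qr].
Qed.

Lemma negligible_singleton (z : R[i]) : (area : set R[i] -> \bar R).-negligible [set z].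
Proof.
exists [set z]; split => //; [exact: measurable_singleton|exact: area_singleton].
Qed.

Lemma level_set_negligible D f (w : R[i]) : domain D -> analytic_on D f ->
  (exists z1 z2, [/\ D z1, D z2 & f z1 <> f z2]) ->
  (area : set R[i] -> \bar R).-negligible (D `&` [set z | f z = w]).
Proof.
move=> dD af fnc; apply: local_negligible => c [Dc _].
have [r r0 Hr] := identity_theorem w dD af fnc Dc.
exists r => //; apply: negligibleS (negligible_singleton c) => z [[_ fz] zr].
by apply: contrapT => /eqP zc; have := Hr z zr zc; rewrite fz eqxx.
Qed.

End ComplexDerivative.

(** * The Bergman space and its orthogonal projection *)

Section BergmanSpace.
Context {R : realType}.
Implicit Types (z c t : R[i]) (f g h k u : R[i] -> R[i]) (D : set R[i]).

Definition sqint D f := measurable_fun setT (cut D f) /\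
  area.-integrable setT (EFin \o (fun z => normc (cut D f z) ^+ 2)).

Lemma square_integrableP D f : measurable D -> square_integrable D f <-> sqint D f.
Proof.
move=> mD.
have e : (\int[area]_(z in D) ((normc (f z)) ^+ 2)%:E = \int[area]_z (normc (cut D f z) ^+ 2)%:E)%E.
  rewrite integral_mkcond; apply: eq_integral => z _; rewrite /patch /cut.
  by case: ifP => // _; rewrite normc0 expr0n.
have e' : (\int[area]_z `|(normc (cut D f z) ^+ 2)%:E| = \int[area]_z (normc (cut D f z) ^+ 2)%:E)%E.
  by apply: eq_integral => z _; rewrite gee0_abs// lee_fin sqr_ge0.
split=> [[mf foo]|[mf /integrableP[_ foo]]].
  have mc := measurable_cut_fun mD mf; split => //; apply/integrableP; split.
    by apply/measurable_EFinP; apply: measurable_funX; exact: measurable_normc.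
  by rewrite e' -e.
split; last by rewrite e -e'.
move=> _ A mA; rewrite (_ : D `&` f @^-1` A = D `&` cut D f @^-1` A).
  by apply: measurableI => //; have := mf measurableT A mA; rewrite setTI.
by apply/seteqP; split => z [Dz]; rewrite /preimage /= cutE.
Qed.

Lemma cutD D f g z : cut D (fun w => f w + g w) z = cut D f z + cut D g z.
Proof. by rewrite /cut; case: ifP => // _; rewrite addr0. Qed.

Lemma cutZ D f c z : cut D (fun w => c * f w) z = c * cut D f z.
Proof. by rewrite /cut; case: ifP => // _; rewrite mulr0. Qed.

Lemma cutM D f g z : cut D (fun w => f w * g w) z = cut D f z * cut D g z.
Proof. by rewrite /cut; case: ifP => // _; rewrite mulr0. Qed.

Lemma sqintD D f g : sqint D f -> sqint D g -> sqint D (fun z => f z + g z).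
Proof.
move=> [mf jf] [mg jg].
have m : measurable_fun setT (cut D (fun z => f z + g z)).
  rewrite (_ : cut D _ = fun z => cut D f z + cut D g z); first exact: measurable_complexD.
  by apply/funext => z; rewrite cutD.
split => //.
have i2 := integrableZl measurableT 2 (integrableD measurableT jf jg).
apply: le_integrable i2 => //.
  by apply/measurable_EFinP; apply: measurable_funX; exact: measurable_normc.
move=> z _ /=; rewrite lee_fin ger0_norm ?sqr_ge0//.
apply: le_trans (ler_norm _); rewrite cutD.
have := normcD (cut D f z) (cut D g z).
have := normc_ge0 (cut D f z + cut D g z); have := sqr_ge0 (normc (cut D f z) - normc (cut D g z)).
by nra.
Qed.

Lemma sqintZ D f c : sqint D f -> sqint D (fun z => c * f z).
Proof.
move=> [mf jf].
have m : measurable_fun setT (cut D (fun z => c * f z)).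
  rewrite (_ : cut D _ = fun z => c * cut D f z); first exact: measurable_complexM.
  by apply/funext => z; rewrite cutZ.
split => //; rewrite (_ : _ \o _ = fun z => ((normc c ^+ 2)%:E * (normc (cut D f z) ^+ 2)%:E)%E).
  exact: (integrableZl measurableT (normc c ^+ 2) jf).
by apply/funext => z /=; rewrite cutZ normcM exprMn.
Qed.

Lemma sqintB D f g : sqint D f -> sqint D g -> sqint D (fun z => f z - g z).
Proof.
move=> hf hg; have := sqintD hf (@sqintZ D g (-1) hg).
by congr sqint; apply/funext => z; rewrite mulN1r.
Qed.

Lemma innerE D f g : inner D f g = cint (fun z => cut D f z * Num.conj (cut D g z)).
Proof.
rewrite /inner complex_integralE; apply: eq_cint => z.
by rewrite /cut; case: ifP => // _; rewrite mul0r.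
Qed.

Lemma inner_integrable D f g : sqint D f -> sqint D g ->
  cintegrable (fun z => cut D f z * Num.conj (cut D g z)).
Proof.
move=> [mf jf] [mg jg].
apply: (@cintegrable_le _ _ (fun z => normc (cut D f z) ^+ 2 + normc (cut D g z) ^+ 2)).
- by apply: measurable_complexM => //; exact: measurable_complexJ.
- move=> z; rewrite normcM normc_conj.
  by have := sqr_ge0 (normc (cut D f z) - normc (cut D g z));
    have := sqr_ge0 (normc (cut D f z)); have := sqr_ge0 (normc (cut D g z)); nra.
- exact: (integrableD measurableT jf jg).
Qed.

Lemma innerDl D f g k : sqint D f -> sqint D g -> sqint D k ->
  inner D (fun z => f z + g z) k = inner D f k + inner D g k.
Proof.
move=> sf sg sk; rewrite !innerE -(cintD (inner_integrable sf sk) (inner_integrable sg sk)).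
by apply: eq_cint => z; rewrite cutD mulrDl.
Qed.

Lemma innerZl D f k c : sqint D f -> sqint D k ->
  inner D (fun z => c * f z) k = c * inner D f k.
Proof.
move=> sf sk; rewrite !innerE -(cintZ c (inner_integrable sf sk)).
by apply: eq_cint => z; rewrite cutZ mulrA.
Qed.

Lemma innerC D f k : sqint D f -> sqint D k -> inner D k f = Num.conj (inner D f k).
Proof.
move=> sf sk; rewrite !innerE.
transitivity (cint (fun z => conjc (cut D f z * Num.conj (cut D k z)))); last first.
  exact: (cintJ (inner_integrable sf sk)).
apply: eq_cint => z; case: (cut D f z) (cut D k z) => [a b] [a' b'].
by apply: eq_ReIm => /=; ring.
Qed.

Lemma innerBl D f g k : sqint D f -> sqint D g -> sqint D k ->
  inner D (fun z => f z - g z) k = inner D f k - inner D g k.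
Proof.
move=> sf sg sk; have := innerDl sf (@sqintZ D g (-1) sg) sk.
rewrite innerZl// mulN1r => <-; congr inner; apply/funext => z; by rewrite mulN1r.
Qed.

Lemma eq_inner D f g k : (forall z, D z -> f z = g z) -> inner D f k = inner D g k.
Proof.
move=> fg; rewrite !innerE; apply: eq_cint => z; congr (_ * _).
by rewrite /cut; case: ifP => // /set_mem /fg.
Qed.

Definition sqnorm D f : R := complex.Re (inner D f f).

Lemma sqnormE D f : sqnorm D f = \int[area]_z (normc (cut D f z) ^+ 2).
Proof.
rewrite /sqnorm innerE /=; apply: eq_Rintegral => z _.
by rewrite mulcJ.
Qed.

Lemma sqnorm_ge0 D f : 0 <= sqnorm D f.
Proof. by rewrite sqnormE; apply: Rintegral_ge0 => z _; exact: sqr_ge0. Qed.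

Lemma eq_sqnorm D f g : (forall z, f z = g z) -> sqnorm D f = sqnorm D g.
Proof. by move=> /funext->. Qed.

Lemma sqnormZ D f c : sqint D f -> sqnorm D (fun z => c * f z) = normc c ^+ 2 * sqnorm D f.
Proof.
move=> [mf jf]; rewrite !sqnormE -RintegralZl//; apply: eq_Rintegral => z _.
by rewrite cutZ normcM exprMn.
Qed.

Lemma sqnorm_sub D u k t : sqint D u -> sqint D k ->
  sqnorm D (fun z => u z - t * k z) =
  sqnorm D u - 2 * complex.Re (Num.conj t * inner D u k) + normc t ^+ 2 * sqnorm D k.
Proof.
move=> su sk; have sN := @sqintZ D k t sk; have sd := sqintB su sN.
rewrite /sqnorm innerBl// (innerC sd su) (innerC sd sN) !innerBl//.
rewrite !innerZl// (innerC su sk) (innerC sN su) (innerC sN sk) !innerZl//.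
rewrite (innerC su sk) sqr_normc.
set a := inner D u u; set b := inner D u k; set e := inner D k k.
by rewrite !ReImE /= ?ReImE; ring.
Qed.

Lemma parallelogram D u k : sqint D u -> sqint D k ->
  sqnorm D (fun z => u z - k z) + sqnorm D (fun z => u z + k z) = 2 * sqnorm D u + 2 * sqnorm D k.
Proof.
move=> su sk; have := sqnorm_sub 1 su sk; have := sqnorm_sub (-1) su sk.
rewrite (eq_sqnorm D (f := fun z => u z - -1 * k z) (g := fun z => u z + k z)); last first.
  by move=> z; rewrite mulN1r opprK.
rewrite (eq_sqnorm D (f := fun z => u z - 1 * k z) (g := fun z => u z - k z)); last first.
  by move=> z; rewrite mul1r.
move=> -> ->; rewrite normcN normc1 !ReImE /= ?ReImE /=; ring.
Qed.

Lemma bergmanP D f : open D -> bergman D f <-> sqint D f /\ analytic_on D f.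
Proof.
move=> oD; have mD := open_complex_measurable oD.
by split=> -[h1 h2]; split => //; apply/(square_integrableP f mD).
Qed.

Lemma bergmanD D f g : open D -> bergman D f -> bergman D g -> bergman D (fun z => f z + g z).
Proof.
move=> oD /(bergmanP _ oD)[sf af] /(bergmanP _ oD)[sg ag]; apply/(bergmanP _ oD).
by split; [exact: sqintD|exact: analyticD].
Qed.

Lemma bergmanZ D f c : open D -> bergman D f -> bergman D (fun z => c * f z).
Proof.
move=> oD /(bergmanP _ oD)[sf af]; apply/(bergmanP _ oD).
by split; [exact: sqintZ|exact: analyticZ].
Qed.

Lemma bergmanB D f g : open D -> bergman D f -> bergman D g -> bergman D (fun z => f z - g z).
Proof.
move=> oD /(bergmanP _ oD)[sf af] /(bergmanP _ oD)[sg ag]; apply/(bergmanP _ oD).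
by split; [exact: sqintB|exact: analyticB].
Qed.

(* Since [x <= lam + x ^ 2 / lam], the Cauchy formula bounds point values by
   the L2 norm without the Cauchy-Schwarz inequality. *)
Lemma bergman_sup D c : open D -> D c -> exists2 r : R, 0 < r & exists2 C : R, 0 <= C &
  forall k, bergman D k -> forall a, normc (a - c) < r ->
  D a /\ forall lam : R, 0 < lam -> normc (k a) <= C * (lam + sqnorm D k / lam).
Proof.
move=> oD Dc; have [d d0 bD] := open_ball_radius (ltr0n R 20) oD Dc.
have [kap [K K0 [mk kK kin kout kf]]] := analytic_kernel d0 oD bD.
pose S := square c (11 * d).
have mS : measurable S by exact: measurable_square.
have Soo : (area S < +oo)%E by rewrite area_square ?ltry// mulr_ge0// ltW.
pose A := fine (area S).
have A0 : 0 <= A by exact: fine_ge0.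
have dd0 : 0 < d / 4 by rewrite divr_gt0.
have Kd : 0 <= K * (4 / d) by rewrite mulr_ge0 ?divr_ge0// ltW.
exists (d / 4) => //; exists (2 * (K * (4 / d)) * (A + 1)) => [|k kB a ac].
  exact: mulr_ge0 (mulr_ge0 (ler0n R 2) Kd) (addr_ge0 A0 ler01).
have [[mck jk] ak] := (bergmanP k oD).1 kB.
split=> [|lam lam0]; first by apply: bD; lra.
pose g z := K * (4 / d) * (lam * \1_S z + lam^-1 * normc (cut D k z) ^+ 2).
have [i1 e1] := integrable_indic_bounded lam mS Soo.
have i2 : area.-integrable setT (EFin \o (fun z => lam^-1 * normc (cut D k z) ^+ 2)).
  exact: (integrableZl measurableT lam^-1 jk).
have i12 : area.-integrable setT (EFin \o (fun z => lam * \1_S z + lam^-1 * normc (cut D k z) ^+ 2)).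
  exact: (integrableD measurableT i1 i2).
have ig : area.-integrable setT (EFin \o g).
  exact: (integrableZl measurableT (K * (4 / d)) i12).
have ge : \int[area]_z g z = K * (4 / d) * (lam * A + lam^-1 * sqnorm D k).
  rewrite /g RintegralZl// RintegralD// e1 RintegralZl//.
  by rewrite sqnormE.
have bnd z : normc (kap z * cut D k z / (z - a)) <= g z.
  have g0 : 0 <= g z.
    by rewrite mulr_ge0// addr_ge0// mulr_ge0 ?sqr_ge0 ?invr_ge0 ?(ltW lam0)// indicE ler0n.
  have [zc|zc] := ltP (normc (z - c)) (d / 2); first by rewrite kin// !mul0r normc0.
  have [zc'|zc'] := leP (normc (z - c)) (10 * d); last by rewrite kout// !mul0r normc0.
  have zS : z \in S by apply: mem_set; apply: normc_lt_square; lra.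
  have za : d / 4 <= normc (z - a) by have := normc_distD z a c; lra.
  have iz : normc (z - a)^-1 <= 4 / d.
    by rewrite normcV -[leRHS]invrK invf_div lef_pV2 ?posrE//; lra.
  apply: le_trans (normcM_le (normcM_le (kK z) (lexx (normc (cut D k z)))) iz) _.
  rewrite /g indicE zS mulr1 mulrAC ler_wpM2l//.
  set x := normc _; rewrite -(ler_pM2l lam0) mulrDr mulrA mulrA mulfV ?gt_eqF// mul1r.
  by have := sqr_ge0 (lam - x); have := sqr_ge0 x; have := sqr_ge0 lam; nra.
rewrite (kf k ak a); last by lra.
have mi : measurable_fun setT (fun z => kap z * cut D k z / (z - a)).
  apply: measurable_complexM; last by apply: measurable_complexV; exact: (measurable_shift (- a)).
  exact: measurable_complexM.
have := normc_cint_le (cintegrable_le mi bnd ig) bnd ig.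
move=> hb; have N0 := sqnorm_ge0 D k.
have N1 : 0 <= sqnorm D k / lam by rewrite divr_ge0// ltW.
have key : lam * A + lam^-1 * sqnorm D k <= (A + 1) * (lam + sqnorm D k / lam).
  by rewrite [lam^-1 * _]mulrC; have := mulr_ge0 A0 N1; lra.
have h := ler_wpM2l (mulr_ge0 (ler0n R 2) Kd) key.
rewrite ge (_ : 2 * (K * (4 / d) * (lam * A + lam^-1 * sqnorm D k)) =
  2 * (K * (4 / d)) * (lam * A + lam^-1 * sqnorm D k)) in hb; last by ring.
by apply: le_trans hb _; apply: le_trans h _; rewrite [leLHS]mulrA.
Qed.

(** With norm zero the pointwise bound of [bergman_sup] is [C * lam] for every [lam > 0]. *)
Lemma bergman_eq0 D k : open D -> bergman D k -> inner D k k = 0 -> forall z, D z -> k z = 0.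
Proof.
move=> oD kB k0 z Dz; have [r r0 [C C0 H]] := bergman_sup oD Dz.
have [|_ Hk] := H k kB z; first by rewrite subrr normc0.
apply/eqP; rewrite -normc_le0; apply/ler_addgt0Pr => e e0; rewrite add0r.
have C1 : 0 < C + 1 by rewrite ltr_wpDl.
have := Hk (e / (C + 1)); rewrite divr_gt0// => /(_ isT)/le_trans; apply.
rewrite /sqnorm k0 /= mul0r addr0 mulrCA ler_piMr ?(ltW e0)//.
by rewrite ler_pdivrMr// mul1r lerDl.
Qed.

(** The limit is the supremum of the eventual lower bounds, that is, the lower limit. *)
Lemma real_cauchy (x : nat -> R) :
  (forall e : R, 0 < e -> exists n0, forall n m, (n0 <= n)%N -> (n0 <= m)%N -> `|x n - x m| <= e) ->
  exists l, forall e : R, 0 < e -> exists n0, forall n, (n0 <= n)%N -> `|x n - l| <= e.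
Proof.
move=> H; pose A := [set y | exists n0, forall n, (n0 <= n)%N -> y <= x n].
have key e n0 : (forall n m, (n0 <= n)%N -> (n0 <= m)%N -> `|x n - x m| <= e) ->
    A (x n0 - e) /\ ubound A (x n0 + e).
  move=> h; split.
    by exists n0 => n nn; have := h n0 n (leqnn _) nn; rewrite ler_norml => /andP[? ?]; lra.
  move=> y [m hm]; have := hm (maxn m n0) (leq_maxl _ _).
  by have := h (maxn m n0) n0 (leq_maxr _ _) (leqnn _); rewrite ler_norml => /andP[? ?]; lra.
exists (sup A) => e e0; have e2 : 0 < e / 2 by rewrite divr_gt0.
have [n0 h] := H _ e2; have [a1 a2] := key _ _ h.
have s1 : x n0 - e / 2 <= sup A by apply: ub_le_sup => //; exists (x n0 + e / 2).
have s2 : sup A <= x n0 + e / 2 by apply: ge_sup => //; exists (x n0 - e / 2).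
exists n0 => n nn; have := h n n0 nn (leqnn _); rewrite !ler_norml => /andP[? ?].
by apply/andP; split; lra.
Qed.

Lemma complex_cauchy (x : nat -> R[i]) :
  (forall e : R, 0 < e -> exists n0, forall n m, (n0 <= n)%N -> (n0 <= m)%N -> normc (x n - x m) <= e) ->
  exists l, forall e : R, 0 < e -> exists n0, forall n, (n0 <= n)%N -> normc (x n - l) <= e.
Proof.
move=> H.
have [a ha] : exists l, forall e : R, 0 < e -> exists n0, forall n, (n0 <= n)%N -> `|complex.Re (x n) - l| <= e.
  apply: real_cauchy => e /H[n0 h]; exists n0 => n m nn nm; apply: le_trans (h n m nn nm).
  by rewrite -cReN -cReD; exact: normr_Re_le.
have [b hb] : exists l, forall e : R, 0 < e -> exists n0, forall n, (n0 <= n)%N -> `|complex.Im (x n) - l| <= e.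
  apply: real_cauchy => e /H[n0 h]; exists n0 => n m nn nm; apply: le_trans (h n m nn nm).
  by rewrite -cImN -cImD; exact: normr_Im_le.
exists (a +i* b) => e e0; have e2 : 0 < e / 2 by rewrite divr_gt0.
have [n1 h1] := ha _ e2; have [n2 h2] := hb _ e2; exists (maxn n1 n2) => n.
rewrite geq_max => /andP[/h1 k1 /h2 k2]; apply: le_trans (normc_le_ReIm _) _.
by rewrite !ReImE /=; lra.
Qed.

(** Bounding point values by the norm makes the sequence locally uniformly Cauchy; Cauchy's formula
    with a fixed kernel survives the limit and gives back differentiability, as in Weierstrass's
    theorem. *)
Lemma bergman_limit D (hs : nat -> R[i] -> R[i]) : open D -> (forall n, bergman D (hs n)) ->
  (forall e : R, 0 < e -> exists n0, forall n m, (n0 <= n)%N -> (n0 <= m)%N ->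
     sqnorm D (fun z => hs n z - hs m z) <= e) ->
  exists2 h, analytic_on D h & forall z, D z -> forall e : R, 0 < e ->
    exists n0, forall n, (n0 <= n)%N -> normc (hs n z - h z) <= e.
Proof.
move=> oD hB hC.
have unif c : D c -> exists2 r : R, 0 < r & forall e : R, 0 < e -> exists n0, forall n m,
    (n0 <= n)%N -> (n0 <= m)%N -> forall a, normc (a - c) < r -> normc (hs n a - hs m a) <= e.
  move=> Dc; have [r r0 [C C0 H]] := bergman_sup oD Dc; exists r => // e e0.
  have C1 : 0 < 2 * C + 1 by rewrite ltr_wpDl// mulr_ge0.
  (* This balances the two terms of [bergman_sup]: a squared norm of at most [lam ^ 2] gives
     [2 * C * lam <= e]. *)
  pose lam := e / (2 * C + 1).
  have lam0 : 0 < lam by rewrite divr_gt0.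
  have [|n0 h] := hC (lam ^+ 2); first by rewrite exprn_gt0.
  exists n0 => n m nn nm a ac; have [_ Hk] := H _ (bergmanB oD (hB n) (hB m)) a ac.
  apply: le_trans (Hk lam lam0) _.
  apply: (@le_trans _ _ (C * (lam + lam))).
    rewrite ler_wpM2l// lerD2l ler_pdivrMr// -expr2; exact: h.
  rewrite (_ : e = lam * (2 * C + 1)); last by rewrite /lam divfK// gt_eqF.
  by have := mulr_ge0 C0 (ltW lam0); lra.
have ptw z : exists l, D z -> forall e : R, 0 < e -> exists n0, forall n, (n0 <= n)%N -> normc (hs n z - l) <= e.
  have [Dz|nD] := pselect (D z); last by exists 0 => /nD.
  have [r r0 H] := unif z Dz.
  have [|l hl] := @complex_cauchy (fun n => hs n z); last by exists l.
  move=> e /H[n0 h]; exists n0 => n m nn nm; apply: h => //.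
  by rewrite subrr normc0.
pose h z := sval (cid (ptw z)).
have hP z : D z -> forall e : R, 0 < e -> exists n0, forall n, (n0 <= n)%N -> normc (hs n z - h z) <= e.
  exact: svalP (cid (ptw z)).
exists h; last exact: hP.
have unifh c : D c -> exists2 r : R, 0 < r & forall e : R, 0 < e -> exists n, 
    forall a, normc (a - c) < r -> D a -> normc (hs n a - h a) <= e.
  move=> Dc; have [r r0 H] := unif c Dc; exists r => // e e0.
  have e2 : 0 < e / 2 by rewrite divr_gt0.
  have [n0 h0] := H _ e2; exists n0 => a ac Da; have [n1 h1] := hP a Da _ e2.
  have m1 := h1 (maxn n0 n1) (leq_maxr _ _).
  have m0 := h0 n0 (maxn n0 n1) (leqnn _) (leq_maxl _ _) a ac.
  by have := normc_distD (hs n0 a) (hs (maxn n0 n1) a) (h a); lra.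
(* Measurability has to come before analyticity, as the kernel formula integrates [h]. *)
have mh : measurable_fun setT (cut D h).
  have cvg (g : R[i] -> R) : (forall z w, `|g z - g w| <= normc (z - w)) ->
      measurable_fun setT g -> measurable_fun setT (fun z => g (cut D h z)).
    move=> g1 mg.
    apply: (@measurable_fun_cvg _ _ _ setT (fun n z => g (cut D (hs n) z))) => //.
      move=> n; apply: (measurableT_comp mg); apply: measurable_cut_analytic => //.
      by have /(bergmanP _ oD)[] := hB n.
    move=> z _; have [Dz|nD] := pselect (D z); last first.
      rewrite cut_out//; under eq_fun do rewrite cut_out//; exact: cvg_cst.
    rewrite cutE//; under eq_fun do rewrite cutE//.
    apply/cvgrPdist_le => e e0; have [n0 hn] := hP z Dz e e0.
    exists n0 => // n nn; rewrite distrC; apply: le_trans (g1 _ _) _; exact: hn.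
  apply: ReIm_measurable.
  - by apply: cvg; [move=> z w; rewrite -cReN -cReD; exact: normr_Re_le|exact: measurable_complex_Re].
  - by apply: cvg; [move=> z w; rewrite -cImN -cImD; exact: normr_Im_le|exact: measurable_complex_Im].
apply/analytic_onP => c Dc; have [r r0 Hr] := unifh c Dc.
have [d1 d10 bD1] := open_ball_radius (ltr0n R 20) oD Dc.
(* The second bound keeps the reach [10 * d] of the kernel inside the disc of uniform
   convergence. *)
pose d := Num.min d1 (r / 20).
have d0 : 0 < d by rewrite lt_min d10 divr_gt0.
have [dd1 ddr] : d <= d1 /\ d <= r / 20 by split; rewrite /d ge_min lexx ?orbT.
have bD z : normc (z - c) <= 20 * d -> D z by move=> zc; apply: bD1; lra.
have [kap [K K0 [mk kK kin kout kf]]] := analytic_kernel d0 oD bD.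
have [n1 hn1] := Hr 1 ltr01.
have [_ an1] := (bergmanP _ oD).1 (hB n1).
have d10' : 0 < 10 * d by rewrite mulr_gt0.
have [M M0 HM] := @analytic_bounded _ D (hs n1) c (10 * d) d10' (fun z hz => bD z ltac:(lra)) an1.
have hM z : normc (z - c) <= 10 * d -> normc (h z) <= M + 1.
  move=> zc; have Dz : D z by apply: bD; lra.
  have := hn1 z ltac:(lra) Dz; have := HM z zc.
  have := normcD (h z - hs n1 z) (hs n1 z); rewrite subrK normc_distC; lra.
have kM z : normc (kap z * cut D h z) <= K * (M + 1).
  have [zc|zc] := leP (normc (z - c)) (10 * d).
    by apply: normcM_le => //; rewrite cutE; [exact: hM|apply: bD; lra].
  by rewrite kout// mul0r normc0 mulr_ge0 ?addr_ge0 ?ltW.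
have kmeas : measurable_fun setT (fun z => kap z * cut D h z) by exact: measurable_complexM.
have kout' g z : normc c + 10 * d < normc z -> kap z * cut D g z = 0.
  by move=> zc; rewrite kout ?mul0r//; have := normcD (z - c) c; rewrite subrK; lra.
have dh : 0 < d / 2 by rewrite divr_gt0.
have [||A1 [A2 [A3 [C C0 H]]]] := cauchy_integral_expansion dh kmeas kM (c := c) (rho := normc c + 10 * d).
- by move=> z /kin->; rewrite mul0r.
- exact: kout'.
pose S := square c (11 * d).
have mS : measurable S by exact: measurable_square.
have Soo : (area S < +oo)%E by rewrite area_square ?ltry// mulr_ge0// ltW.
(* Replacing [hs n] by [h] changes the value at [a] and the integral by multiples of the uniform
   distance; [Q] collects the two factors. *)
have hf a : normc (a - c) <= d / 4 -> h a = cint (fun z => kap z * cut D h z / (z - a)).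
  move=> ac; have Da : D a by apply: bD; lra.
  apply/eqP; rewrite -subr_eq0 -normc_le0; apply/ler_addgt0Pr => e e0; rewrite add0r.
  pose Q := 1 + 2 * (K * (4 / d)) * fine (area S).
  have Q0 : 0 < Q.
    by rewrite ltr_pwDl// !mulr_ge0 ?fine_ge0 ?invr_ge0// ltW.
  have eQ : 0 < e / Q by rewrite divr_gt0.
  have [n hn] := Hr _ eQ; have [_ an] := (bergmanP _ oD).1 (hB n).
  have fa := kf _ an a ltac:(lra).
  have mn : measurable_fun setT (fun z => kap z * (cut D (hs n) z - cut D h z) / (z - a)).
    apply: measurable_complexM; last by apply: measurable_complexV; exact: (measurable_shift (- a)).
    by apply: measurable_complexM => //; apply: measurable_complexB => //; exact: measurable_cut_analytic.
  have pos : 0 <= K * (e / Q) * (4 / d) :=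
    mulr_ge0 (mulr_ge0 (ltW K0) (ltW eQ)) (divr_ge0 (ler0n R 4) (ltW d0)).
  have [|||||_ hb] := @cint_bounded R (fun z => kap z * (cut D (hs n) z - cut D h z) / (z - a)) S
     (K * (e / Q) * (4 / d)).
  - exact: mn.
  - exact: mS.
  - exact: Soo.
  - move=> z _; have [zc|zc] := ltP (normc (z - c)) (d / 2).
      by rewrite kin// !mul0r normc0.
    have [zc'|zc'] := leP (normc (z - c)) (10 * d); last first.
      by rewrite kout// !mul0r normc0.
    have Dz : D z by apply: bD; lra.
    have za : d / 4 <= normc (z - a) by have := normc_distD z a c; lra.
    have dd4 : 0 < d / 4 by rewrite divr_gt0.
    apply: normcM_le; last by rewrite normcV -[leRHS]invrK invf_div lef_pV2 ?posrE//; lra.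
    by apply: normcM_le => //; rewrite !cutE//; apply: hn => //; lra.
  - move=> z zS; rewrite kout ?mul0r//.
    by rewrite ltNge; apply/negP => zc; apply: zS; apply: normc_lt_square; lra.
  have ic g M' : measurable_fun setT (cut D g) -> (forall z, normc (kap z * cut D g z) <= M') ->
      cintegrable (fun z => kap z * cut D g z / (z - a)).
    move=> mg gM; apply: (@cintegrable_cauchy _ (fun z => kap z * cut D g z) a M' (normc c + 10 * d)).
    - exact: measurable_complexM.
    - exact: gM.
    - exact: (kout' g).
  have i1 := ic h _ mh kM.
  have [M' M'0 HM'] := @analytic_bounded _ D (hs n) c (10 * d) d10' (fun z hz => bD z ltac:(lra)) an.
  have i2 : cintegrable (fun z => kap z * cut D (hs n) z / (z - a)).
    apply: (ic _ (K * M')); first exact: measurable_cut_analytic.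
    move=> z; have [zc|zc] := leP (normc (z - c)) (10 * d).
      by apply: normcM_le => //; rewrite cutE; [exact: HM'|apply: bD; lra].
    by rewrite kout// mul0r normc0 mulr_ge0// ltW.
  rewrite (_ : h a - _ = (h a - hs n a) + cint (fun z => kap z * (cut D (hs n) z - cut D h z) / (z - a))); last first.
    rewrite (@eq_cint _ (fun z => kap z * (cut D (hs n) z - cut D h z) / (z - a))
      (fun z => kap z * cut D (hs n) z / (z - a) - kap z * cut D h z / (z - a))); last by move=> z; ring.
    by rewrite cintB// -fa; ring.
  apply: le_trans (normcD _ _) _; rewrite normc_distC.
  have := hn a ltac:(lra) Da.
  have -> : e = e / Q * Q by rewrite divfK// gt_eqF.
  move: hb; rewrite mulfK ?gt_eqF//; set x := e / Q => hb hx; rewrite /Q.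
  rewrite (_ : 2 * (K * x * (4 / d)) * fine (area S) = x * (2 * (K * (4 / d)) * fine (area S))) in hb; last by ring.
  lra.
have d40 : 0 < d / 4 by rewrite divr_gt0.
have A1E : h c = A1.
  have h0 : normc (0 : R[i]) <= d / 2 / 2 by rewrite normc0; lra.
  have := H 0 h0; rewrite !addr0 normc0 !expr0n !mul0r !subr0 mulr0 -hf ?subrr ?normc0 ?(ltW d40)//.
  by rewrite normc_le0 subr_eq0 => /eqP.
exists A2 => e e0.
have B0 : 0 < normc A3 + C + 1 by have := normc_ge0 A3; lra.
exists (Num.min 1 (Num.min (d / 4) (e / (normc A3 + C + 1)))).
  by rewrite lt_min ltr01 lt_min d40 divr_gt0.
move=> t; rewrite lt_min => /andP[t1]; rewrite lt_min => /andP[t4]; rewrite ltr_pdivlMr// => te.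
have := H t ltac:(lra); rewrite -hf; last by rewrite addrC addKr; lra.
rewrite -A1E => Ht.
rewrite (_ : _ - A2 * t = (h (c + t) - h c - t * A2 - t ^+ 2 * A3) + t ^+ 2 * A3); last by ring.
apply: le_trans (normcD _ _) _; rewrite normcM normcX.
have n0 := normc_ge0 t; have a0 := normc_ge0 A3; set n := normc t in t1 t4 te Ht n0 *.
have p1 : C * n ^+ 3 <= C * n * n.
  by rewrite -mulrA ler_wpM2l// exprSr -expr2 ler_piMr// ?sqr_ge0// ltW.
have p2 : (normc A3 + C + 1) * n * n <= e * n.
  by rewrite ler_wpM2r//; rewrite mulrC; exact: ltW.
have p3 := mulr_ge0 n0 n0.
by rewrite expr2; nra.
Qed.

(** Nearest point by a minimising sequence: the parallelogram law makes it Cauchy, [bergman_limit]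
    gives an analytic pointwise limit, Fatou's lemma bounds its distance to [u], and a first
    variation gives orthogonality. *)
Theorem bergman_projection D u : open D -> sqint D u -> exists2 h, bergman D h &
  forall k, bergman D k -> inner D (fun z => u z - h z) k = 0.
Proof.
move=> oD su.
have B0 : bergman D (fun=> 0).
  apply/(bergmanP _ oD); split; last exact: analytic_cst.
  split.
    by rewrite (_ : cut D _ = fun=> 0)//; apply/funext => z; rewrite /cut; case: ifP.
  rewrite (_ : _ \o _ = cst 0%E); first exact: integrable0.
  by apply/funext => z /=; rewrite /cut; case: ifP => _; rewrite normc0 expr0n.
pose S := [set x | exists2 h, bergman D h & x = sqnorm D (fun z => u z - h z)].
have S0 : has_inf S.
  split; first by exists (sqnorm D (fun z => u z - 0)), (fun=> 0).
  by exists 0 => _ [h _ ->]; exact: sqnorm_ge0.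
pose d := inf S.
have dle h : bergman D h -> d <= sqnorm D (fun z => u z - h z).
  by move=> hB; apply: ge_inf; [case: S0|exists h].
have ex n : exists h, bergman D h /\ sqnorm D (fun z => u z - h z) < d + n.+1%:R^-1.
  have n0 : 0 < n.+1%:R^-1 :> R by rewrite invr_gt0.
  by have [_ [h hB ->] hd] := inf_adherent n0 S0; exists h.
pose hs n := sval (cid (ex n)).
have hsB n : bergman D (hs n) by exact: (svalP (cid (ex n))).1.
have hsd n : sqnorm D (fun z => u z - hs n z) < d + n.+1%:R^-1 by exact: (svalP (cid (ex n))).2.
have sh n : sqint D (hs n) by have /(bergmanP _ oD)[] := hsB n.
have small (e : R) : 0 < e -> exists n0, forall n, (n0 <= n)%N -> n.+1%:R^-1 <= e.
  move=> e0; exists (Num.bound e^-1) => n nn.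
  rewrite -[e]invrK lef_pV2 ?posrE ?invr_gt0//; apply: le_trans (ltW (archi_boundP _)) _.
    by rewrite invr_ge0 ltW.
  by rewrite ler_nat; exact: leqW.
have hC (e : R) : 0 < e -> exists n0, forall n m, (n0 <= n)%N -> (n0 <= m)%N ->
    sqnorm D (fun z => hs n z - hs m z) <= e.
  (* The midpoint is a competitor, so the parallelogram law bounds the squared distance by [2 * (d +
     e / 4) + 2 * (d + e / 4) - 4 * d = e]. *)
  move=> e0; have e4 : 0 < e / 4 by rewrite divr_gt0.
  have [n0 h0] := small _ e4; exists n0 => n m /h0 nn /h0 nm.
  have := parallelogram (sqintB su (sh m)) (sqintB su (sh n)).
  rewrite (eq_sqnorm D (f := fun z => u z - hs m z - (u z - hs n z)) (g := fun z => hs n z - hs m z)); last first.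
    by move=> z; ring.
  have hB2 := bergmanZ 2^-1 oD (bergmanD oD (hsB n) (hsB m)).
  have s2 : sqint D (fun z => u z - 2^-1 * (hs n z + hs m z)).
    by apply: sqintB => //; have /(bergmanP _ oD)[] := hB2.
  rewrite (eq_sqnorm D (f := fun z => u z - hs m z + (u z - hs n z)) (g := fun z => 2 * (u z - 2^-1 * (hs n z + hs m z)))); last first.
    by move=> z; field.
  rewrite sqnormZ// (_ : normc 2 = 2); last by rewrite -(rmorph_nat (real_complex R)) normc_real ger0_norm.
  rewrite (_ : 2 ^+ 2 = 4 :> R); last by ring.
  move=> par; have q1 := dle _ hB2.
  have q2 : sqnorm D (fun z => u z - hs n z) <= d + e / 4 by apply: le_trans (ltW (hsd n)) _; rewrite lerD2l.
  have q3 : sqnorm D (fun z => u z - hs m z) <= d + e / 4 by apply: le_trans (ltW (hsd m)) _; rewrite lerD2l.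
  by lra.
have [h ah hlim] := bergman_limit oD hsB hC.
pose F n z : R := normc (cut D (fun z => u z - hs n z) z) ^+ 2.
pose G z : R := normc (cut D (fun z => u z - h z) z) ^+ 2.
have [mu _] := su.
have mh : measurable_fun setT (cut D h) by exact: measurable_cut_analytic.
have muh : measurable_fun setT (cut D (fun z => u z - h z)).
  rewrite (_ : cut D _ = fun z => cut D u z - cut D h z); first exact: measurable_complexB.
  by apply/funext => z; rewrite /cut; case: ifP => // _; rewrite subrr.
have mF n : measurable_fun setT (fun z => (F n z)%:E).
  apply/measurable_EFinP; apply: measurable_funX; apply: measurable_normc.
  by have [] := sqintB su (sh n).
have F0 n z : setT z -> (0 <= (F n z)%:E)%E by rewrite lee_fin sqr_ge0.
have FG z : (fun n => (F n z)%:E) @ \oo --> (G z)%:E.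
  apply: cvg_EFin; first exact: nearW.
  rewrite /F /G; under eq_fun do rewrite expr2; rewrite expr2.
  suff cv : (fun n => normc (cut D (fun z => u z - hs n z) z)) @ \oo --> normc (cut D (fun z => u z - h z) z).
    exact (cvgM cv cv).
  have [Dz|nD] := pselect (D z); last first.
    by rewrite cut_out//; under eq_fun do rewrite cut_out//; exact: cvg_cst.
  rewrite cutE//; under eq_fun do rewrite cutE//.
  apply/cvgrPdist_le => e e0; have [n0 hn] := hlim z Dz e e0.
  exists n0 => // n nn; apply: le_trans (hn n nn).
  have := normcD (u z - h z - (u z - hs n z)) (u z - hs n z); rewrite subrK.
  have := normcB (u z - h z) (u z - h z - (u z - hs n z)).
  rewrite (_ : u z - h z - (u z - h z - (u z - hs n z)) = u z - hs n z); last by ring.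
  rewrite (_ : u z - h z - (u z - hs n z) = hs n z - h z); last by ring.
  by rewrite ler_norml => ? ?; apply/andP; split; lra.
have intF n : (\int[area]_z (F n z)%:E = (sqnorm D (fun z => u z - hs n z))%:E)%E.
  rewrite sqnormE /Rintegral fineK//; apply: integrable_fin_num => //.
  by have [] := sqintB su (sh n).
(* Fatou gives only an inequality, which is enough because [d] is the infimum. *)
have Gd : (\int[area]_z (G z)%:E <= d%:E)%E.
  have := fatou (@area R) measurableT mF F0.
  rewrite (eq_integral (fun z => (G z)%:E)); last first.
    by move=> z _; have [] := cvg_limn_einf_sup (FG z).
  move=> /le_trans; apply.
  under eq_fun do rewrite intF.
  have lo n : d <= sqnorm D (fun z => u z - hs n z) <= d + n.+1%:R^-1.
    by rewrite (dle _ (hsB n)) (ltW (hsd n)).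
  have cvR : (fun n => sqnorm D (fun z => u z - hs n z)) @ \oo --> d.
    apply: (@squeeze_cvgr _ _ _ _ (cst d) (fun n => d + n.+1%:R^-1)).
    - by apply: nearW => n; exact: lo.
    - exact: cvg_cst.
    - by rewrite -[X in _ --> X]addr0; apply: cvgD; [exact: cvg_cst|exact: cvg_harmonic].
  have cv : (fun n => (sqnorm D (fun z => u z - hs n z))%:E) @ \oo --> d%:E.
    by apply: cvg_EFin; [exact: nearW|exact: cvR].
  by have [-> _] := cvg_limn_einf_sup cv.
have suh : sqint D (fun z => u z - h z).
  split => //; apply/integrableP; split.
    by apply/measurable_EFinP; apply: measurable_funX; exact: measurable_normc.
  apply: le_lt_trans (ltry d); apply: le_trans Gd; rewrite le_eqVlt; apply/orP; left; apply/eqP.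
  by apply: eq_integral => z _ /=; rewrite ger0_norm// sqr_ge0.
have hB : bergman D h.
  apply/(bergmanP _ oD); split => //.
  (* Here [h] is recovered as [u - (u - h)], a difference of square integrable functions. *)
  have := sqintB su suh; congr sqint; apply/funext => z; ring.
have Nd : sqnorm D (fun z => u z - h z) <= d.
  rewrite -lee_fin sqnormE /Rintegral fineK//; apply: integrable_fin_num => //.
  by have [] := suh.
exists h => // k kB; have [sk _] := (bergmanP _ oD).1 kB.
set w := inner _ _ _.
have N0 := sqnorm_ge0 D k; have N1 : 0 < sqnorm D k + 1 by rewrite ltr_wpDl.
(* Moving [h] by [tau * w * k] changes the squared distance by [- 2 * tau * |w| ^ 2 + tau ^ 2 * |w|
   ^ 2 * sqnorm D k], which is at most [- tau * |w| ^ 2] for this [tau]; minimality forces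
   [w = 0]. *)
pose tau := (sqnorm D k + 1)^-1.
have tau0 : 0 < tau by rewrite invr_gt0.
have := dle _ (bergmanD oD hB (bergmanZ (tau%:C * w) oD kB)).
rewrite (eq_sqnorm D (f := fun z => u z - (h z + tau%:C * w * k z)) (g := fun z => (u z - h z) - (tau%:C * w) * k z)); last first.
  by move=> z; ring.
rewrite sqnorm_sub// -/w normcM normc_real (gtr0_norm tau0).
have -> : complex.Re (Num.conj (tau%:C * w) * w) = tau * normc w ^+ 2.
  by rewrite sqr_normc !ReImE /= ?ReImE; ring.
have tN : tau * sqnorm D k <= 1.
  by rewrite /tau mulrC ler_pdivrMr// mul1r lerDl.
have w0 := sqr_ge0 (normc w).
rewrite exprMn => H; apply: eq0_normc; apply/eqP; rewrite -sqrf_eq0 eq_le w0 andbT.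
have p1 : tau * (tau * sqnorm D k) * normc w ^+ 2 <= tau * normc w ^+ 2.
  by rewrite ler_wpM2r// ler_piMr// ltW.
have p2 : tau * normc w ^+ 2 <= 0 by rewrite expr2 in H; lra.
by move: p2; rewrite pmulr_rle0.
Qed.

(** By [bergman_projection] the set in [bergman_proj] is inhabited, so [xget] returns one of its
    elements and not the default. *)
Lemma toeplitz_spec D (phi f : R[i] -> R[i]) : open D -> sqint D (fun z => phi z * f z) ->
  bergman D (toeplitz D phi f) /\
  forall k, bergman D k -> inner D (fun z => phi z * f z - toeplitz D phi f z) k = 0.
Proof.
move=> oD sf; have [h hB hk] := bergman_projection oD sf.
have : exists h0, [set h0 | bergman D h0 /\ forall k, bergman D k ->
    inner D ((phi \* f) \- h0) k = 0] h0 by exists h.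
by move=> /(xgetPex (cst 0)) [].
Qed.

(** The difference of two candidates lies in the Bergman space and is orthogonal to it, hence to
    itself; [bergman_eq0] turns zero norm into zero values. *)
Lemma projection_unique D u h1 h2 : open D -> sqint D u -> bergman D h1 -> bergman D h2 ->
  (forall k, bergman D k -> inner D (fun z => u z - h1 z) k = 0) ->
  (forall k, bergman D k -> inner D (fun z => u z - h2 z) k = 0) ->
  forall z, D z -> h1 z = h2 z.
Proof.
move=> oD su B1 B2 o1 o2 z Dz; have B12 := bergmanB oD B1 B2.
have [s1 _] := (bergmanP _ oD).1 B1; have [s2 _] := (bergmanP _ oD).1 B2.
have [s12 _] := (bergmanP _ oD).1 B12.
have := innerBl (sqintB su s2) (sqintB su s1) s12.
rewrite (o1 _ B12) (o2 _ B12) subrr => e.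
apply/eqP; rewrite -subr_eq0; apply/eqP; apply: (bergman_eq0 oD B12) => //.
by rewrite -[RHS]e; congr inner; apply/funext => w; ring.
Qed.

End BergmanSpace.

(** * From commutation to the analyticity of the symbol *)

Section BoundedSymbols.
Context {R : realType}.
Implicit Types (z c a b : R[i]) (f g h k u v phi psi : R[i] -> R[i]) (D : set R[i]).

Lemma real_complexD (x y : R) : (x + y)%:C = x%:C + y%:C.
Proof. exact: (rmorphD (real_complex R)). Qed.

Lemma real_complexB (x y : R) : (x - y)%:C = x%:C - y%:C.
Proof. exact: (rmorphB (real_complex R)). Qed.

Lemma real_complexM (x y : R) : (x * y)%:C = x%:C * y%:C.
Proof. exact: (rmorphM (real_complex R)). Qed.

Lemma real_complexV (x : R) : (x^-1)%:C = (x%:C)^-1.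
Proof. exact: (fmorphV (real_complex R)). Qed.

Lemma cvg_const_eq0 (x : nat -> R) (y : R) : (forall n, x n = y) -> x @ \oo --> 0 -> y = 0.
Proof.
move=> xy x0; have xc : x @ \oo --> y by rewrite (_ : x = cst y); [exact: cvg_cst|exact/funext].
exact: (cvg_unique (@Rhausdorff R) xc x0).
Qed.

Lemma bounded_area D (M : R) : 0 < M -> measurable D -> (forall z, D z -> normc z <= M) ->
  (area D < +oo)%E.
Proof.
move=> M0 mD DM; apply: (@le_lt_trans _ _ (area (square 0 (M + 1)))).
  apply: le_measure; rewrite ?inE//; first exact: measurable_square.
  by move=> z Dz; apply: normc_lt_square; rewrite subr0; have := DM z Dz; lra.
by rewrite area_square ?ltry//; lra.
Qed.

Lemma normc_cut_le D f (M : R) : 0 <= M -> (forall z, D z -> normc (f z) <= M) ->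
  forall z, normc (cut D f z) <= M.
Proof.
move=> M0 fM z; have [Dz|nD] := pselect (D z); first by rewrite cutE//; exact: fM.
by rewrite cut_out// normc0.
Qed.

Lemma sqint_bounded D f (M : R) : measurable D -> (area D < +oo)%E -> measurable_fun D f ->
  0 <= M -> (forall z, D z -> normc (f z) <= M) -> sqint D f.
Proof.
move=> mD Doo mf M0 fM; have mc := measurable_cut_fun mD mf; split => //.
have [i _] := integrable_indic_bounded (M ^+ 2) mD Doo.
apply: le_integrable i => //.
  by apply/measurable_EFinP; apply: measurable_funX; exact: measurable_normc.
move=> z _ /=; rewrite lee_fin ger0_norm ?sqr_ge0//; apply: le_trans (ler_norm _).
have [Dz|nD] := pselect (D z).
  rewrite cutE// indicE mem_set// mulr1; have := fM z Dz; have := normc_ge0 (f z).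
  by nra.
by rewrite cut_out// normc0 expr0n mulr_ge0// ?sqr_ge0// indicE ler0n.
Qed.

Lemma sqintM D f g (M : R) : measurable_fun setT (cut D f) -> 0 <= M ->
  (forall z, D z -> normc (f z) <= M) -> sqint D g -> sqint D (fun z => f z * g z).
Proof.
move=> mf M0 fM [mg jg].
have m : measurable_fun setT (cut D (fun z => f z * g z)).
  rewrite (_ : cut D _ = fun z => cut D f z * cut D g z); first exact: measurable_complexM.
  by apply/funext => z; rewrite cutM.
split => //.
have i := integrableZl measurableT (M ^+ 2) jg.
apply: le_integrable i => //.
  by apply/measurable_EFinP; apply: measurable_funX; exact: measurable_normc.
move=> z _ /=; rewrite lee_fin ger0_norm ?sqr_ge0//; apply: le_trans (ler_norm _).
rewrite cutM normcM exprMn ler_wpM2r ?sqr_ge0//.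
by have := normc_cut_le M0 fM z; have := normc_ge0 (cut D f z); nra.
Qed.

Lemma inner0 D k : inner D (fun=> 0) k = 0.
Proof.
rewrite innerE -[RHS](@cint0 R); apply: eq_cint => z.
by rewrite /cut; case: ifP; rewrite mul0r.
Qed.

(* Commutation forces [T_psi (phi ^ n) = phi ^ n * T_psi 1]. *)
Lemma toeplitz_powers D phi psi (M : R) : open D -> (area D < +oo)%E -> 0 <= M ->
  analytic_on D phi -> (forall z, D z -> normc (phi z) <= M) ->
  measurable_fun D psi -> (forall z, D z -> normc (psi z) <= M) ->
  (forall f, bergman D f -> forall z, D z ->
     toeplitz D phi (toeplitz D psi f) z = toeplitz D psi (toeplitz D phi f) z) ->
  exists2 g, bergman D g & forall n k, bergman D k ->
    inner D (fun z => phi z ^+ n * (psi z - g z)) k = 0.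
Proof.
move=> oD Doo M0 aphi phiM mpsi psiM comm.
have mD := open_complex_measurable oD.
have mphi := measurable_cut_analytic oD aphi.
have mpsi' := measurable_cut_fun mD mpsi.
have Bphi f : bergman D f -> bergman D (fun z => phi z * f z).
  move=> /(bergmanP _ oD)[sf af]; apply/(bergmanP _ oD).
  by split; [exact: sqintM phiM sf|exact: analyticM].
have B1 : bergman D (fun=> 1).
  apply/(bergmanP _ oD); split; last exact: analytic_cst.
  apply: (@sqint_bounded _ _ 1) => // z _; exact: normc1_le1.
have Bpow n : bergman D (fun z => phi z ^+ n).
  elim: n => [|n IH]; first by rewrite (_ : (fun z => _) = fun=> 1).
  rewrite (_ : (fun z => _) = fun z => phi z * phi z ^+ n); first exact: Bphi.
  by apply/funext => z; rewrite exprS.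
have Spsi f : bergman D f -> sqint D (fun z => psi z * f z).
  by move=> /(bergmanP _ oD)[sf _]; exact: sqintM psiM sf.
have Sphi f : bergman D f -> sqint D (fun z => phi z * f z).
  by move=> /Bphi /(bergmanP _ oD)[].
(* Multiplication by [phi] preserves the Bergman space, so the projection leaves the product
   unchanged on [D]. *)
have Tphi f : bergman D f -> forall z, D z -> toeplitz D phi f z = phi z * f z.
  move=> fB; have [tB tO] := toeplitz_spec oD (Sphi _ fB).
  apply: (projection_unique oD (Sphi _ fB) tB (Bphi _ fB) tO) => k kB.
  by rewrite -[RHS](inner0 D k); apply: eq_inner => z _; rewrite subrr.
have Tpsi f (fB : bergman D f) := toeplitz_spec oD (Spsi f fB).
pose g := toeplitz D psi (fun=> 1).
have gB : bergman D g by exact: (Tpsi _ B1).1.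
have Tn n : forall z, D z -> toeplitz D psi (fun z => phi z ^+ n) z = phi z ^+ n * g z.
  elim: n => [|n IH] z Dz.
    by rewrite expr0 mul1r /g; congr (toeplitz D psi _ z).
  have [t1 _] := Tpsi _ (Bpow n).
  have c := comm _ (Bpow n) z Dz; rewrite (Tphi _ t1 z Dz) (IH z Dz) in c.
  rewrite exprS -mulrA c.
  have [b2 o2] := Tpsi _ (Bpow n.+1).
  have tB := (toeplitz_spec oD (Sphi _ (Bpow n))).1.
  have [b3 o3] := Tpsi _ tB.
  (* [toeplitz D phi] applied to [phi ^ n] is known to agree with [phi ^ (n + 1)] on [D] only, not
     as a function on the plane, so their images under [toeplitz D psi] are compared through
     uniqueness of the projection. *)
  have o4 k : bergman D k -> inner D (fun w => psi w * phi w ^+ n.+1 -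
      toeplitz D psi (toeplitz D phi (fun w => phi w ^+ n)) w) k = 0.
    move=> kB; apply: etrans (o3 k kB); apply: eq_inner => w Dw.
    by rewrite (Tphi _ (Bpow n) w Dw) exprS.
  exact (projection_unique oD (Spsi _ (Bpow n.+1)) b2 b3 o2 o4 Dz).
exists g => // n k kB; have [_ o] := Tpsi _ (Bpow n).
rewrite -[RHS](o k kB); apply: eq_inner => z Dz; rewrite Tn//; ring.
Qed.

Lemma cintegrableM_bounded v k (B : R) : cintegrable v -> measurable_fun setT k ->
  (forall z, normc (k z) <= B) -> cintegrable (fun z => v z * k z).
Proof.
move=> iv mk kB; have B0 : 0 <= B := le_trans (normc_ge0 _) (kB 0).
apply: (cintegrable_dom _ (cintegrableZ B%:C iv)).
  by apply: measurable_complexM => //; exact: cintegrable_measurable.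
move=> z; rewrite !normcM normc_real (ger0_norm B0) mulrC.
by rewrite ler_wpM2r ?normc_ge0.
Qed.

(* With [t = |phi - phi a| ^ 2 / K] in [0, 1], the functions
   [(1 - (1 - t) ^ n) / (z - a)] are polynomials in [phi] and its conjugate
   times the analytic function [(phi - phi a) / (z - a)], and they
   converge to [1 / (z - a)] off the level set of [a]. *)
Lemma cauchy_transform_eq0 D phi v (M : R) a : domain D -> 0 < M ->
  analytic_on D phi -> (forall z, D z -> normc (phi z) <= M) ->
  (exists z1 z2, [/\ D z1, D z2 & phi z1 <> phi z2]) ->
  cintegrable v -> (forall z, ~ D z -> v z = 0) ->
  (forall n k (B : R), analytic_on D k -> (forall z, D z -> normc (k z) <= B) ->
     cint (fun z => v z * Num.conj (cut D phi z) ^+ n * cut D k z) = 0) ->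
  D a -> cintegrable (fun z => v z / (z - a)) -> cint (fun z => v z / (z - a)) = 0.
Proof.
move=> dD M0 aphi phiM nonc iv v0 ortho Da iva.
have [oD _ _] := dD; have mv := cintegrable_measurable iv.
set P := cut D phi; set b := phi a.
have mP : measurable_fun setT P by exact: measurable_cut_analytic.
have PM z : normc (P z) <= M by exact: normc_cut_le (ltW M0) phiM z.
have bM : normc b <= M by exact: phiM.
have [A aq] := quot_analytic oD Da aphi.
have [d d0 bD] := open_ball_radius (ltr0n R 2) oD Da.
have [M1 M10 HM1] := analytic_bounded d0 bD aq.
have qM z : D z -> normc (quot phi a A z) <= M1 + 2 * M / d.
  move=> Dz; have p0 : 0 <= 2 * M / d by rewrite !mulr_ge0 ?invr_ge0// ltW.
  have [zd|zd] := leP (normc (z - a)) d; first by have := HM1 z zd; lra.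
  rewrite /quot; case: eqP => [e|_]; first by move: zd; rewrite e subrr normc0; lra.
  have : normc ((phi z - phi a) / (z - a)) <= 2 * M * d^-1.
    apply: normcM_le.
      by apply: le_trans (normcB _ _) _; have := phiM z Dz; have := phiM a Da; lra.
    by rewrite normcV lef_pV2 ?posrE//; lra.
  by lra.
set f := cut D (quot phi a A).
have mf : measurable_fun setT f by exact: measurable_cut_analytic.
pose cP z := Num.conj (P z).
have mcP : measurable_fun setT cP by exact: measurable_complexJ.
have cPM z : normc (cP z) <= M by rewrite /cP normc_conj.
(* Bounded functions annihilated by [v] together with all their multiples by powers of [P] and [cP].
   The exponents belong to the property so that multiplication by [P] or [cP] is an index shift. *)
pose Q k := [/\ measurable_fun setT k, exists B : R, forall z, normc (k z) <= B &
  forall n j, cint (fun z => v z * (cP z ^+ n * P z ^+ j * k z)) = 0].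
have powM (k : R[i] -> R[i]) n z : normc (k z) <= M -> normc (k z ^+ n) <= M ^+ n.
  by move=> kM; rewrite normcX lerXn2r ?nnegrE ?normc_ge0// ltW.
have iQ k n j : Q k -> cintegrable (fun z => v z * (cP z ^+ n * P z ^+ j * k z)).
  move=> [mk [B kB] _]; apply: (@cintegrableM_bounded _ _ (M ^+ n * M ^+ j * B)) => //.
    by apply: measurable_complexM => //; apply: measurable_complexM; exact: measurable_complexX.
  by move=> z; apply: normcM_le => //; apply: normcM_le; exact: powM.
have Qf : Q f.
  split => //; first by exists (M1 + 2 * M / d); apply: normc_cut_le => //;
    rewrite addr_ge0 ?(ltW M10)// !mulr_ge0 ?invr_ge0// ltW.
  move=> n j; have aX : analytic_on D (fun z => phi z ^+ j) by exact: analyticX.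
  rewrite -[RHS](ortho n (fun z => phi z ^+ j * quot phi a A z) (M ^+ j * (M1 + 2 * M / d))).
  - apply: eq_cint => z; rewrite /cP /f /P.
    have [Dz|nD] := pselect (D z); first by rewrite !cutE//; ring.
    by rewrite (v0 z nD) !mul0r.
  - exact: (analyticM aX aq).
  - by move=> z Dz; apply: normcM_le; [apply: powM; exact: phiM|exact: qM].
have QP k : Q k -> Q (fun z => P z * k z).
  move=> [mk [B kB] Hk]; split; [exact: measurable_complexM| |].
    by exists (M * B) => z; exact: normcM_le.
  by move=> n j; rewrite -[RHS](Hk n j.+1); apply: eq_cint => z; rewrite exprS; ring.
have QcP k : Q k -> Q (fun z => cP z * k z).
  move=> [mk [B kB] Hk]; split; [exact: measurable_complexM| |].
    by exists (M * B) => z; exact: normcM_le.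
  by move=> n j; rewrite -[RHS](Hk n.+1 j); apply: eq_cint => z; rewrite exprS; ring.
have QZ (e : R[i]) k : Q k -> Q (fun z => e * k z).
  move=> Qk; have [mk [B kB] Hk] := Qk; split; [exact: measurable_complexM| |].
    by exists (normc e * B) => z; exact: normcM_le.
  move=> n j; rewrite -[RHS](mulr0 e) -(Hk n j) -cintZ; last exact: iQ.
  by apply: eq_cint => z; ring.
have QD k l : Q k -> Q l -> Q (fun z => k z + l z).
  move=> Qk Ql; have [mk [B kB] Hk] := Qk; have [ml [C lC] Hl] := Ql.
  split; [exact: measurable_complexD| |].
    by exists (B + C) => z; apply: le_trans (normcD _ _) _; exact: lerD.
  move=> n j; rewrite -[RHS](addr0 0) -{1}(Hk n j) -(Hl n j) -cintD; [|exact: iQ|exact: iQ].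
  by apply: eq_cint => z; ring.
have Qeq k l : (forall z, k z = l z) -> Q k -> Q l by move=> /funext->.
have Q0 : Q (fun=> 0) by apply: Qeq (QZ 0 f Qf) => z; rewrite mul0r.
(* As [normc (P z - b) <= 2 * M], division by [K] brings [t] into [[0, 1]]. *)
pose K : R := 4 * M ^+ 2 + 1.
have K0 : 0 < K by rewrite ltr_wpDl// mulr_ge0// sqr_ge0.
pose cb : R[i] := Num.conj b; pose iK : R[i] := K^-1%:C.
pose t z : R[i] := iK * ((cP z - cb) * (P z - b)).
pose tr z : R := K^-1 * normc (P z - b) ^+ 2.
have tE z : t z = (tr z)%:C.
  by rewrite /tr real_complexM -mulcJ rmorphB /t [(cP z - cb) * _]mulrC.
have tr0 z : 0 <= tr z by rewrite mulr_ge0 ?sqr_ge0// invr_ge0 ltW.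
have tr1 z : tr z <= 1.
  rewrite /tr mulrC ler_pdivrMr// mul1r.
  have h1 : normc (P z - b) <= 2 * M by apply: le_trans (normcB _ _) _; have := PM z; lra.
  by have := normc_ge0 (P z - b); rewrite /K; nra.
have Qt k : Q k -> Q (fun z => iK * (cP z - cb) * k z).
  move=> Qk; apply: Qeq (QD _ _ (QZ iK _ (QcP _ Qk)) (QZ (- (iK * cb)) _ Qk)) => z; ring.
have Qs k : Q k -> Q (fun z => (1 - t z) * k z).
  move=> Qk; have Q1 := Qt _ (QD _ _ (QP _ Qk) (QZ (- b) _ Qk)).
  apply: Qeq (QD _ _ Qk (QZ (-1) _ Q1)) => z; rewrite /t; ring.
have Qn n : Q (fun z => (1 - t z) ^+ n * f z).
  elim: n => [|n IH]; first by apply: Qeq Qf => z; rewrite expr0 mul1r.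
  by apply: Qeq (Qs _ IH) => z; rewrite exprS mulrA.
(* Induction on [1 - (1 - t) ^ (n + 1) = (1 - (1 - t) ^ n) + t * (1 - t) ^ n]: the factor [P - b] of
   [t], divided by [z - a], is [f], so the new term stays in [Q]. The exceptional point [z = a] is a
   null set. *)
have HH n : exists2 H, Q H & forall z, D z -> z != a -> H z = (1 - (1 - t z) ^+ n) / (z - a).
  elim: n => [|n [H QH HE]].
    by exists (fun=> 0) => // z _ _; rewrite expr0 subrr mul0r.
  exists (fun z => H z + iK * (cP z - cb) * ((1 - t z) ^+ n * f z)).
    by apply: QD => //; apply: Qt; exact: Qn.
  move=> z Dz za; have za0 : z - a != 0 by rewrite subr_eq0.
  rewrite HE// /f cutE// /quot (negbTE za) -/b.
  have -> : phi z = P z by rewrite /P cutE.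
  rewrite exprS.
  have -> : iK * (cP z - cb) * ((1 - t z) ^+ n * ((P z - b) / (z - a))) =
    t z * (1 - t z) ^+ n / (z - a) by rewrite /t; ring.
  by ring.
pose s n z : R := 1 - (1 - tr z) ^+ n.
have sE n z : 1 - (1 - t z) ^+ n = (s n z)%:C.
  by rewrite tE /s rmorphB rmorphXn rmorphB rmorph1.
have pow01 n z : 0 <= (1 - tr z) ^+ n <= 1.
  have h : 0 <= 1 - tr z by rewrite subr_ge0.
  by rewrite exprn_ge0//= exprn_ile1// lerBlDr lerDl.
have ae1 : {ae area, forall z, z <> a}.
  by apply: negligibleS (negligible_singleton a) => z /= /contrapT.
have Fz n : cint (fun z => (s n z)%:C * (v z / (z - a))) = 0.
  have [H QH HE] := HH n; have i0 := iQ _ 0 0 QH; have [_ _ H0] := QH.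
  have mt : measurable_fun setT (fun z => (s n z)%:C * (v z / (z - a))).
    apply: measurable_complexM; last exact: cintegrable_measurable iva.
    rewrite (_ : (fun z => _) = fun z => 1 - (1 - t z) ^+ n); last by apply/funext => z; rewrite sE.
    apply: measurable_complexB => //; apply: measurable_complexX; apply: measurable_complexB => //.
    apply: measurable_complexM => //; apply: measurable_complexM; exact: measurable_complexB.
  have e0 : {ae area, forall z, v z * (cP z ^+ 0 * P z ^+ 0 * H z) = (s n z)%:C * (v z / (z - a))}.
    apply: filterS ae1 => z /eqP za.
    have [Dz|nD] := pselect (D z); last by rewrite (v0 z nD) !mul0r mulr0.
    by rewrite HE// sE !expr0; ring.
  by have [_ <-] := cint_ae i0 mt e0; exact: (H0 0%N 0%N).
have lim := @cint_dominated R (fun n z => (s n z)%:C * (v z / (z - a)))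
  (fun z => v z / (z - a)) (fun z => normc (v z / (z - a))).
have mva := cintegrable_measurable iva.
have cv : (fun n => normc (cint (fun z => (s n z)%:C * (v z / (z - a))) -
    cint (fun z => v z / (z - a)))) @ \oo --> 0.
  apply: lim => //.
  - move=> n; apply: measurable_complexM => //.
    rewrite (_ : (fun z => _) = fun z => 1 - (1 - t z) ^+ n); last by apply/funext => z; rewrite sE.
    apply: measurable_complexB => //; apply: measurable_complexX; apply: measurable_complexB => //.
    apply: measurable_complexM => //; apply: measurable_complexM; exact: measurable_complexB.
  - move=> n z; rewrite normcM normc_real ler_piMl ?normc_ge0//.
    have /andP[p0 p1] := pow01 n z; rewrite /s ger0_norm; lra.
  - exact: cintegrable_normc.
  (* Off the level set of [b] one has [0 < tr z <= 1], hence [(1 - tr z) ^ n] tends to [0]. *)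
  - apply: negligibleS (level_set_negligible b dD aphi nonc) => z /= H.
    apply: contrapT => nz; apply: H.
    have [Dz|nD] := pselect (D z); last first.
      under eq_fun do rewrite (v0 z nD) mul0r mulr0 subrr normc0; exact: cvg_cst.
    have trp : 0 < tr z.
      rewrite mulr_gt0 ?invr_gt0// exprn_gt0// normc_gt0 subr_eq0 /P cutE//.
      by apply/eqP => e; apply: nz.
    rewrite (_ : (fun n => _) = fun n => normc (v z / (z - a)) * (1 - tr z) ^+ n); last first.
      apply/funext => n; have /andP[p0 _] := pow01 n z.
      rewrite (_ : (s n z)%:C * _ - _ = - ((1 - tr z) ^+ n)%:C * (v z / (z - a))); last first.
        by rewrite /s rmorphB rmorph1; ring.
      by rewrite normcM normcN normc_real ger0_norm// mulrC.
    rewrite -[X in _ --> X](mulr0 (normc (v z / (z - a)))).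
    apply: cvgM; first exact: cvg_cst.
    by apply: cvg_expr; rewrite ger0_norm; have := tr1 z; lra.
apply: eq0_normc; apply: (cvg_const_eq0 _ cv) => n.
by rewrite Fz sub0r normcN.
Qed.

Lemma integral_Re f : cintegrable f ->
  (\int[area]_z (complex.Re (f z))%:E = (complex.Re (cint f))%:E)%E.
Proof.
by move=> [iR _]; rewrite /cint /= /Rintegral fineK//; exact: integrable_fin_num iR.
Qed.

Lemma inv_normc_opp (B : R) z : inv_normc B (- z) = inv_normc B z.
Proof.
rewrite /inv_normc normcN !indicE; congr (_ * _%:R); congr (nat_of_bool _).
apply/idP/idP => /set_mem h; apply/mem_set; move: h; case: z => x y;
  rewrite /square /rect /= !sub0r !add0r => -[/andP[? ?] /andP[? ?]];
  by split; apply/andP; split; lra.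
Qed.

(** Fubini for [E a * v z / (z - a)]. Integrated first in [z] it vanishes, since the Cauchy
    transform of [v] is [0] on [D] and [E] is [0] off [D]; integrated first in [a] it gives
    [- kappa0 * v z * s z] by Cauchy-Pompeiu. Real parts are taken because Fubini is applied to a
    real function. *)
Lemma cauchy_test_Re D v s E (rho M : R) : 0 < rho -> 0 < M ->
  cintegrable v -> (forall z, M < normc z -> v z = 0) ->
  dbar_pair s E -> (forall z, rho < normc z -> s z = 0) -> (forall z, ~ D z -> E z = 0) ->
  (forall a, D a -> cintegrable (fun z => v z / (z - a)) -> cint (fun z => v z / (z - a)) = 0) ->
  complex.Re (kappa0 * cint (fun z => v z * s z)) = 0.
Proof.
move=> rho0 M0 iv vM sE sout ED cau.
have [ms mE] := dbar_pair_measurable sE; have mv := cintegrable_measurable iv.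
have Eout := dbar_support sE sout; have [ME ME0 HE] := dbar_bounded rho sE.
have [Ms Ms0 Hs] := dbar_bounded rho sE.
have EM z : normc (E z) <= ME.
  by have [/HE[]//|/Eout->] := leP (normc z) rho; rewrite normc0 ltW.
have sM z : normc (s z) <= Ms.
  by have [/Hs[]//|/sout->] := leP (normc z) rho; rewrite normc0 ltW.
pose B := M + rho + 1; have B0 : 0 < B by rewrite /B; lra.
pose F (p : R[i] * R[i]) : R[i] := E p.2 * v p.1 / (p.1 - p.2).
pose Psi (p : R[i] * R[i]) : R := normc (v p.1) * inv_normc B (p.1 - p.2).
have m1 : measurable_fun setT (fun p : R[i] * R[i] => v p.1) by exact: measurableT_comp mv measurable_fst.
have m2 : measurable_fun setT (fun p : R[i] * R[i] => E p.2) by exact: measurableT_comp mE measurable_snd.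
have m12 : measurable_fun setT (fun p : R[i] * R[i] => p.1 - p.2).
  by apply: measurable_complexB; [exact: measurable_fst|exact: measurable_snd].
have mF : measurable_fun setT F.
  by apply: measurable_complexM; [exact: measurable_complexM|exact: measurable_complexV].
have mPsi : measurable_fun setT Psi.
  apply: measurable_funM; first exact: measurable_normc.
  exact: measurableT_comp (measurable_inv_normc_square B) m12.
have Psi0 p : 0 <= Psi p by rewrite mulr_ge0 ?normc_ge0// inv_normc_ge0.
pose C := \int[area]_w inv_normc B w.
have CE : (\int[area]_w (inv_normc B w)%:E = C%:E)%E.
  by rewrite /C /Rintegral fineK//; exact: integrable_fin_num (integrable_inv_normc B0).
have C0 : 0 <= C by rewrite -lee_fin -CE; apply: integral_ge0 => w _; rewrite lee_fin inv_normc_ge0.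
(* Tonelli: [inv_normc B] is even and area is translation invariant, so the inner integral is the
   constant [C] times [normc (v x)]. *)
have iPsi : ((@area R) \x (@area R))%E.-integrable setT (EFin \o Psi).
  apply/integrable12ltyP; first exact/measurable_EFinP.
  rewrite (eq_integral (fun x => (C * normc (v x))%:E)); last first.
    move=> x _; transitivity (\int[area]_y ((normc (v x))%:E * (inv_normc B (y + - x)%R)%:E))%E.
      apply: eq_integral => y _ /=; rewrite ger0_norm ?Psi0// /Psi /= EFinM.
      by rewrite -(inv_normc_opp B (x - y)) opprB.
    rewrite ge0_integralZl_EFin//; first 1 last.
    - by move=> y _; rewrite lee_fin inv_normc_ge0.
    - apply/measurable_EFinP.
      exact: measurableT_comp (measurable_inv_normc_square B) (measurable_shift (- x)).
    - exact: normc_ge0.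
    rewrite (@ge0_integral_shift _ (- x) (EFin \o inv_normc B)).
    - by rewrite CE -EFinM mulrC.
    - apply/measurable_EFinP; exact: measurable_inv_normc_square.
    - by move=> y; rewrite lee_fin inv_normc_ge0.
  have /integrableP[_] := integrableZl measurableT C (cintegrable_normc iv).
  apply: le_lt_trans; rewrite le_eqVlt; apply/orP; left; apply/eqP.
  by apply: eq_integral => x _ /=; rewrite ger0_norm// mulr_ge0// normc_ge0.
have bnd z a : normc a <= rho -> normc (v z / (z - a)) <= Psi (z, a).
  move=> ar; rewrite /Psi /=; have [zM|zM] := leP (normc z) M; last first.
    by rewrite (vM z zM) mul0r normc0 mul0r.
  rewrite normcM normcV /inv_normc indicE mem_set ?mulr1//.
  by apply: normc_lt_square; rewrite subr0; have := normcB z a; rewrite /B; lra.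
have FE z a : F (z, a) = E a * (v z / (z - a)) by rewrite /F /= mulrA.
have FM p : normc (F p) <= ME * Psi p.
  case: p => z a; rewrite FE; have [ar|ar] := leP (normc a) rho.
    by apply: normcM_le => //; exact: bnd.
  by rewrite (Eout a ar) mul0r normc0 mulr_ge0// ?Psi0// ltW.
have iF : ((@area R) \x (@area R))%E.-integrable setT (EFin \o (@complex.Re R \o F)).
  have i := integrableZl measurableT ME iPsi.
  apply: le_integrable i => //.
    by apply/measurable_EFinP; have [] := measurable_ReIm mF.
  move=> p _ /=; rewrite lee_fin; apply: le_trans (normr_Re_le _) _.
  by apply: le_trans (FM p) (ler_norm _).
have fub := Fubini iF.
have R0 : (\int[area]_a \int[area]_z (complex.Re (F (z, a)))%:E = 0)%E.
  rewrite -[RHS](@integral0 _ _ R (@area R) setT).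
  apply: ae_eq_integral; [exact: measurableT|exact: (measurable_fubini_G iF)|exact: measurable_cst|].
  (* The transform at [a] is known to vanish only when it converges absolutely, which the
     integrability of [Psi] ensures for almost every [a]. *)
  apply: filterS (ae_integrable2 iPsi) => a ia _.
  have [Ea|Ea] := eqVneq (E a) 0.
    by apply: integral0_eq => z _; rewrite FE Ea mul0r.
  have Da : D a by apply: contrapT => /ED h; rewrite h eqxx in Ea.
  have ar : normc a <= rho by rewrite leNgt; apply/negP => /Eout h; rewrite h eqxx in Ea.
  have iva : cintegrable (fun z => v z / (z - a)).
    apply: (@cintegrable_le _ _ (fun z => Psi (z, a))); last exact: ia.
    - exact: measurable_complexM mv (measurable_complexV (measurable_shift (- a))).
    - by move=> z; exact: bnd.
  rewrite (eq_integral (fun z => (complex.Re (E a * (v z / (z - a))))%:E)); last by move=> z _; rewrite FE.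
  by rewrite (integral_Re (cintegrableZ (E a) iva)) cintZ// (cau a Da iva) mulr0.
have ivs : cintegrable (fun z => v z * s z) by exact: cintegrableM_bounded sM.
(* The minus sign comes from [1 / (z - a) = - (1 / (a - z))]: in the inner integral [z] is the
   pole. *)
have L0 : (\int[area]_z \int[area]_a (complex.Re (F (z, a)))%:E =
    (complex.Re (- kappa0 * cint (fun z => v z * s z)))%:E)%E.
  rewrite -(cintZ (- kappa0) ivs).
  apply: (etrans _ (integral_Re (cintegrableZ (- kappa0) ivs))).
  apply: eq_integral => z _.
  have ic : cintegrable (fun a => E a / (a - z)) by exact: (cintegrable_cauchy z mE EM Eout).
  rewrite (eq_integral (fun a => (complex.Re (- v z * (E a / (a - z))))%:E)).
    rewrite (integral_Re (cintegrableZ (- v z) ic)) cintZ// (cauchy_pompeiu_dbar z sE sout).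
    by congr (_ _)%:E; ring.
  by move=> a _; rewrite FE -(opprB a z) invrN; congr (complex.Re _)%:E; ring.
move: fub; rewrite /fubini_F /fubini_G /= => fub.
have : (complex.Re (- kappa0 * cint (fun z => v z * s z)))%:E = 0%E :> \bar R.
  by rewrite -L0 -R0 fub.
by move/eqP; rewrite eqe mulNr cReN oppr_eq0 => /eqP.
Qed.

(** The statement on real parts, for [v] and for [j * v] with [j] the imaginary unit, gives the
    complex one; [kappa0] is then cancelled. *)
Lemma cauchy_test D v s E (rho M : R) : 0 < rho -> 0 < M ->
  cintegrable v -> (forall z, M < normc z -> v z = 0) ->
  dbar_pair s E -> (forall z, rho < normc z -> s z = 0) -> (forall z, ~ D z -> E z = 0) ->
  (forall a, D a -> cintegrable (fun z => v z / (z - a)) -> cint (fun z => v z / (z - a)) = 0) ->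
  cint (fun z => v z * s z) = 0.
Proof.
move=> rho0 M0 iv vM sE sout ED cau.
have [ms mE] := dbar_pair_measurable sE.
have [Ms Ms0 Hs] := dbar_bounded rho sE.
have sM z : normc (s z) <= Ms.
  by have [/Hs[]//|/sout->] := leP (normc z) rho; rewrite normc0 ltW.
have ivs : cintegrable (fun z => v z * s z) by exact: cintegrableM_bounded sM.
pose j : R[i] := complex.Complex 0 1.
have j2 : (- j) * j = 1 by apply: eq_ReIm => /=; ring.
have h1 := cauchy_test_Re rho0 M0 iv vM sE sout ED cau.
have h2 : complex.Re (kappa0 * cint (fun z => j * v z * s z)) = 0.
  apply: (cauchy_test_Re rho0 M0 (cintegrableZ j iv) _ sE sout ED).
    by move=> z /vM->; rewrite mulr0.
  move=> a Da ia.
  have ia' : cintegrable (fun z => v z / (z - a)).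
    have := cintegrableZ (- j) ia; congr cintegrable; apply/funext => z.
    by rewrite !mulrA j2 mul1r.
  rewrite -[RHS](mulr0 j) -(cau a Da ia') -cintZ//.
  by apply: eq_cint => z; rewrite mulrA.
rewrite (@eq_cint _ _ (fun z => j * (v z * s z))) in h2; last by move=> z; rewrite mulrA.
rewrite cintZ// mulrCA in h2.
have : kappa0 * cint (fun z => v z * s z) = 0.
  apply: eq_ReIm; rewrite ?h1//; move: h2; rewrite cReM /= mul0r sub0r mul1r.
  by move=> /eqP; rewrite oppr_eq0 => /eqP.
by move=> /eqP; rewrite mulf_eq0 (negbTE kappa0_neq0) => /eqP.
Qed.

Lemma rect_bounded (p q r t : R) z : rect p q r t z ->
  normc z <= `|p| + `|q| + `|r| + `|t|.
Proof.
move=> [/andP[h1 h2] /andP[h3 h4]]; apply: le_trans (normc_le_ReIm z) _.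
have := ler_norm p; have := ler_norm (- p); have := ler_norm q; have := ler_norm (- q).
have := ler_norm r; have := ler_norm (- r); have := ler_norm t; have := ler_norm (- t).
rewrite !normrN => *.
have : `|complex.Re z| <= `|p| + `|q| by rewrite ler_norml; apply/andP; split; lra.
have : `|complex.Im z| <= `|r| + `|t| by rewrite ler_norml; apply/andP; split; lra.
lra.
Qed.

(** With [beta] a product of squared positive parts, positive exactly on the rectangle,
    [N * beta / (1 + N * beta)] is a test function with values in [[0, 1]] that tends to the
    indicator; its denominator is at least [1], as [dbarV] wants a positive lower bound. *)
Lemma cint_rect D v (p q r t : R) : cintegrable v ->
  (forall s E (rho : R), 0 < rho -> dbar_pair s E -> (forall z, rho < normc z -> s z = 0) ->
     (forall z, ~ D z -> E z = 0) -> cint (fun z => v z * s z) = 0) ->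
  rect p q r t `<=` D -> cint (fun z => v z * (\1_(rect p q r t) z)%:C) = 0.
Proof.
move=> iv test sub; have mv := cintegrable_measurable iv.
pose x1 z := pospart (1 * complex.Re z + - p); pose x2 z := pospart (-1 * complex.Re z + q).
pose x3 z := pospart (1 * complex.Im z + - r); pose x4 z := pospart (-1 * complex.Im z + t).
have px (x : R) : x <= 0 -> pospart x = 0 by move=> h; rewrite /pospart max_r.
have py (x : R) : 0 < x -> 0 < pospart x by move=> h; rewrite /pospart max_l// ltW.
have xout z : ~ rect p q r t z -> [\/ x1 z = 0, x2 z = 0, x3 z = 0 | x4 z = 0].
  move=> nr; have [h1|h1] := leP (complex.Re z) p; first by apply: Or41; apply: px; lra.
  have [h2|h2] := leP q (complex.Re z); first by apply: Or42; apply: px; lra.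
  have [h3|h3] := leP (complex.Im z) r; first by apply: Or43; apply: px; lra.
  have [h4|h4] := leP t (complex.Im z); first by apply: Or44; apply: px; lra.
  by exfalso; apply: nr; split; apply/andP.
pose beta z : R := x1 z ^+ 2 * x2 z ^+ 2 * (x3 z ^+ 2 * x4 z ^+ 2).
have beta0 z : 0 <= beta z :=
  mulr_ge0 (mulr_ge0 (sqr_ge0 _) (sqr_ge0 _)) (mulr_ge0 (sqr_ge0 _) (sqr_ge0 _)).
have bin z : rect p q r t z -> 0 < beta z.
  move=> [/andP[h1 h2] /andP[h3 h4]].
  by apply: mulr_gt0; apply: mulr_gt0; apply: exprn_gt0; apply: py; lra.
have bout z : ~ rect p q r t z -> beta z = 0.
  by move=> /xout[]h; rewrite /beta h expr0n /= ?(mul0r, mulr0).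
have [Eb [dE Eout]] : exists Eb, dbar_pair (fun z => (beta z)%:C) Eb /\
    forall z, ~ rect p q r t z -> Eb z = 0.
  have d := dbarM (dbarM (dbar_pospart_Re 1 (- p)) (dbar_pospart_Re (-1) q))
    (dbarM (dbar_pospart_Im 1 (- r)) (dbar_pospart_Im (-1) t)).
  eexists; split.
    rewrite (_ : (fun z => (beta z)%:C) = fun z => (x1 z ^+ 2)%:C * (x2 z ^+ 2)%:C *
      ((x3 z ^+ 2)%:C * (x4 z ^+ 2)%:C)); first exact: d.
    by apply/funext => z; rewrite /beta !rmorphM.
  move=> z /xout[]; rewrite /x1 /x2 /x3 /x4 => h; rewrite !h expr0n /=;
    by rewrite ?(mulr0, mul0r, rmorph0, addr0).
pose N n : R := n.+1%:R; have N0 n : 0 < N n by rewrite /N ltr0n.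
have den n z : 1 <= 1 + N n * beta z by rewrite lerDl mulr_ge0// ltW.
pose sn n z := (N n)%:C * (beta z)%:C * (1 + (N n)%:C * (beta z)%:C)^-1.
pose sr n z : R := N n * beta z / (1 + N n * beta z).
have snE n z : sn n z = (sr n z)%:C.
  rewrite /sn /sr (real_complexM (N n * beta z)) (real_complexM (N n) (beta z)) real_complexV.
  by rewrite (real_complexD 1) (real_complexM (N n) (beta z)).
have sr01 n z : 0 <= sr n z <= 1.
  have d0 : 0 < 1 + N n * beta z := lt_le_trans ltr01 (den n z).
  have nb : 0 <= N n * beta z by rewrite mulr_ge0// ltW.
  by rewrite /sr divr_ge0 ?(ltW d0)//= ler_pdivrMr// mul1r lerDr.
have snz n : cint (fun z => v z * sn n z) = 0.
  pose rho : R := `|p| + `|q| + `|r| + `|t| + 1.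
  have rho0 : 0 < rho by rewrite ltr_wpDl// !addr_ge0.
  have nrect z : rho < normc z -> ~ rect p q r t z.
    by move=> h /rect_bounded; rewrite /rho in h; lra.
  have dN := dbarZ (N n)%:C dE.
  have dV := @dbarV _ _ _ 1 ltr01 _ (dbarD (dbar_cst 1) dN).
  have hc z : 1 <= normc (1 + (N n)%:C * (beta z)%:C).
    rewrite (_ : 1 + (N n)%:C * (beta z)%:C = (1 + N n * beta z)%:C).
      by rewrite normc_real; apply: le_trans (den n z) (ler_norm _).
    by rewrite real_complexD real_complexM.
  apply: (test _ _ rho rho0 (dbarM dN (dV hc))).
  - by move=> z /nrect/bout->; rewrite rmorph0 mulr0 mul0r.
  - move=> z nD; have nr : ~ rect p q r t z by move=> /sub.
    by rewrite (Eout z nr) (bout z nr) rmorph0 !mulr0 !mul0r addr0.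
have msn n : measurable_fun setT (fun z => v z * sn n z).
  apply: measurable_complexM => //; have [mb _] := dbar_pair_measurable dE.
  apply: measurable_complexM; first exact: measurable_complexM.
  by apply: measurable_complexV; apply: measurable_complexD => //; exact: measurable_complexM.
have mi : measurable_fun setT (fun z => v z * (\1_(rect p q r t) z)%:C).
  apply: measurable_complexM => //; apply: measurable_real_complex.
  by apply: measurable_indic; exact: measurable_rect.
have cv : (fun n => normc (cint (fun z => v z * sn n z) -
    cint (fun z => v z * (\1_(rect p q r t) z)%:C))) @ \oo --> 0.
  apply: (@cint_dominated R _ _ (fun z => normc (v z))) => //.
  - move=> n z; rewrite snE normcM normc_real; have /andP[h0 h1] := sr01 n z.
    by rewrite ger0_norm// ler_piMr// normc_ge0.
  - move=> z; rewrite normcM normc_real indicE; case: (_ \in _).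
      by rewrite normr1 mulr1.
    by rewrite normr0 mulr0 normc_ge0.
  - exact: cintegrable_normc.
  - apply: aeW => z; have [zr|nr] := pselect (rect p q r t z); last first.
      under eq_fun do rewrite snE /sr (bout z nr) mulr0 mul0r indicE memNset//= !mulr0 subrr normc0.
      exact: cvg_cst.
    have b0 := bin z zr.
    apply: (@squeeze_cvgr _ _ _ _ (cst 0) (fun n => normc (v z) / beta z * n.+1%:R^-1)).
    + apply: nearW => n; rewrite normc_ge0 /=.
      have d0 : 0 < 1 + N n * beta z := lt_le_trans ltr01 (den n z).
      rewrite snE indicE mem_set//= (_ : _ - _ = v z * (- (1 + N n * beta z)^-1)%:C); last first.
        rewrite -mulrBr -real_complexB; congr (_ * _%:C).
        rewrite /sr; have y0 := d0; move: (N n * beta z) y0 => y y0.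
        by field; rewrite gt_eqF.
      rewrite normcM normc_real normrN gtr0_norm ?invr_gt0//.
      have q0 : 0 < beta z * n.+1%:R := mulr_gt0 b0 (N0 n).
      have q1 : beta z * n.+1%:R <= 1 + N n * beta z by rewrite [beta z * _]mulrC -/(N n) lerDr.
      by rewrite -mulrA ler_wpM2l ?normc_ge0// -invfM lef_pV2 ?posrE.
    + exact: cvg_cst.
    + rewrite -[X in _ --> X](mulr0 (normc (v z) / beta z)).
      by apply: cvgM; [exact: cvg_cst|exact: cvg_harmonic].
apply: eq0_normc; apply: (cvg_const_eq0 _ cv) => n.
by rewrite snz sub0r normcN.
Qed.

Definition quadrant (x y : R) : set R[i] := [set z | x < complex.Re z /\ y < complex.Im z].

Definition quadrants : set (set R[i]) := [set A | exists x y, A = quadrant x y].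

(** Half-planes are countable unions of quadrants, so both coordinates are measurable for the
    generated sigma-algebra. Quadrants are chosen because they are closed under intersection. *)
Lemma measurable_quadrants : @measurable _ R[i] = <<s quadrants >>.
Proof.
apply/seteqP; split => [A mA|]; last first.
  apply: smallest_sub; first exact: sigma_algebra_measurable.
  move=> _ [x [y ->]].
  rewrite (_ : quadrant x y = (@complex.Re R @^-1` `]x, +oo[%classic) `&`
    (@complex.Im R @^-1` `]y, +oo[%classic)); last first.
    by apply/seteqP; split => z /=; rewrite /quadrant /= !in_itv /= !andbT.
  apply: measurableI; rewrite -[X in measurable X]setTI.
    exact: measurable_complex_Re.
  exact: measurable_complex_Im.
have bd (x : R) : exists n, - n%:R < x.
  exists (Num.bound `|x|); have := archi_boundP (normr_ge0 x).
  by rewrite ltr_norml => /andP[].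
have mid : measurable_fun setT (id : g_sigma_algebraType quadrants -> R[i]).
  apply: ReIm_measurable; apply: (measurability _ (RGenOInfty.measurableE R)) => _ [_ [x ->] <-];
    rewrite setTI.
    rewrite (_ : _ @^-1` _ = \bigcup_n quadrant x (- n%:R)).
      by apply: bigcupT_measurable => n; apply: sub_sigma_algebra; exists x, (- n%:R).
    apply/seteqP; split => z /=; rewrite in_itv /= andbT.
      by move=> zx; have [n hn] := bd (complex.Im z); exists n.
    by move=> [n _ []].
  rewrite (_ : _ @^-1` _ = \bigcup_n quadrant (- n%:R) x).
    by apply: bigcupT_measurable => n; apply: sub_sigma_algebra; exists (- n%:R), x.
  apply/seteqP; split => z /=; rewrite in_itv /= andbT.
    by move=> zx; have [n hn] := bd (complex.Re z); exists n.
  by move=> [n _ []].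
by have := mid measurableT A mA; rewrite setTI.
Qed.

Lemma cintegrable_indic v (A : set R[i]) : cintegrable v -> measurable A ->
  cintegrable (fun z => v z * (\1_A z)%:C).
Proof.
move=> iv mA; apply: (@cintegrableM_bounded _ _ 1) => //.
  by apply: measurable_real_complex; exact: measurable_indic.
move=> z; rewrite normc_real indicE; case: (_ \in _); by rewrite ?normr1 ?normr0.
Qed.

(** Dynkin's theorem: quadrants form a pi-system, [cint v = 0] settles complements, and dominated
    convergence settles disjoint unions. *)
Lemma cint_indic_dynkin v : cintegrable v -> cint v = 0 ->
  (forall x y, cint (fun z => v z * (\1_(quadrant x y) z)%:C) = 0) ->
  forall A, measurable A -> cint (fun z => v z * (\1_A z)%:C) = 0.
Proof.
move=> iv v0 vq A; rewrite measurable_quadrants; move: A.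
apply: (@dynkin_induction _ R[i] quadrants (fun A => cint (fun z => v z * (\1_A z)%:C) = 0)).
- exact: measurable_quadrants.
- move=> _ _ [x [y ->]] [x' [y' ->]]; exists (Num.max x x'), (Num.max y y').
  apply/seteqP; split => z; rewrite /quadrant /= !gt_max.
    by move=> [[-> ->] [-> ->]].
  by move=> [/andP[? ?] /andP[? ?]].
- by rewrite -[RHS]v0; apply: eq_cint => z; rewrite indicT mulr1.
- by move=> _ [x [y ->]]; exact: vq.
- move=> S mS S0; rewrite -[RHS](subrr 0) -{1}v0 -S0 -cintB//; last exact: cintegrable_indic.
  apply: eq_cint => z; rewrite !indicE in_setC; case: (_ \in _) => /=;
    by rewrite ?mulr1 ?mulr0 ?subrr ?subr0.
- move=> F mF tF F0.
  pose f (n : nat) (z : R[i]) : R[i] := \sum_(0 <= i < n) v z * (\1_(F i) z)%:C.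
  have iF i := cintegrable_indic iv (mF i).
  have fz n : cint (f n) = 0.
    by rewrite /f cint_sum// big1.
  (* By disjointness only the index [k] contributes, and it enters the sum over [i < n] once
     [k < n]. *)
  have fin z (k : nat) : F k z -> forall n, f n z = if (k < n)%N then v z else 0.
    move=> Fk; elim => [|n IH]; first by rewrite /f big_nil.
    rewrite /f big_nat_recr//= -/(f n z) IH; have [<-|kn] := eqVneq k n.
      by rewrite ltnn ltnS leqnn indicE mem_set// mulr1 add0r.
    rewrite (ltnS k n) (leq_eqVlt k n) (negbTE kn) /= indicE memNset ?mulr0 ?addr0//.
    by move=> Fn; move: kn; rewrite (tF k n I I)// ?eqxx//; exists z.
  have fout z : ~ (\bigcup_k F k) z -> forall n, f n z = 0.
    move=> nz n; rewrite /f big1// => i _; rewrite indicE memNset ?mulr0//.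
    by move=> Fi; apply: nz; exists i.
  have mv := cintegrable_measurable iv.
  have mU : measurable (\bigcup_k F k) by exact: bigcupT_measurable.
    have iU := cintegrable_indic iv mU.
  have cv : (fun n => normc (cint (f n) - cint (fun z => v z * (\1_(\bigcup_k F k) z)%:C))) @ \oo --> 0.
    apply: (@cint_dominated R _ _ (fun z => normc (v z))) => //.
    + by move=> n; apply: cintegrable_measurable; exact: cintegrable_sum.
    + exact: cintegrable_measurable.
    + move=> n z; have [[k _ Fk]|nz] := pselect ((\bigcup_k F k) z).
        by rewrite (fin z k Fk); case: ifP => // _; rewrite normc0 normc_ge0.
      by rewrite fout// normc0 normc_ge0.
    + move=> z; rewrite normcM normc_real indicE; case: (_ \in _).
        by rewrite normr1 mulr1.
      by rewrite normr0 mulr0 normc_ge0.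
    + exact: cintegrable_normc.
    + apply: aeW => z; have [Uz|nz] := pselect ((\bigcup_k F k) z).
        have [k _ Fk] := Uz; apply/cvgrPdist_le => e e0.
        exists k.+1 => // n kn; rewrite (fin z k Fk) kn indicE mem_set// mulr1 subrr normc0.
        by rewrite subrr normr0 ltW.
      under eq_fun do rewrite (fout z nz) indicE memNset// mulr0 subrr normc0.
      exact: cvg_cst.
  apply: eq0_normc; apply: (cvg_const_eq0 _ cv) => n.
  by rewrite fz sub0r normcN.
Qed.

(** Testing on the set where the real part is positive and on its complement, and subtracting, gives
    the integral of the absolute value of the real part. *)
Lemma Re_ae_eq0 v : cintegrable v ->
  (forall A, measurable A -> cint (fun z => v z * (\1_A z)%:C) = 0) ->
  {ae area, forall z, complex.Re (v z) = 0}.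
Proof.
move=> iv v0; have mv := cintegrable_measurable iv; have [mR _] := measurable_ReIm mv.
pose A : set R[i] := [set z | 0 < complex.Re (v z)].
have mA : measurable A.
  rewrite (_ : A = setT `&` (@complex.Re R \o v) @^-1` `]0, +oo[%classic); first exact: mR.
  by rewrite setTI; apply/seteqP; split => z; rewrite /A /= in_itv /= andbT.
have i1 := cintegrable_indic iv mA; have i2 := cintegrable_indic iv (measurableC mA).
have [mRe _] := measurable_ReIm mv.
have z0 : (\int[area]_z `|(EFin \o (@complex.Re R \o v)) z| = 0)%E.
  transitivity (complex.Re (cint (fun z => v z * (\1_A z)%:C - v z * (\1_(~` A) z)%:C)))%:E; last first.
    by rewrite cintB// v0// v0 ?subrr//; exact: measurableC.
  rewrite -(integral_Re (cintegrableB i1 i2)); apply: eq_integral => z _ /=; congr EFin.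
  rewrite -mulrBr !indicE in_setC; have [Az|nA] := pselect (A z).
    by rewrite mem_set//= subr0 mulr1 gtr0_norm.
  rewrite memNset//= sub0r mulrN1 cReN ler0_norm// leNgt; exact/negP.
have /(ae_eq_integral_abs (@area R) measurableT) : measurable_fun setT (EFin \o (@complex.Re R \o v)).
  exact/measurable_EFinP.
move=> [/(_ z0) h _]; apply: filterS h => z /(_ I) /= [h]; exact: h.
Qed.

Lemma cint_indic_ae_eq0 v : cintegrable v ->
  (forall A, measurable A -> cint (fun z => v z * (\1_A z)%:C) = 0) ->
  {ae area, forall z, v z = 0}.
Proof.
move=> iv v0; have h1 := Re_ae_eq0 iv v0.
pose j : R[i] := complex.Complex 0 1.
have h2 : {ae area, forall z, complex.Re (j * v z) = 0}.
  apply: Re_ae_eq0; first exact: cintegrableZ.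
  move=> A mA; rewrite -[RHS](mulr0 j) -(v0 A mA) -cintZ; last exact: cintegrable_indic.
  by apply: eq_cint => z; rewrite mulrA.
apply: filterS2 h1 h2 => z h1; rewrite cReM h1 /= mul0r mul1r sub0r => /eqP.
by rewrite oppr_eq0 => /eqP h2; exact: (@eq_ReIm R (v z) 0 h1 h2).
Qed.

Lemma commuting_symbol D phi psi (M : R) : domain D -> 0 < M ->
  (forall z, D z -> normc z <= M) -> analytic_on D phi ->
  (forall z, D z -> normc (phi z) <= M) ->
  (exists z w, [/\ D z, D w & phi z <> phi w]) ->
  measurable_fun D psi -> (forall z, D z -> normc (psi z) <= M) ->
  (forall f, bergman D f -> forall z, D z ->
     toeplitz D phi (toeplitz D psi f) z = toeplitz D psi (toeplitz D phi f) z) ->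
  exists2 g, analytic_on D g & {ae area, forall z, D z -> psi z = g z}.
Proof.
move=> dD M0 DM aphi phiM nonc mpsi psiM comm; have [oD _ _] := dD.
have mD := open_complex_measurable oD; have Doo := bounded_area M0 mD DM.
have [g gB o] := toeplitz_powers oD Doo (ltW M0) aphi phiM mpsi psiM comm.
have [sg ag] := (bergmanP _ oD).1 gB; exists g => //.
pose u z := psi z - g z.
have su : sqint D u := sqintB (sqint_bounded mD Doo mpsi (ltW M0) psiM) sg.
have [mu ju] := su.
(* Conjugated and extended by [0], so that orthogonality becomes the vanishing of plain integrals of
   [v] against products. *)
pose v z := Num.conj (cut D u z).
have mv : measurable_fun setT v by exact: measurable_complexJ.
have v0 z : ~ D z -> v z = 0 by move=> nD; rewrite /v cut_out// rmorph0.
(* Square integrability gives integrability because [x <= 1 + x ^ 2] and [D] has finite area. *)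
have iv : cintegrable v.
  have [i1 _] := integrable_indic_bounded 1 mD Doo.
  apply: (@cintegrable_le _ _ (fun z => 1 * \1_D z + normc (cut D u z) ^+ 2)) => //.
    move=> z; rewrite /v normc_conj indicE; have [Dz|nD] := pselect (D z).
      by rewrite mem_set// mulr1; have := sqr_ge0 (normc (cut D u z) - 1); nra.
    by rewrite cut_out// normc0 addr_ge0 ?sqr_ge0// mulr_ge0// ler0n.
  exact: (integrableD measurableT i1 ju).
have ortho n k (B : R) : analytic_on D k -> (forall z, D z -> normc (k z) <= B) ->
    cint (fun z => v z * Num.conj (cut D phi z) ^+ n * cut D k z) = 0.
  move=> ak kB.
  have sk : sqint D k.
    apply: (@sqint_bounded _ _ `|B|) => //; first exact: analytic_measurable.
    by move=> z /kB h; exact: le_trans h (ler_norm _).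
  have kBg : bergman D k := (bergmanP k oD).2 (conj sk ak).
  have := o n k kBg; rewrite innerE => h.
  have aX : analytic_on D (fun z => phi z ^+ n) by exact: analyticX.
  have spn : sqint D (fun z => phi z ^+ n * u z).
    apply: (@sqintM _ _ _ (M ^+ n)) => //.
    - exact: (measurable_cut_analytic oD aX).
    - exact: exprn_ge0 (ltW M0).
    - move=> z Dz; rewrite normcX lerXn2r ?nnegrE ?normc_ge0 ?(ltW M0)//; exact: phiM.
  have hJ := cintJ (inner_integrable spn sk).
  transitivity (Num.conj (0 : R[i])); last by rewrite rmorph0.
  rewrite -{1}h -[RHS]hJ; apply: eq_cint => z; rewrite /v.
  have [Dz|nD] := pselect (D z); last first.
    by rewrite !(cut_out _ nD) mul0r mulr0; apply: eq_ReIm => /=; rewrite ?oppr0.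
  rewrite !cutE// -[RHS]/(Num.conj (phi z ^+ n * u z * Num.conj (k z))).
  by rewrite !rmorphM rmorphXn [X in _ = _ * X]conjCK; congr (_ * _); rewrite mulrC.
have cau a : D a -> cintegrable (fun z => v z / (z - a)) -> cint (fun z => v z / (z - a)) = 0.
  exact: (cauchy_transform_eq0 dD M0 aphi phiM nonc iv v0 ortho).
have test s E (rho : R) : 0 < rho -> dbar_pair s E -> (forall z, rho < normc z -> s z = 0) ->
    (forall z, ~ D z -> E z = 0) -> cint (fun z => v z * s z) = 0.
  move=> rho0 sE sout ED; apply: (cauchy_test rho0 M0 iv _ sE sout ED cau).
  by move=> z zM; apply: v0 => /DM; rewrite leNgt zM.
have negl : (area : set R[i] -> \bar R).-negligible [set z | D z /\ v z <> 0].
  apply: local_negligible => c [Dc _].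
  have [d d0 bD] := open_ball_radius (ltr0n R 2) oD Dc.
  have SD : square c d `<=` D by move=> z /square_normc_lt h; apply: bD; exact: ltW.
  have mS := measurable_square c d.
  (* Restricting [v] to a square inside [D] admits all quadrants as test sets: a quadrant cuts this
     square in a rectangle contained in [D], to which [cint_rect] applies. *)
  pose w z := v z * (\1_(square c d) z)%:C.
  have iw : cintegrable w by exact: cintegrable_indic.
  have w0 : cint w = 0 by exact: (cint_rect iv test SD).
  have wq x y : cint (fun z => w z * (\1_(quadrant x y) z)%:C) = 0.
    have eS : square c d `&` quadrant x y = rect (Num.max (complex.Re c - d) x) (complex.Re c + d)
        (Num.max (complex.Im c - d) y) (complex.Im c + d).
      apply/seteqP; split => z; rewrite /square /rect /quadrant /= !gt_max.
        by move=> [[/andP[-> ->] /andP[-> ->]] [-> ->]].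
      by move=> [/andP[/andP[-> ->] ->] /andP[/andP[-> ->] ->]].
    rewrite -[RHS](@cint_rect D v (Num.max (complex.Re c - d) x) (complex.Re c + d)
        (Num.max (complex.Im c - d) y) (complex.Im c + d) iv test); last first.
      by rewrite -eS; exact: subset_trans (@subIsetl _ _ _) SD.
    by rewrite -eS; apply: eq_cint => z; rewrite /w indicI /= rmorphM mulrA.
  exists d => //.
  have := cint_indic_ae_eq0 iw (cint_indic_dynkin iw w0 wq).
  apply: negligibleS => z [[Dz vz] zd] /= wz; apply: vz.
  by move: wz; rewrite /w indicE mem_set ?mulr1//; exact: normc_lt_square.
apply: negligibleS negl => z /= /not_implyP[Dz ne]; split => // vz; apply: ne.
apply/eqP; rewrite -subr_eq0 -/(u z) -(cutE u Dz) -[cut D u z]conjCK.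
by rewrite -[Num.conj (cut D u z)]/(v z) vz rmorph0.
Qed.

End BoundedSymbols.

Theorem mainTheorem1 (R : realType) (Omega : set R[i])
  (phi psi : R[i] -> R[i]) :
  domain Omega ->
  bounded_set Omega ->
  analytic_on Omega phi ->
  [bounded phi z | z in Omega] ->
  (exists z w, [/\ Omega z, Omega w & phi z <> phi w]) ->
  measurable_fun Omega psi ->
  [bounded psi z | z in Omega] ->
  (forall f, bergman Omega f -> forall z, Omega z ->
     toeplitz Omega phi (toeplitz Omega psi f) z =
     toeplitz Omega psi (toeplitz Omega phi f) z) ->
  exists2 g, analytic_on Omega g &
    {ae area, forall z, Omega z -> psi z = g z}.
Proof.
move=> dO bO aphi bphi nonc mpsi bpsi comm.
have [M1 M10 h1] := boundedset_normcP bO.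
have [M2 M20 h2] := bounded_normcP bphi.
have [M3 M30 h3] := bounded_normcP bpsi.
have M0 : 0 < M1 + M2 + M3 by rewrite !addr_gt0.
apply: (commuting_symbol dO M0 _ aphi _ nonc mpsi _ comm).
- by move=> z /h1; lra.
- by move=> z /h2; lra.
- by move=> z /h3; lra.
Qed.
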